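(* Let $B$ be the open unit ball of $\mathbb{C}^n$ with respect to an arbitrary norm on $\mathbb{C}^n$. Let $g:\mathbb{U}\to\mathbb{C}$ be a univalent holomorphic function such that $g(0)=1$, $g(\overline{\zeta})=\overline{g(\zeta)}$ and $\Re g(\zeta)>0$ for all $\zeta\in\mathbb{U}$. Assume that $g(\rho)=O(1-\rho)$ as $\rho\to1-0$. Then there exists an unbounded support point for $S_g^0(B)$.
   Context: $\mathbb{U}$ is the open unit disc in $\mathbb{C}$; $\|\cdot\|$ is the given norm on $X=\mathbb{C}^n$. $H(B)$ is the space of holomorphic maps $B\to\mathbb{C}^n$ with locally uniform convergence; $f$ is normalized if $f(0)=0$, $Df(0)=I$. For $z\neq0$, $T(z)=\{l_z\in L(\mathbb{C}^n,\mathbb{C}):\|l_z\|=1,\ l_z(z)=\|z\|\}$. $\mathcal{M}(B)$ is the set of normalized $h\in H(B)$ with $\Re l_z(h(z))>0$ for all $z\in B\setminus\{0\}$, $l_z\in T(z)$. $\mathcal{M}_g(B)$ is the set of normalized $h\in H(B)$ with $\frac1{\|z\|}l_z(h(z))\in g(\mathbb{U})$ for all $z\in B\setminus\{0\}$, $l_z\in T(z)$. A Herglotz vector field is $h:B\times[0,\infty)\to\mathbb{C}^n$ with $h(\cdot,t)\in\mathcal{M}(B)$ for all $t\ge0$ and $h(z,\cdot)$ measurable for all $z$. $S_g^0(B)$ (maps with $g$-parametric representation) is the set of normalized $f\in H(B)$ for which there is a Herglotz vector field $h$ with $h(\cdot,t)\in\mathcal{M}_g(B)$ for a.e. $t\ge0$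 and $f(z)=\lim_{t\to\infty}e^tv(z,t)$ locally uniformly on $B$, where $v(z,\cdot)$ is the unique locally Lipschitz solution on $[0,\infty)$ of $\frac{\partial v}{\partial t}=-h(v,t)$ for a.e. $t\ge0$, $v(z,0)=z$. A support point of $E\subseteq H(B)$ is $f\in E$ for which there is a continuous linear functional $\Lambda:H(B)\to\mathbb{C}$ with $\Re\Lambda|_E$ not constant and $\Re\Lambda(f)=\max_{q\in E}\Re\Lambda(q)$. It is unbounded if $f$ is an unbounded mapping on $B$. *)

(* Defs.v *)
From HB Require Import structures.
From mathcomp Require Import all_boot all_order all_algebra.
From mathcomp Require Import all_classical all_reals all_analysis.
From mathcomp.real_closed Require Import complex.

Set Implicit Arguments.
Unset Strict Implicit.
Unset Printing Implicit Defensive.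

Import Order.TTheory GRing.Theory Num.Theory.
Import numFieldNormedType.Exports.

Local Open Scope classical_set_scope.
Local Open Scope ring_scope.

(* R[i] packaged as a numFieldType, so that the topological and normed
   structures that numFieldNormedType attaches to numeric fields are inferred
   for it and for 'rV[Cplx R]_n. *)
Definition Cplx (R : realType) : numFieldType := R[i].

Definition cofR (R : realType) (x : R) : Cplx R := real_complex R x.
Definition cRe (R : realType) (z : Cplx R) : R := complex.Re z.
Definition cconj (R : realType) (z : Cplx R) : Cplx R := conjc z.
(* The real-valued modulus; `|z| on Cplx R takes its values in Cplx R. *)
Definition cmod (R : realType) (z : Cplx R) : R := ComplexField.Normc.normc z.

Definition unit_disc (R : realType) : set (Cplx R) := [set z | cmod z < 1].
Arguments unit_disc R _ : clear implicits.

(* Complex Frechet differentiability at every point: the scalar field of V and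
   W is Cplx R.  Maps are total functions, only their values on D matter. *)
Definition holomorphic_on (R : realType) (V W : normedModType (Cplx R))
    (D : set V) (f : V -> W) : Prop :=
  forall z, D z -> differentiable f z.

Section Ball.
Variables (R : realType) (n : nat).
Local Notation C := (Cplx R).
Local Notation X := 'rV[Cplx R]_n.

(* All norms on C^n induce the topology of the library's sup norm on 'rV_n, which
   is the one used for differentiability, compactness and convergence. *)
Definition is_norm (N : X -> R) : Prop :=
  [/\ forall x y, N (x + y) <= N x + N y,
      forall (a : C) x, N (a *: x) = cmod a * N x
    & forall x, N x = 0 -> x = 0].

Variable N : X -> R.

Definition unit_ball : set X := [set z | N z < 1].

Definition dual_norm (l : {linear X -> C}) : R :=
  sup [set cmod (l x) | x in [set x | N x <= 1]].

Definition support_functionals (z : X) : set {linear X -> C} :=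
  [set l : {linear X -> C} | dual_norm l = 1 /\ l z = cofR (N z)].

(* Topology of uniform convergence on the compact subsets of the ball, i.e. of
   locally uniform convergence there.  It does not separate functions that agree on
   the ball, so a continuous functional only depends on values on the ball. *)
Definition mapsB := {family compactly_in unit_ball, X -> X}.

Definition holB : set mapsB := [set f | holomorphic_on unit_ball f].

Definition normalized (f : X -> X) : Prop :=
  f 0 = 0 /\ ('d f 0 : X -> X) = idfun.

Definition calM : set mapsB :=
  [set h | [/\ holB h, normalized h &
    forall z l, unit_ball z -> z != 0 -> support_functionals z l ->
      0 < cRe (l (h z))]].

Definition calMg (g : C -> C) : set mapsB :=
  [set h | [/\ holB h, normalized h &
    forall z l, unit_ball z -> z != 0 -> support_functionals z l ->
      (g @` unit_disc R) (cofR (N z)^-1 * l (h z))]].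

(* Lebesgue measurable on [0, +oo[: the Caratheodory sigma-algebra of the Lebesgue
   outer measure on the source, the Borel sigma-algebra on the target. *)
Definition lebesgue_measurable_on_nneg (u : R -> X) : Prop :=
  @measurable_fun _ _ (caratheodory_type (wlength (idfun : R -> R))^*%mu)
    (g_sigma_algebraType (@open X)) `[0, +oo[ u.

Definition herglotz_vector_field (h : X -> R -> X) : Prop :=
  (forall t, 0 <= t -> calM (h ^~ t)) /\
  (forall z, unit_ball z -> lebesgue_measurable_on_nneg (h z)).

Definition locally_lipschitz_on_nneg (u : R -> X) : Prop :=
  forall t0, 0 <= t0 -> exists L d : R, 0 < d /\
    forall s t, 0 <= s -> 0 <= t -> `|s - t0| < d -> `|t - t0| < d ->
      N (u s - u t) <= L * `|s - t|.

(* Derivative with respect to a real variable; the library's derivative would need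
   X to be a normed module over R. *)
Definition has_real_derivative (u : R -> X) (t : R) (d : X) : Prop :=
  (fun s : R => cofR s^-1 *: (u (t + s) - u t)) @ 0^' --> d.

Definition loewner_solution (h : X -> R -> X) (z : X) (u : R -> X) : Prop :=
  [/\ forall t, 0 <= t -> unit_ball (u t),
      locally_lipschitz_on_nneg u,
      {ae @lebesgue_measure R, forall t, 0 <= t ->
        has_real_derivative u t (- h (u t) t)}
    & u 0 = z].

Definition S0g (g : C -> C) : set mapsB :=
  [set f | [/\ holB f, normalized f &
    exists (h : X -> R -> X) (v : X -> R -> X),
    [/\ herglotz_vector_field h,
        {ae @lebesgue_measure R, forall t, 0 <= t -> calMg g (h ^~ t)},
        forall z, unit_ball z -> loewner_solution h z (v z)
      & {family compactly_in unit_ball,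
          (fun (t : R) (z : X) => cofR (expR t) *: v z t) @ +oo --> f}]]].

Definition continuous_linear_functional (L : mapsB -> C) : Prop :=
  (forall (a : C) (f q : X -> X), holB f -> holB q ->
    L (fun z => a *: f z + q z) = a * L f + L q) /\
  {within holB, continuous L}.

Definition support_point (E : set mapsB) (f : mapsB) : Prop :=
  E f /\ exists L : mapsB -> C,
    [/\ continuous_linear_functional L,
        ~ (exists c : R, forall q, E q -> cRe (L q) = c)
      & forall q, E q -> cRe (L q) <= cRe (L f)].

Definition unbounded_on_ball (f : X -> X) : Prop :=
  ~ (exists M : R, forall z, unit_ball z -> N (f z) <= M).

End Ball.

Arguments holB {R n} N _.
Arguments calM {R n} N _.
Arguments calMg {R n} N g _.
Arguments S0g {R n} N g _.
Arguments support_point {R n N} E f.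

(* Main.v *)
(* Let [u] be a unit vector, [l] a functional of norm 1 with [l u = 1], and let
   [f z = exp (Phi (l z)) z] with [Phi' w = (1 / g w - 1) / w].  The function
   [F w = w exp (Phi w)] satisfies [F = w g(w) F'], hence is starlike, and
   [f] is embedded in the Loewner chain of the field [h z = g (l z) z].

   The functional is the second Taylor coefficient of [w |-> l (q (w u))].  For
   [q] with [g]-parametric representation the Schwarz lemma applied to
   [g^-1 o (l o h)] along complex lines gives
   [Re l_v (h v) >= |v| (1 - a |v|)] near [0] for every [a > |g'(0)|], so that
   [e^t |v(t)| <= r + a r^2 + O(r^3)] along a trajectory starting at norm [r],
   and the coefficient has real part at most [|g'(0)|].  It equals
   [- g'(0) = |g'(0)|] at [f] and [0] at the identity.

   Finally [Re Phi (x)] tends to infinity as [x] tends to [1], since its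
   derivative is at least [1 / (K (1 - x)) - 2] when [g x <= K (1 - x)]. *)

Require Import Defs.
From HB Require Import structures.
From mathcomp Require Import all_boot all_order all_algebra.
From mathcomp Require Import all_classical all_reals all_analysis.
From mathcomp.real_closed Require Import complex.
From mathcomp Require Import ring lra measurable_realfun.

Import Order.TTheory GRing.Theory Num.Theory.
Import numFieldNormedType.Exports.

Local Open Scope classical_set_scope.
Local Open Scope ring_scope.

Set Implicit Arguments.
Unset Strict Implicit.
Unset Printing Implicit Defensive.

(** Two obstacles shape the upper bound: the field is merely measurable in time, and [N] need not be
    differentiable. A functional supporting [N] at [V t] still bounds the increments of [N (V t)] to
    the left of [t], at almost every [t], so the growth estimate rests on a monotonicity principle
    for left increments outside a null set. Every slope [a > |g'(0)|] is allowed since the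
    coefficient is read off as [r] tends to 0. Equality at [f] needs [g'(0)] real and nonpositive:
    [g] is real on the real axis, and as it decays at 1 it could not exceed 1 on (0,1) without
    taking the value [g 0] twice. The growth hypothesis thus serves extremality as well as
    unboundedness. On the side of [f], the function [F] is multiplied by [e^-t] along the solutions
    of [w' = - w g(w)]. The flow is therefore written as [F^-1 (e^-t F w0)], and what has to be
    proved is that [F] is injective with image starlike about 0. The function theory rests on
    Goursat's theorem for rectangles, carried to annuli by the exponential; the later results on
    holomorphic functions are drawn from means over circles. *)

(** * Real and imaginary parts, real-valued modulus, epsilon-delta forms of limits *)

Section ComplexModulus.
Context {R : realType}.
Local Notation C := (Cplx R).
Implicit Types (z w : C) (x y : R).

Definition cIm z : R := complex.Im z.

Lemma normCE z : `|z| = cofR (cmod z).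
Proof. by case: z. Qed.

Lemma cmodM z w : cmod (z * w) = cmod z * cmod w.
Proof. exact: ComplexField.Normc.normcM. Qed.

Lemma cmodV z : cmod z^-1 = (cmod z)^-1.
Proof. exact: ComplexField.Normc.normcV. Qed.

Lemma cmodD z w : cmod (z + w) <= cmod z + cmod w.
Proof. exact: le_normcD. Qed.

Lemma cmodN z : cmod (- z) = cmod z.
Proof. exact: normcN. Qed.

Lemma cmod0 : cmod (0 : C) = 0.
Proof. exact: ComplexField.Normc.normc0. Qed.

Lemma cmod1 : cmod (1 : C) = 1.
Proof. exact: ComplexField.Normc.normc1. Qed.

Lemma cmod_ge0 z : 0 <= cmod z.
Proof. by case: z => a b; apply: sqrtr_ge0. Qed.

Lemma cmod_eq0 z : (cmod z == 0) = (z == 0).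
Proof.
apply/eqP/eqP => [/ComplexField.Normc.eq0_normc //|->]; exact: cmod0.
Qed.

Lemma cmod_gt0 z : (0 < cmod z) = (z != 0).
Proof. by rewrite lt_def cmod_ge0 andbT cmod_eq0. Qed.

Lemma cmodX z k : cmod (z ^+ k) = cmod z ^+ k.
Proof. by elim: k => [|k IH]; rewrite ?expr0 ?cmod1 // !exprS cmodM IH. Qed.

Lemma cmodB z w : cmod (z - w) = cmod (w - z).
Proof. by rewrite -cmodN opprB. Qed.

Lemma cmod_triB z w : cmod z - cmod w <= cmod (z - w).
Proof. by rewrite lerBlDr -{1}(subrK w z) cmodD. Qed.

Lemma cmod_cofR x : cmod (cofR x) = `|x|.
Proof. by rewrite /cmod /cofR /= expr0n addr0 sqrtr_sqr. Qed.

Lemma cofRD x y : cofR (x + y) = cofR x + cofR y. Proof. exact: rmorphD. Qed.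
Lemma cofRN x : cofR (- x) = - cofR x. Proof. exact: rmorphN. Qed.
Lemma cofRB x y : cofR (x - y) = cofR x - cofR y. Proof. exact: rmorphB. Qed.
Lemma cofRM x y : cofR (x * y) = cofR x * cofR y. Proof. exact: rmorphM. Qed.
Lemma cofRV x : cofR x^-1 = (cofR x)^-1. Proof. exact: fmorphV. Qed.
Lemma cofR0 : cofR (0 : R) = 0. Proof. by []. Qed.
Lemma cofR1 : cofR (1 : R) = 1. Proof. by []. Qed.
Lemma cofR_nat k : cofR (k%:R : R) = k%:R. Proof. exact: rmorph_nat. Qed.
Lemma cofR_eq0 x : (cofR x == 0) = (x == 0). Proof. exact: fmorph_eq0. Qed.

Lemma cofR_lt x y : (cofR x < cofR y) = (x < y).
Proof. by rewrite /cofR ltcE /= eqxx. Qed.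

Lemma cofR_le x y : (cofR x <= cofR y) = (x <= y).
Proof. by rewrite /cofR lecE /= eqxx. Qed.

Lemma pos_cofR z : 0 < z -> exists2 x, 0 < x & z = cofR x.
Proof.
case: z => a b; rewrite ltcE /= => /andP[/eqP b0 a0]; exists a => //.
by rewrite /cofR /real_complex_def /= b0.
Qed.

Lemma cReD z w : cRe (z + w) = cRe z + cRe w. Proof. by case: z; case: w. Qed.
Lemma cReN z : cRe (- z) = - cRe z. Proof. by case: z. Qed.
Lemma cReB z w : cRe (z - w) = cRe z - cRe w.
Proof. by rewrite cReD cReN. Qed.
Lemma cImD z w : cIm (z + w) = cIm z + cIm w. Proof. by case: z; case: w. Qed.
Lemma cImN z : cIm (- z) = - cIm z. Proof. by case: z. Qed.
Lemma cImB z w : cIm (z - w) = cIm z - cIm w.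
Proof. by rewrite cImD cImN. Qed.
Lemma cReM z w : cRe (z * w) = cRe z * cRe w - cIm z * cIm w.
Proof. by case: z; case: w. Qed.
Lemma cImM z w : cIm (z * w) = cRe z * cIm w + cIm z * cRe w.
Proof. by case: z; case: w. Qed.
Lemma cRe_cofR x : cRe (cofR x) = x. Proof. by []. Qed.
Lemma cIm_cofR x : cIm (cofR x) = 0. Proof. by []. Qed.
Lemma cRe_real x z : cRe (cofR x * z) = x * cRe z.
Proof. by rewrite cReM /= mul0r subr0. Qed.
Lemma cIm_real x z : cIm (cofR x * z) = x * cIm z.
Proof. by rewrite cImM /= mul0r addr0. Qed.

Definition cI : C := Complex 0 1.

Lemma cplx_eq z w : cRe z = cRe w -> cIm z = cIm w -> z = w.
Proof. by case: z => a b; case: w => c d /= -> ->. Qed.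

Lemma cplxE z : z = cofR (cRe z) + cofR (cIm z) * cI.
Proof.
apply: cplx_eq; rewrite ?cReD ?cImD ?cRe_real ?cIm_real /=.
  by rewrite mulr0 addr0.
by rewrite mulr1 add0r.
Qed.

Lemma cIsq : cI * cI = -1.
Proof.
by apply: cplx_eq; rewrite ?cReM ?cImM /= ?cReN ?cImN /=;
   rewrite ?(mul0r, mulr0, mulr1, addr0, add0r, oppr0).
Qed.

Lemma cmod_sq z : cmod z ^+ 2 = cRe z ^+ 2 + cIm z ^+ 2.
Proof. by case: z => a b; rewrite /cmod /= sqr_sqrtr // addr_ge0 ?sqr_ge0. Qed.

Lemma cRe_le_cmod z : `|cRe z| <= cmod z.
Proof.
rewrite -(ler_pXn2r (n := 2)) ?nnegrE ?cmod_ge0 // cmod_sq real_normK ?num_real //.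
by rewrite lerDl sqr_ge0.
Qed.

Lemma cIm_le_cmod z : `|cIm z| <= cmod z.
Proof.
rewrite -(ler_pXn2r (n := 2)) ?nnegrE ?cmod_ge0 // cmod_sq real_normK ?num_real //.
by rewrite lerDr sqr_ge0.
Qed.

Lemma cmod_cI : cmod cI = 1.
Proof.
apply/eqP; rewrite -(eqrXn2 (n := 2)) ?cmod_ge0 // cmod_sq /=.
by rewrite expr0n add0r.
Qed.

Lemma cmod_le_ReIm z : cmod z <= `|cRe z| + `|cIm z|.
Proof.
rewrite {1}[z]cplxE (le_trans (cmodD _ _)) // cmodM !cmod_cofR cmod_cI mulr1 //.
Qed.

Lemma cRe_le z : cRe z <= cmod z.
Proof. exact: le_trans (ler_norm _) (cRe_le_cmod z). Qed.

Lemma cmod_sum I (s : seq I) (P : pred I) (f : I -> C) :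
  cmod (\sum_(i <- s | P i) f i) <= \sum_(i <- s | P i) cmod (f i).
Proof.
elim/big_rec2 : _ => [|i y z _ h]; first by rewrite cmod0.
by rewrite (le_trans (cmodD _ _)) // lerD2l.
Qed.

(** The norm of [Cplx R] takes its values in [Cplx R], so the radii of the topology are complex. A
    positive complex number is real, by [pos_cofR], and all later estimates use real radii. *)
Lemma nbhsCP (z : C) (P : C -> Prop) :
  (\forall w \near z, P w) <->
  exists2 e : R, 0 < e & forall w, cmod (w - z) < e -> P w.
Proof.
split.
  move=> h; have [e /= /pos_cofR[x x0 ->] He] := (nbhs_normP z P).1 h; exists x => // w wz.
  by apply: He; rewrite /= normCE cofR_lt cmodB.
move=> [x x0 He]; apply: (nbhs_normP z P).2; exists (cofR x); first by rewrite /= -cofR0 cofR_lt.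
by move=> w /=; rewrite normCE cofR_lt cmodB; exact: He.
Qed.

Lemma cvgCP {T : Type} (F : set_system T) {FF : Filter F} (f : T -> C) (l : C) :
  f @ F --> l <-> forall e : R, 0 < e -> \forall t \near F, cmod (f t - l) < e.
Proof.
split.
  move=> /cvgrPdist_lt h e e0; have := h (cofR e); rewrite -cofR0 cofR_lt.
  by move=> /(_ e0); apply: filterS => t; rewrite normCE cofR_lt cmodB.
move=> h; apply/cvgrPdist_lt => e /pos_cofR[x x0 ->].
by apply: filterS (h x x0) => t; rewrite normCE cofR_lt cmodB.
Qed.

Lemma contCP (f : C -> C) (z : C) :
  {for z, continuous f} <->
  forall e : R, 0 < e -> exists2 d : R, 0 < d &
    forall w, cmod (w - z) < d -> cmod (f w - f z) < e.
Proof.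
split.
  move=> h e e0.
  by have [d d0 H] := (nbhsCP z _).1 ((cvgCP (F := nbhs z) f (f z)).1 h e e0);
    exists d.
move=> h; apply: (cvgCP (F := nbhs z) f (f z)).2 => e e0; apply: (nbhsCP z _).2.
have [d d0 H] := h e e0.
by exists d.
Qed.

(** In this product form the point [w = z] needs no exception and nothing is divided, which is what
    the estimates below manipulate. *)
Lemma deriveCP (f : C -> C) (z d : C) :
  is_derive z 1 f d <->
  forall e : R, 0 < e -> exists2 r : R, 0 < r &
    forall w, cmod (w - z) < r ->
      cmod (f w - f z - d * (w - z)) <= e * cmod (w - z).
Proof.
have key : is_derive z 1 f d <->
    (fun h : C => h^-1 *: (f (h *: (1 : C) + z) - f z)) @ 0^' --> d.
  split; first by case=> h1 <-.
  move=> h; have dv : derivable f z 1 by rewrite /derivable; apply/cvg_ex; exists d.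
  exact: DeriveDef dv (cvg_lim (@norm_hausdorff _ _) h).
rewrite key; split.
  move=> h e e0; have [r r0 H] := (nbhsCP 0 _).1 ((cvgCP _ _).1 h e e0).
  exists r => // w wr; have [->|wz] := eqVneq w z.
    by rewrite !subrr mulr0 subr0 cmod0 mulr0.
  have := H (w - z); rewrite subr0 => /(_ wr); rewrite subr_eq0 => /(_ wz).
  have e1 : (w - z) *: (1 : C) + z = w by rewrite [_ *: _]mulr1 subrK.
  rewrite e1 => /ltW h1.
  have wz' : w - z != 0 by rewrite subr_eq0.
  have -> : f w - f z - d * (w - z) = ((w - z)^-1 *: (f w - f z) - d) * (w - z).
    by rewrite mulrBl -[_ *: _]/(_ * _) mulrAC mulVf // mul1r.
  by rewrite cmodM ler_wpM2r // cmod_ge0.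
move=> h; apply: (cvgCP _ _).2 => e e0; apply: (nbhsCP 0 _).2.
have [|r r0 H] := h (e / 2); first by rewrite divr_gt0.
exists r => // w; rewrite subr0 => wr w0.
have := H (w *: (1 : C) + z); rewrite addrK [_ *: _]mulr1 => /(_ wr) h1.
have -> : w^-1 *: (f (w + z) - f z) - d = (f (w + z) - f z - d * w) * w^-1.
  by rewrite [RHS]mulrBl mulfK // [_ *: _]mulrC.
rewrite cmodM cmodV; have w1 : 0 < cmod w by rewrite cmod_gt0.
rewrite ltr_pdivrMr // (le_lt_trans h1) // ltr_pM2r //.
by rewrite ltr_pdivrMr // mulr_natr mulr2n ltrDl.
Qed.

End ComplexModulus.

(** * Path integrals and Goursat's theorem *)

Section PathIntegral.
Context {R : realType}.
Local Notation C := (Cplx R).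
Local Notation mu := (@lebesgue_measure R).
Implicit Types (a b x y : R) (phi psi : R -> C).

Lemma nbhsRP x (P : R -> Prop) :
  (\forall w \near x, P w) <->
  exists2 e : R, 0 < e & forall w, `|w - x| < e -> P w.
Proof.
split.
  move=> h; have [e /= e0 He] := (nbhs_normP x P).1 h; exists e => // w wx.
  by apply: He; rewrite /= distrC.
move=> [e e0 He]; apply: (nbhs_normP x P).2; exists e => //= w.
by rewrite /= distrC; exact: He.
Qed.

Lemma contRP phi x :
  {for x, continuous phi} <->
  forall e : R, 0 < e -> exists2 d : R, 0 < d &
    forall y, `|y - x| < d -> cmod (phi y - phi x) < e.
Proof.
split.
  move=> h e e0.
  by have [d d0 H] := (nbhsRP x _).1 ((cvgCP (F := nbhs x) phi (phi x)).1 h e e0);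
    exists d.
move=> h; apply: (cvgCP (F := nbhs x) phi (phi x)).2 => e e0; apply: (nbhsRP x _).2.
by have [d d0 H] := h e e0; exists d.
Qed.

Lemma contRRP (u : R -> R) x :
  {for x, continuous u} <->
  forall e : R, 0 < e -> exists2 d : R, 0 < d &
    forall y, `|y - x| < d -> `|u y - u x| < e.
Proof.
split.
  move=> h e e0.
  have h1 : \forall t \near nbhs x, `|u x - u t| < e.
    by move/cvgrPdist_lt : h; apply.
  by have [d d0 H] := (nbhsRP x _).1 h1; exists d => // y /H; rewrite distrC.
move=> h; apply: (cvgrPdist_lt (F := nbhs x) u (u x)).2 => e e0.
apply: (nbhsRP x _).2.
by have [d d0 H] := h e e0; exists d => // y /H; rewrite distrC.
Qed.

Lemma deriveRP (u : R -> R) (x d : R) :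
  is_derive x 1 u d <->
  forall e : R, 0 < e -> exists2 r : R, 0 < r &
    forall y, `|y - x| < r -> `|u y - u x - d * (y - x)| <= e * `|y - x|.
Proof.
have key : is_derive x 1 u d <->
    (fun h : R => h^-1 *: (u (h *: (1 : R) + x) - u x)) @ 0^' --> d.
  split; first by case=> h1 <-.
  move=> h; have dv : derivable u x 1 by rewrite /derivable; apply/cvg_ex; exists d.
  by split => //; apply/cvg_lim.
rewrite key; split.
  move=> h e e0.
  have h1 : \forall t \near 0^', `|d - (t^-1 *: (u (t *: (1 : R) + x) - u x))| < e.
    by move/cvgrPdist_lt : h; apply.
  have [r r0 H] := (nbhsRP 0 _).1 h1.
  exists r => // w wr; have [->|wz] := eqVneq w x.
    by rewrite !subrr mulr0 subr0 normr0 mulr0.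
  have := H (w - x); rewrite subr0 => /(_ wr); rewrite subr_eq0 => /(_ wz).
  have e1 : (w - x) *: (1 : R) + x = w by rewrite [_ *: _]mulr1 subrK.
  rewrite e1 distrC => /ltW h2.
  have wz' : w - x != 0 by rewrite subr_eq0.
  have -> : u w - u x - d * (w - x) = ((w - x)^-1 *: (u w - u x) - d) * (w - x).
    by rewrite mulrBl -[_ *: _]/(_ * _) mulrAC mulVf // mul1r.
  by rewrite normrM ler_wpM2r.
move=> h; apply: (cvgrPdist_lt _ _).2 => e e0; apply: (nbhsRP 0 _).2.
have [|r r0 H] := h (e / 2); first by rewrite divr_gt0.
exists r => // w; rewrite subr0 => wr w0; rewrite distrC.
have := H (w *: (1 : R) + x); rewrite addrK [_ *: _]mulr1 => /(_ wr) h1.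
have -> : w^-1 *: (u (w + x) - u x) - d = (u (w + x) - u x - d * w) * w^-1.
  by rewrite [RHS]mulrBl mulfK // [_ *: _]mulrC.
rewrite normrM normfV; have w1 : 0 < `|w| by rewrite normr_gt0.
rewrite ltr_pdivrMr // (le_lt_trans h1) // ltr_pM2r //.
by rewrite ltr_pdivrMr // mulr_natr mulr2n ltrDl.
Qed.

(** Derivative along a real variable. Source and target have different scalar fields, so the
    increment estimate itself serves as the definition. *)
Definition rderiv phi x (d : C) : Prop :=
  forall e : R, 0 < e -> exists2 r : R, 0 < r &
    forall y, `|y - x| < r ->
      cmod (phi y - phi x - d * cofR (y - x)) <= e * `|y - x|.

Lemma rderiv_Re phi x d : rderiv phi x d ->
  is_derive x 1 (fun t => cRe (phi t)) (cRe d).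
Proof.
move=> h; apply/deriveRP => e e0; have [r r0 H] := h e e0.
exists r => // y /H; apply: le_trans.
by rewrite (le_trans _ (cRe_le_cmod _)) // !cReB [d * _]mulrC cRe_real [_ * cRe d]mulrC.
Qed.

Lemma rderiv_Im phi x d : rderiv phi x d ->
  is_derive x 1 (fun t => cIm (phi t)) (cIm d).
Proof.
move=> h; apply/deriveRP => e e0; have [r r0 H] := h e e0.
exists r => // y /H; apply: le_trans.
by rewrite (le_trans _ (cIm_le_cmod _)) // !cImB [d * _]mulrC cIm_real [_ * cIm d]mulrC.
Qed.

Lemma rderiv_cont phi x d : rderiv phi x d -> {for x, continuous phi}.
Proof.
move=> h; apply/contRP => e e0; have [r r0 H] := h 1 ltr01.
have dp : 0 < cmod d + 1 by rewrite ltr_wpDl ?cmod_ge0.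
exists (Num.min r (e / (cmod d + 1))); first by rewrite lt_min r0 divr_gt0.
move=> y; rewrite lt_min => /andP[/H h1 h2].
have -> : phi y - phi x = (phi y - phi x - d * cofR (y - x)) + d * cofR (y - x).
  by rewrite subrK.
rewrite (le_lt_trans (cmodD _ _)) // cmodM cmod_cofR.
rewrite (le_lt_trans (lerD h1 (lexx _))) // -mulrDl [1 + _]addrC.
by rewrite mulrC -ltr_pdivlMr.
Qed.

Lemma rderiv_comp (f : C -> C) phi x p d :
  is_derive (phi x) 1 f d -> rderiv phi x p ->
  rderiv (fun t => f (phi t)) x (d * p).
Proof.
move=> /deriveCP hf hp e e0.
have pd : 0 < cmod p + 1 by rewrite ltr_wpDl ?cmod_ge0.
have dd : 0 < cmod d + 1 by rewrite ltr_wpDl ?cmod_ge0.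
have e1 : 0 < e / 2 / (cmod p + 1) by rewrite !divr_gt0.
have e2 : 0 < e / 2 / (cmod d + 1) by rewrite !divr_gt0.
have [r1 r10 H1] := hf _ e1; have [r2 r20 H2] := hp _ e2.
have [r3 r30 H3] := hp _ ltr01.
have [r4 r40 H4] := (contRP phi x).1 (rderiv_cont hp) r1 r10.
exists (Num.min (Num.min r2 r3) r4); first by rewrite !lt_min r20 r30 r40.
move=> y; rewrite !lt_min => /andP[/andP[/H2 h2 /H3 h3] /H4/H1 h1].
have h4 : cmod (phi y - phi x) <= (cmod p + 1) * `|y - x|.
  have -> : phi y - phi x = (phi y - phi x - p * cofR (y - x)) + p * cofR (y - x).
    by rewrite subrK.
  rewrite (le_trans (cmodD _ _)) // cmodM cmod_cofR mulrDl addrC.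
  by rewrite lerD2l.
have -> : f (phi y) - f (phi x) - d * p * cofR (y - x) =
   (f (phi y) - f (phi x) - d * (phi y - phi x)) +
   d * (phi y - phi x - p * cofR (y - x)) by ring.
rewrite (le_trans (cmodD _ _)) // cmodM.
have := ler_wpM2l (ltW e1) h4.
rewrite mulrA divfK ?gt_eqF // => h5.
have h6 : cmod d * cmod (phi y - phi x - p * cofR (y - x)) <= e / 2 * `|y - x|.
  have := ler_wpM2l (cmod_ge0 d) h2 => /le_trans; apply.
  rewrite mulrA ler_wpM2r // mulrCA ler_piMr //; first by rewrite divr_ge0 // ltW.
  by rewrite ler_pdivrMr // mul1r lerDl.
rewrite (le_trans (lerD (le_trans h1 h5) h6)) // -mulrDl.
by rewrite (_ : e / 2 + e / 2 = e) //; field.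
Qed.

Lemma rderiv_cofR x : rderiv (fun t => cofR t) x 1.
Proof.
move=> e e0; exists 1 => // y _.
by rewrite mul1r cofRB subrr cmod0 mulr_ge0 // ltW.
Qed.

Lemma cont_Re phi x : {for x, continuous phi} ->
  {for x, continuous (fun t => cRe (phi t))}.
Proof.
move=> /contRP h; apply/contRRP => e /h [d d0 H]; exists d => // y /H.
by apply: le_lt_trans; rewrite -cReB cRe_le_cmod.
Qed.

Lemma cont_Im phi x : {for x, continuous phi} ->
  {for x, continuous (fun t => cIm (phi t))}.
Proof.
move=> /contRP h; apply/contRRP => e /h [d d0 H]; exists d => // y /H.
by apply: le_lt_trans; rewrite -cImB cIm_le_cmod.
Qed.

Definition path_continuous a b phi : Prop :=
  forall x, a <= x <= b -> {for x, continuous phi}.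

Definition cint a b phi : C :=
  Complex (\int[mu]_(x in `[a, b]) cRe (phi x))
          (\int[mu]_(x in `[a, b]) cIm (phi x)).

Lemma within_cont (u : R -> R) a b :
  (forall x, a <= x <= b -> {for x, continuous u}) ->
  {within `[a, b], continuous u}.
Proof.
move=> h; apply: continuous_in_subspaceT => x /[!inE] /=.
by rewrite in_itv /=; exact: h.
Qed.

Lemma cont_integrable (u : R -> R) a b :
  (forall x, a <= x <= b -> {for x, continuous u}) ->
  mu.-integrable `[a, b] (EFin \o u).
Proof.
move=> h; apply: continuous_compact_integrable; first exact: segment_compact.
exact: within_cont.
Qed.

Lemma path_int_Re a b phi : path_continuous a b phi ->
  mu.-integrable `[a, b] (EFin \o (fun t => cRe (phi t))).
Proof. by move=> h; apply: cont_integrable => x /h; exact: cont_Re. Qed.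

Lemma path_int_Im a b phi : path_continuous a b phi ->
  mu.-integrable `[a, b] (EFin \o (fun t => cIm (phi t))).
Proof. by move=> h; apply: cont_integrable => x /h; exact: cont_Im. Qed.

Lemma cint_eq a b phi psi :
  (forall x, a <= x <= b -> phi x = psi x) -> cint a b phi = cint a b psi.
Proof.
by move=> h; congr Complex; apply: eq_Rintegral => x; rewrite inE /= in_itv /=
  => /h ->.
Qed.

Lemma cintD a b phi psi : path_continuous a b phi -> path_continuous a b psi ->
  cint a b (fun t => phi t + psi t) = cint a b phi + cint a b psi.
Proof.
move=> h1 h2; apply: cplx_eq; rewrite ?cReD ?cImD /=.
  rewrite -RintegralD //; try exact: path_int_Re.
  by apply: eq_Rintegral => x _; rewrite cReD.
rewrite -RintegralD //; try exact: path_int_Im.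
by apply: eq_Rintegral => x _; rewrite cImD.
Qed.

Lemma integrableZR (c : R) a b (u : R -> R) :
  mu.-integrable `[a, b] (EFin \o u) ->
  mu.-integrable `[a, b] (EFin \o (fun t => c * u t)).
Proof.
move=> h; rewrite (_ : _ \o _ = (fun t => c%:E * (EFin \o u) t)%E) //.
exact: integrableZl.
Qed.

Lemma cintZ a b (c : C) phi : path_continuous a b phi ->
  cint a b (fun t => c * phi t) = c * cint a b phi.
Proof.
move=> h; have h1 := path_int_Re h; have h2 := path_int_Im h.
apply: cplx_eq; rewrite ?cReM ?cImM /=.
  rewrite -!RintegralZl // -RintegralB //; try exact: integrableZR.
  by apply: eq_Rintegral => x _; rewrite cReM.
rewrite -!RintegralZl // -RintegralD //; try exact: integrableZR.
by apply: eq_Rintegral => x _; rewrite cImM.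
Qed.

Lemma path_continuousB a b phi psi :
  path_continuous a b phi -> path_continuous a b psi ->
  path_continuous a b (fun t => phi t - psi t).
Proof. by move=> h1 h2 x xab; apply: cvgB; [exact: h1|exact: h2]. Qed.

Lemma path_continuousM a b phi psi :
  path_continuous a b phi -> path_continuous a b psi ->
  path_continuous a b (fun t => phi t * psi t).
Proof. by move=> h1 h2 x xab; apply: cvgM; [exact: h1|exact: h2]. Qed.

Lemma path_continuous_cst a b (c : C) : path_continuous a b (fun=> c).
Proof. by move=> x _; exact: cvg_cst. Qed.

Lemma cintB a b phi psi : path_continuous a b phi -> path_continuous a b psi ->
  cint a b (fun t => phi t - psi t) = cint a b phi - cint a b psi.
Proof.
move=> h1 h2; have [c cE] : exists c : C, c = -1 by exists (-1).
have h3 := path_continuousM (@path_continuous_cst a b c) h2.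
have -> : cint a b (fun t => phi t - psi t) = cint a b (fun t => phi t + c * psi t).
  by apply: cint_eq => x _; rewrite cE mulN1r.
by rewrite cintD // cintZ // cE mulN1r.
Qed.

Lemma Rint_bound (u : R -> R) a b M : a <= b ->
  (forall x, a <= x <= b -> {for x, continuous u}) ->
  (forall x, a <= x <= b -> `|u x| <= M) ->
  `|\int[mu]_(x in `[a, b]) u x| <= M * (b - a).
Proof.
move=> ab uc uM; have iu := cont_integrable uc.
apply: (le_trans (le_normr_Rintegral _ _)) => //.
have -> : M * (b - a) = \int[mu]_(x in `[a, b]) (fun=> M) x.
  rewrite Rintegral_cst //= lebesgue_measure_itv /= lte_fin.
  case: ltP => //= ba; rewrite ?EFinN ?fine0 //.
  by rewrite (_ : b = a) ?subrr ?mulr0 //; apply/eqP; rewrite eq_le ab ba.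
apply: le_Rintegral => //.
- exact: (integrable_norm iu).
- apply: cont_integrable => x _; exact: cvg_cst.
Qed.

(* The constant 2 comes from bounding real and imaginary parts separately. *)
Lemma cint_bound a b phi M : a <= b -> path_continuous a b phi ->
  (forall x, a <= x <= b -> cmod (phi x) <= M) ->
  cmod (cint a b phi) <= 2 * M * (b - a).
Proof.
move=> ab h hM; apply: le_trans (cmod_le_ReIm _) _ => /=.
rewrite -mulrA mulr_natl mulr2n; apply: lerD; apply: Rint_bound => // x xab.
- by apply: cont_Re; exact: h.
- exact: le_trans (cRe_le_cmod _) (hM _ xab).
- by apply: cont_Im; exact: h.
- exact: le_trans (cIm_le_cmod _) (hM _ xab).
Qed.

Lemma Rint_split (u : R -> R) a m b : a <= m <= b ->
  (forall x, a <= x <= b -> {for x, continuous u}) ->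
  \int[mu]_(x in `[a, b]) u x =
  \int[mu]_(x in `[a, m]) u x + \int[mu]_(x in `[m, b]) u x.
Proof.
move=> /andP[am mb] uc.
have iu := cont_integrable uc.
have := Rintegral_itvB (f := u) (a := BLeft a) (b := BRight b) (x := m) iu.
rewrite !bnd_simp => /(_ am mb) /eqP; rewrite subr_eq => /eqP ->.
rewrite Rintegral_itv_obnd_cbnd 1?addrC //.
apply: integrableS iu => //= x; rewrite /= !in_itv /= => /andP[mx ->].
by rewrite (le_trans am (ltW mx)).
Qed.

Lemma cint_split a m b phi : a <= m <= b -> path_continuous a b phi ->
  cint a b phi = cint a m phi + cint m b phi.
Proof.
move=> amb h; apply: cplx_eq; rewrite ?cReD ?cImD /=; apply: Rint_split => // x.
  by move=> /h; exact: cont_Re.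
by move=> /h; exact: cont_Im.
Qed.

Lemma Rint_FTC (F u : R -> R) a b : a <= b ->
  (forall x, a <= x <= b -> is_derive x 1 F (u x)) ->
  (forall x, a <= x <= b -> {for x, continuous u}) ->
  \int[mu]_(x in `[a, b]) u x = F b - F a.
Proof.
rewrite le_eqVlt => /predU1P[<- _ _|ab dF cu].
  by rewrite set_itv1 Rintegral_set1 subrr.
have cF x : a <= x <= b -> {for x, continuous F}.
  move=> /dF [d _]; apply: differentiable_continuous.
  exact/derivable1_diffP.
rewrite /Rintegral (@continuous_FTC2 _ u F) //=.
- exact: within_cont.
- split.
  + move=> x; rewrite in_itv /= => /andP[ax xb].
    by have [] := dF x (introT andP (conj (ltW ax) (ltW xb))).
  + by apply: cvg_at_right_filter; apply: cF; rewrite lexx ltW.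
  + by apply: cvg_at_left_filter; apply: cF; rewrite lexx ltW.
- move=> x; rewrite in_itv /= => /andP[ax xb].
  by have [_ <-] := dF x (introT andP (conj (ltW ax) (ltW xb))); rewrite derive1E.
Qed.

Lemma cint_FTC (F u : R -> C) a b : a <= b ->
  (forall x, a <= x <= b -> rderiv F x (u x)) -> path_continuous a b u ->
  cint a b u = F b - F a.
Proof.
move=> ab dF cu; apply: cplx_eq; rewrite ?cReB ?cImB /=.
  exact: (Rint_FTC ab (fun x xab => rderiv_Re (dF x xab))
                      (fun x xab => cont_Re (cu x xab))).
exact: (Rint_FTC ab (fun x xab => rderiv_Im (dF x xab))
                    (fun x xab => cont_Im (cu x xab))).
Qed.

Lemma cint_cst a b (c : C) : a <= b -> cint a b (fun=> c) = c * cofR (b - a).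
Proof.
move=> ab; rewrite (cint_FTC (F := fun t => c * cofR t)) //.
- by rewrite cofRB mulrBr.
- move=> x _ e e0; exists 1 => // y _.
  by rewrite cofRB mulrBr subrr cmod0 mulr_ge0 // ltW.
- exact: path_continuous_cst.
Qed.

End PathIntegral.

(** * Pointwise continuity of algebraic combinations *)

Section ContinuityRules.
Context {R : realType} {T : topologicalType}.
Local Notation C := (Cplx R).
Implicit Types (f h : T -> C) (x : T).

Lemma cont_cst (c : C) x : {for x, continuous (fun _ : T => c)}.
Proof. exact: cvg_cst. Qed.

Lemma contD f h x : {for x, continuous f} -> {for x, continuous h} ->
  {for x, continuous (fun t => f t + h t)}.
Proof. by move=> fc hc; exact: (cvgD fc hc). Qed.

Lemma contB f h x : {for x, continuous f} -> {for x, continuous h} ->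
  {for x, continuous (fun t => f t - h t)}.
Proof. by move=> fc hc; exact: (cvgB fc hc). Qed.

Lemma contM f h x : {for x, continuous f} -> {for x, continuous h} ->
  {for x, continuous (fun t => f t * h t)}.
Proof. by move=> fc hc; exact: (cvgM fc hc). Qed.

Lemma contV f x : f x != 0 -> {for x, continuous f} ->
  {for x, continuous (fun t => (f t)^-1)}.
Proof. by move=> f0 fc; exact: (cvgV f0 fc). Qed.

Lemma contX f x k : {for x, continuous f} ->
  {for x, continuous (fun t => f t ^+ k)}.
Proof.
move=> fc; elim: k => [|k IH]; first exact: cont_cst.
have -> : (fun t => f t ^+ k.+1) = (fun t => f t * f t ^+ k).
  by apply/funext => t; rewrite exprS.
exact: contM.
Qed.

End ContinuityRules.
Arguments cont_cst {R T} c x.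

Lemma cont_idC {R : realType} (z : Cplx R) : {for z, continuous (fun w : Cplx R => w)}.
Proof. exact: cvg_id. Qed.
Arguments cont_idC {R} z.

(** * Goursat's theorem on rectangles by bisection *)

Section Goursat.
Context {R : realType}.
Local Notation C := (Cplx R).
Implicit Types (a b c d x y w h : R).

(** If [P] failed, dependent choice would produce nested rectangles, each a quarter of the previous
    one, on which [P] fails. They shrink to a point, where the local hypothesis is contradicted. A
    rectangle is given by its lower left corner and its sides. *)
Lemma rectangle_bisection (P : R -> R -> R -> R -> Prop) a c w h :
  0 <= w -> 0 <= h ->
  (forall x y w h, 0 <= w -> 0 <= h ->
     P x y (w / 2) (h / 2) -> P (x + w / 2) y (w / 2) (h / 2) ->
     P x (y + h / 2) (w / 2) (h / 2) ->
     P (x + w / 2) (y + h / 2) (w / 2) (h / 2) -> P x y w h) ->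
  (forall px py, exists2 e, 0 < e & forall x y w h,
     x <= px <= x + w -> y <= py <= y + h -> w < e -> h < e ->
     P x y w h) ->
  P a c w h.
Proof.
move=> w0 h0 Psplit Ploc; apply: contrapT => nP.
pose Q (q : R * R * R * R) := let: (x, y, w, h) := q in
  0 <= w /\ 0 <= h /\ ~ P x y w h.
pose T := {q | Q q}.
pose S (q q' : T) := let: (x, y, w, h) := sval q in
  let: (x', y', w', h') := sval q' in
  [/\ w' = w / 2, h' = h / 2, x <= x' <= x + w / 2 & y <= y' <= y + h / 2].
have [] := @dependent_choice T S _ (exist _ (a, c, w, h) (conj w0 (conj h0 nP))).
  case=> -[[[x y] w1] h1] /= [w10 [h10 nP1]]; apply: cid.
  have h12 : 0 <= h1 / 2 by rewrite divr_ge0.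
  have w12 : 0 <= w1 / 2 by rewrite divr_ge0.
  have mk x' y' : ~ P x' y' (w1 / 2) (h1 / 2) -> x <= x' <= x + w1 / 2 ->
      y <= y' <= y + h1 / 2 ->
      exists t : T, S (exist _ (x, y, w1, h1) (conj w10 (conj h10 nP1))) t.
    move=> nP' xx yy.
    by exists (exist _ (x', y', w1 / 2, h1 / 2) (conj w12 (conj h12 nP'))).
  have [p1|/mk] := pselect (P x y (w1 / 2) (h1 / 2)); last first.
    by apply; rewrite lexx lerDl.
  have [p2|/mk] := pselect (P (x + w1 / 2) y (w1 / 2) (h1 / 2)); last first.
    by apply; rewrite lexx lerDl ?andbT.
  have [p3|/mk] := pselect (P x (y + h1 / 2) (w1 / 2) (h1 / 2)); last first.
    by apply; rewrite lexx lerDl ?andbT.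
  have [p4|/mk] := pselect (P (x + w1 / 2) (y + h1 / 2) (w1 / 2) (h1 / 2)).
    by exfalso; apply: (nP1); exact: Psplit.
  by apply; rewrite lexx lerDl ?andbT.
move=> f [f0 fS].
pose X k := (sval (f k)).1.1.1; pose Y k := (sval (f k)).1.1.2.
have dim k : (sval (f k)).1.2 = w / 2 ^+ k /\ (sval (f k)).2 = h / 2 ^+ k.
  elim: k => [|k [IH1 IH2]]; first by rewrite f0 /= !expr0 !divr1.
  have := fS k; rewrite /S; move: IH1 IH2.
  case: (sval (f k)) => -[[x y] w1] h1; case: (sval (f k.+1)) => -[[x' y'] w'] h' /=.
  by move=> -> -> [-> -> _ _]; rewrite exprSr !invfM !mulrA.
have XS k : X k <= X k.+1 <= X k + w / 2 ^+ k.+1.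
  have := fS k; have := dim k; rewrite /S /X.
  case: (sval (f k)) => -[[x y] w1] h1; case: (sval (f k.+1)) => -[[x' y'] w'] h' /=.
  by move=> [-> ->] [_ _ + _]; rewrite exprSr !invfM !mulrA.
have YS k : Y k <= Y k.+1 <= Y k + h / 2 ^+ k.+1.
  have := fS k; have := dim k; rewrite /S /Y.
  case: (sval (f k)) => -[[x y] w1] h1; case: (sval (f k.+1)) => -[[x' y'] w'] h' /=.
  by move=> [-> ->] [_ _ _]; rewrite exprSr !invfM !mulrA.
(* The left ends increase and the right ends decrease, so the supremum of the left ends lies in
   every interval. *)
have nest (Z : nat -> R) (s : R) : 0 <= s ->
    (forall k, Z k <= Z k.+1 <= Z k + s / 2 ^+ k.+1) ->
    forall k, Z k <= sup (range Z) <= Z k + s / 2 ^+ k.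
  move=> s0 ZS.
  have Zmono j k : (j <= k)%N -> Z j <= Z k.
    move=> /subnK <-; elim: (k - j)%N => [|i IH]; first by rewrite add0n.
    by apply: le_trans IH _; have /andP[] := ZS (i + j)%N.
  have Zup j k : (j <= k)%N -> Z k + s / 2 ^+ k <= Z j + s / 2 ^+ j.
    move=> /subnK <-; elim: (k - j)%N => [|i IH]; first by rewrite add0n.
    apply: le_trans IH; have /andP[_ +] := ZS (i + j)%N.
    rewrite addSn exprS => Zle.
    have : s / 2 ^+ (i + j) = s / (2 * 2 ^+ (i + j)) + s / (2 * 2 ^+ (i + j)).
      by field; rewrite expf_neq0.
    by move: Zle; lra.
  have sk k : 0 <= s / 2 ^+ k by rewrite divr_ge0 // exprn_ge0.
  have ub k j : Z j <= Z k + s / 2 ^+ k.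
    have [jk|kj] := leqP j k.
      by rewrite (le_trans (Zmono _ _ jk)) // lerDl.
    by rewrite (le_trans _ (Zup _ _ (ltnW kj))) // lerDl.
  move=> k; apply/andP; split.
    apply: ub_le_sup; last by exists k.
    by exists (Z k + s / 2 ^+ k) => _ [j _ <-].
  by apply: ge_sup; [exists (Z 0%N), 0%N|move=> _ [j _ <-]].
have hX := nest X w w0 XS; have hY := nest Y h h0 YS.
have [e e0 He] := Ploc (sup (range X)) (sup (range Y)).
(* Any [k > (w + h) / e] will do, because [k < 2 ^+ k]. *)
have [k hk] : exists k, w / 2 ^+ k < e /\ h / 2 ^+ k < e.
  have wh : 0 <= w + h by rewrite addr_ge0.
  have := archi_boundP (divr_ge0 wh (ltW e0)).
  set k := Num.Def.archi_bound _ => hk; exists k.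
  have k2 : (w + h) / 2 ^+ k < e.
    rewrite ltr_pdivrMr ?exprn_gt0 // mulrC -ltr_pdivrMr //.
    apply: lt_trans hk _; rewrite -natrX ltr_nat; exact: ltn_expl.
  have i2 : 0 <= (2 ^+ k)^-1 :> R by rewrite invr_ge0 exprn_ge0.
  split; apply: le_lt_trans k2; rewrite ler_wpM2r //.
    by rewrite lerDl.
  by rewrite lerDr.
have := hX k; have := hY k; have := dim k; rewrite /X /Y.
case: (f k) => -[[[x y] w1] h1] /= [_ [_ nPk]] [w1E h1E].
move: nPk; rewrite w1E h1E => nPk hy hx; apply: nPk.
by have [k1 k2] := hk; exact: He.
Qed.

Definition cpt x y : C := Complex x y.

Lemma cmod_cpt x y : cmod (cpt x y) <= `|x| + `|y|.
Proof. exact: cmod_le_ReIm. Qed.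

Lemma cptE x y : cpt x y = cofR x + cofR y * cI.
Proof. exact: (cplxE (cpt x y)). Qed.

Lemma cont_hslice (G : C -> C) x y : {for cpt x y, continuous G} ->
  {for x, continuous (fun t => G (cpt t y))}.
Proof.
move=> /contCP H; apply/contRP => e /H [r r0 Hr]; exists r => // t tx.
apply: Hr; apply: le_lt_trans tx.
by rewrite !cptE opprD addrACA subrr addr0 -cofRB cmod_cofR.
Qed.

Lemma cont_vslice (G : C -> C) x y : {for cpt x y, continuous G} ->
  {for y, continuous (fun t => G (cpt x t))}.
Proof.
move=> /contCP H; apply/contRP => e /H [r r0 Hr]; exists r => // t tx.
apply: Hr; apply: le_lt_trans tx.
by rewrite !cptE opprD addrACA subrr add0r -mulrBl -cofRB cmodM cmod_cofR cmod_cI mulr1.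
Qed.

Definition rect_cont (G : C -> C) a b c d :=
  forall x y, a <= x <= b -> c <= y <= d -> {for cpt x y, continuous G}.

(** Contour integral along the boundary of the rectangle, counterclockwise; [cI] is the derivative
    of the parametrisation of the vertical sides. *)
Definition rect_int (G : C -> C) a b c d : C :=
  cint a b (fun x => G (cpt x c)) - cint a b (fun x => G (cpt x d)) +
  cI * (cint c d (fun y => G (cpt b y)) - cint c d (fun y => G (cpt a y))).

Lemma rect_hpath G a b c d x0 x1 y : rect_cont G a b c d ->
  a <= x0 -> x1 <= b -> c <= y <= d ->
  path_continuous x0 x1 (fun x => G (cpt x y)).
Proof.
move=> Gc ax0 x1b ycd x /andP[x0x xx1]; apply: cont_hslice; apply: Gc => //.
by rewrite (le_trans ax0) // (le_trans xx1).
Qed.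

Lemma rect_vpath G a b c d y0 y1 x : rect_cont G a b c d ->
  c <= y0 -> y1 <= d -> a <= x <= b ->
  path_continuous y0 y1 (fun y => G (cpt x y)).
Proof.
move=> Gc cy0 y1d xab y /andP[y0y yy1]; apply: cont_vslice; apply: Gc => //.
by rewrite (le_trans cy0) // (le_trans yy1).
Qed.

Lemma rect_int_hsplit G a m b c d : a <= m <= b -> c <= d ->
  rect_cont G a b c d ->
  rect_int G a b c d = rect_int G a m c d + rect_int G m b c d.
Proof.
move=> amb cd Gc; have /andP[am mb] := amb.
rewrite /rect_int (cint_split amb); last first.
  by apply: (rect_hpath Gc) => //; rewrite lexx cd.
rewrite (cint_split amb); last by apply: (rect_hpath Gc) => //; rewrite lexx cd.
ring.
Qed.

Lemma rect_int_vsplit G a b c m d : c <= m <= d -> a <= b ->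
  rect_cont G a b c d ->
  rect_int G a b c d = rect_int G a b c m + rect_int G a b m d.
Proof.
move=> cmd ab Gc; have /andP[cm md] := cmd.
rewrite /rect_int (cint_split (a := c) cmd); last first.
  by apply: (rect_vpath Gc) => //; rewrite lexx ab.
rewrite (cint_split (a := c) cmd); last first.
  by apply: (rect_vpath Gc) => //; rewrite lexx ab.
ring.
Qed.

Lemma rect_intB G H a b c d : a <= b -> c <= d ->
  rect_cont G a b c d -> rect_cont H a b c d ->
  rect_int (fun z => G z - H z) a b c d = rect_int G a b c d - rect_int H a b c d.
Proof.
move=> ab cd Gc Hc; have aa : a <= a <= b by rewrite lexx ab.
have bb : a <= b <= b by rewrite lexx ab.
have cc : c <= c <= d by rewrite lexx cd.
have dd : c <= d <= d by rewrite lexx cd.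
rewrite /rect_int !cintB; first ring.
- exact: (rect_vpath Gc (lexx c) (lexx d) aa).
- exact: (rect_vpath Hc (lexx c) (lexx d) aa).
- exact: (rect_vpath Gc (lexx c) (lexx d) bb).
- exact: (rect_vpath Hc (lexx c) (lexx d) bb).
- exact: (rect_hpath Gc (lexx a) (lexx b) dd).
- exact: (rect_hpath Hc (lexx a) (lexx b) dd).
- exact: (rect_hpath Gc (lexx a) (lexx b) cc).
- exact: (rect_hpath Hc (lexx a) (lexx b) cc).
Qed.

(** The perimeter contributes [2 * ((b - a) + (d - c))], and the other factor 2 is that of
    [cint_bound]. *)
Lemma rect_int_bound G a b c d M : a <= b -> c <= d ->
  rect_cont G a b c d ->
  (forall x y, a <= x <= b -> c <= y <= d -> cmod (G (cpt x y)) <= M) ->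
  cmod (rect_int G a b c d) <= 4 * M * ((b - a) + (d - c)).
Proof.
move=> ab cd Gc GM.
have aa : a <= a <= b by rewrite lexx ab.
have bb : a <= b <= b by rewrite lexx ab.
have cc : c <= c <= d by rewrite lexx cd.
have dd : c <= d <= d by rewrite lexx cd.
have h1 := cint_bound ab (rect_hpath Gc (lexx a) (lexx b) cc) (fun x xab => GM x c xab cc).
have h2 := cint_bound ab (rect_hpath Gc (lexx a) (lexx b) dd) (fun x xab => GM x d xab dd).
have h3 := cint_bound cd (rect_vpath Gc (lexx c) (lexx d) aa) (fun y ycd => GM a y aa ycd).
have h4 := cint_bound cd (rect_vpath Gc (lexx c) (lexx d) bb) (fun y ycd => GM b y bb ycd).
rewrite /rect_int (le_trans (cmodD _ _)) // cmodM cmod_cI mul1r.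
set A := cint a b _ in h1 *; set B := cint a b _ in h2 *.
set D := cint c d _ in h3 *; set E := cint c d _ in h4 *.
have := cmodD A (- B); have := cmodD E (- D); rewrite !cmodN.
move: (cmod A) (cmod B) (cmod D) (cmod E) (cmod _) (cmod _) h1 h2 h3 h4 => /=.
by move=> *; lra.
Qed.

(** The primitive [P] turns each side into a difference of values at two corners, and the four
    differences cancel. *)
Lemma rect_int_affine (al be : C) a b c d : a <= b -> c <= d ->
  rect_int (fun z => al + be * z) a b c d = 0.
Proof.
move=> ab cd; rewrite /rect_int.
pose P (z : C) := al * z + be / 2 * z ^+ 2.
have dP (z : C) : is_derive z 1 P (al + be * z).
  apply/deriveCP => e e0; have d1 : 0 < e / (cmod (be / 2) + 1).
    by rewrite divr_gt0 // ltr_wpDl ?cmod_ge0.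
  exists (e / (cmod (be / 2) + 1)) => // w wz.
  have -> : P w - P z - (al + be * z) * (w - z) = (be / 2) * (w - z) * (w - z).
    by rewrite /P; field.
  rewrite cmodM ler_wpM2r ?cmod_ge0 // cmodM.
  move: wz; rewrite ltr_pdivlMr ?ltr_wpDl ?cmod_ge0 // mulrC => /ltW.
  by apply: le_trans; rewrite ler_wpM2r ?cmod_ge0 // lerDl.
have dh y x : rderiv (fun t => P (cpt t y)) x (al + be * cpt x y).
  rewrite -[al + _]mulr1; apply: (rderiv_comp (phi := fun t => cpt t y) (dP _)).
  move=> e e0; exists 1 => // t _; rewrite !cptE opprD addrACA subrr addr0 mul1r.
  by rewrite cofRB subrr cmod0 mulr_ge0 // ltW.
have dv x y : rderiv (fun t => P (cpt x t)) y ((al + be * cpt x y) * cI).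
  apply: (rderiv_comp (phi := fun t => cpt x t) (dP _)).
  move=> e e0; exists 1 => // t _; rewrite !cptE opprD addrACA subrr add0r cofRB.
  by rewrite [cI * _]mulrC -mulrBl subrr cmod0 mulr_ge0 // ltW.
have hc y x0 x1 : path_continuous x0 x1 (fun x => al + be * cpt x y).
  move=> x _; apply: (cont_hslice (G := fun z => al + be * z)).
  exact: (contD (cont_cst al _) (contM (cont_cst be _) (cont_idC _))).
have vc x y0 y1 : path_continuous y0 y1 (fun y => al + be * cpt x y).
  move=> y _; apply: (cont_vslice (G := fun z => al + be * z)).
  exact: (contD (cont_cst al _) (contM (cont_cst be _) (cont_idC _))).
have Hh y : cint a b (fun x => al + be * cpt x y) = P (cpt b y) - P (cpt a y).
  by rewrite (cint_FTC (F := fun t => P (cpt t y))).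
have Hv x : cI * cint c d (fun y => al + be * cpt x y) = P (cpt x d) - P (cpt x c).
  rewrite -cintZ // -(cint_FTC (F := fun t => P (cpt x t)) (u := fun y => cI * (al + be * cpt x y))) //.
    by move=> y _; rewrite mulrC.
  by apply: path_continuousM => //; exact: path_continuous_cst.
rewrite mulrBr !Hh !Hv; ring.
Qed.

Lemma cmod_arbitrarily_small (z : C) :
  (forall e : R, 0 < e -> cmod z <= e) -> z = 0.
Proof.
move=> h; apply/eqP; rewrite -cmod_eq0 eq_le cmod_ge0 andbT.
by apply/ler_addgt0Pr => e /h; rewrite add0r.
Qed.

(** The bound [e * (w + h) ^+ 2] is inherited from the four quarters, since it scales by 4 like the
    area. Near a point it holds because the affine part of [G] integrates to 0 and the remainder is
    at most [e / 4 * (w + h)], the [4] being that of [rect_int_bound]. *)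
Lemma goursat (G : C -> C) a b c d : a <= b -> c <= d ->
  (forall x y, a <= x <= b -> c <= y <= d -> differentiable G (cpt x y)) ->
  rect_int G a b c d = 0.
Proof.
move=> ab cd dG.
have Gc : rect_cont G a b c d.
  by move=> x y xab ycd; apply: differentiable_continuous; exact: dG.
suff key (e : R) : 0 < e -> cmod (rect_int G a b c d) <= e * ((b - a) + (d - c)) ^+ 2.
  apply: cmod_arbitrarily_small => e e0.
  have s0 : 0 < ((b - a) + (d - c)) ^+ 2 + 1 by rewrite ltr_wpDl ?sqr_ge0.
  have e1 : 0 < e / (((b - a) + (d - c)) ^+ 2 + 1) by rewrite divr_gt0.
  apply: le_trans (key _ e1) _.
  by rewrite -mulrA ler_piMr ?(ltW e0) // mulrC ler_pdivrMr // mul1r lerDl.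
move=> e0.
pose P x y w h := 0 <= w -> 0 <= h -> a <= x -> x + w <= b -> c <= y -> y + h <= d ->
  cmod (rect_int G x (x + w) y (y + h)) <= e * (w + h) ^+ 2.
suff : P a c (b - a) (d - c).
  by rewrite /P [a + _]addrC [c + _]addrC !subrK !subr_ge0 ab cd !lexx; apply.
apply: rectangle_bisection; rewrite ?subr_ge0 //.
- move=> x y w h w0 h0 P1 P2 P3 P4 _ _ ax xb cy yd.
  have w2 : 0 <= w / 2 by rewrite divr_ge0.
  have h2 : 0 <= h / 2 by rewrite divr_ge0.
  have sub x0 x1 y0 y1 : a <= x0 -> x1 <= b -> c <= y0 -> y1 <= d ->
      rect_cont G x0 x1 y0 y1.
    move=> h1 h2' h3 h4 u v /andP[xu uw] /andP[yv vh]; apply: Gc.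
      by rewrite (le_trans h1 xu) (le_trans uw h2').
    by rewrite (le_trans h3 yv) (le_trans vh h4).
  have xw : x + w / 2 + w / 2 = x + w by field.
  have yh : y + h / 2 + h / 2 = y + h by field.
  have xx : x <= x + w / 2 <= x + w by apply/andP; split; lra.
  have yy : y <= y + h / 2 <= y + h by apply/andP; split; lra.
  have yh' : y <= y + h by lra.
  rewrite (rect_int_hsplit xx yh' (sub _ _ _ _ ax xb cy yd)).
  have s1 : rect_cont G x (x + w / 2) y (y + h) by apply: sub => //; lra.
  have s2 : rect_cont G (x + w / 2) (x + w) y (y + h) by apply: sub => //; lra.
  rewrite (rect_int_vsplit yy _ s1); last by lra.
  rewrite (rect_int_vsplit yy _ s2); last by lra.
  have ax' : a <= x + w / 2 by clear -ax w2; lra.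
  have cy' : c <= y + h / 2 by clear -cy h2; lra.
  have xb' : x + w / 2 <= b by clear -xb w0; lra.
  have yd' : y + h / 2 <= d by clear -yd h0; lra.
  have xb2 : x + w / 2 + w / 2 <= b by rewrite xw.
  have yd2 : y + h / 2 + h / 2 <= d by rewrite yh.
  have q1 := P1 w2 h2 ax xb' cy yd'.
  have q2 := P2 w2 h2 ax' xb2 cy yd'.
  have q3 := P3 w2 h2 ax xb' cy' yd2.
  have q4 := P4 w2 h2 ax' xb2 cy' yd2.
  move: q2 q3 q4; rewrite !xw !yh => q2 q3 q4.
  set A := rect_int _ _ _ _ _ in q1 *; set D := rect_int _ _ _ _ _ in q3 *.
  set E := rect_int _ _ _ _ _ in q2 *; set F := rect_int _ _ _ _ _ in q4 *.
  have := cmodD (A + D) (E + F); have := cmodD A D; have := cmodD E F.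
  have -> : e * (w + h) ^+ 2 = 4 * (e * (w / 2 + h / 2) ^+ 2) by field.
  clear -q1 q2 q3 q4; lra.
- move=> px py.
  (* At a point outside the given rectangle the claim is void: no subrectangle contains it. *)
  have [[pin1 pin2]|nin] := pselect (a <= px <= b /\ c <= py <= d); last first.
    have [pxa|] := ltP px a.
      exists 1 => // x y w h /andP[? _] _ _ _ _ _ ? _ _ _; lra.
    have [pxb|] := ltP b px.
      exists 1 => // x y w h /andP[_ ?] _ _ _ _ _ _ ? _ _; lra.
    have [pya|] := ltP py c.
      exists 1 => // x y w h _ /andP[? _] _ _ _ _ _ _ ? _; lra.
    have [pyb|] := ltP d py.
      exists 1 => // x y w h _ /andP[_ ?] _ _ _ _ _ _ _ ?; lra.
    by move=> *; case: nin; split; apply/andP; split.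
  have /derivable1_diffP/derivableP/deriveCP := dG _ _ pin1 pin2.
  set p := cpt px py; set G' := 'D_1 G p => /(_ (e / 4)) [|r r0 Hr].
    by rewrite divr_gt0.
  (* Points of a rectangle with sides below [r / 4] are at distance at most [w + h < r] from [p]. *)
  exists (r / 4); first by rewrite divr_gt0.
  move=> x y w h pxw pyh wr hr w0 h0 ax xb cy yd.
  have sub : rect_cont G x (x + w) y (y + h).
    move=> u v /andP[xu uw] /andP[yv vh]; apply: Gc.
      by rewrite (le_trans ax xu) (le_trans uw xb).
    by rewrite (le_trans cy yv) (le_trans vh yd).
  pose A (z : C) := (G p - G' * p) + G' * z.
  have Ac : rect_cont A x (x + w) y (y + h).
    move=> u v _ _.
    exact: (contD (cont_cst (G p - G' * p) _) (contM (cont_cst G' _) (cont_idC _))).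
  have xw : x <= x + w by rewrite lerDl.
  have yh : y <= y + h by rewrite lerDl.
  have <- : rect_int (fun z => G z - A z) x (x + w) y (y + h) =
            rect_int G x (x + w) y (y + h).
    by rewrite rect_intB // rect_int_affine // subr0.
  have -> : e * (w + h) ^+ 2 = 4 * (e / 4 * (w + h)) * ((x + w - x) + (y + h - y)).
    by field.
  apply: (rect_int_bound xw yh).
    by move=> u v hu hv; exact: (contB (sub _ _ hu hv) (Ac _ _ hu hv)).
  move=> u v /andP[u1 u2] /andP[v1 v2].
  have zp : cmod (cpt u v - p) <= w + h.
    have -> : cpt u v - p = cpt (u - px) (v - py) by [].
    apply: le_trans (cmod_cpt _ _) _.
    have /andP[p1 p2] := pxw; have /andP[p3 p4] := pyh.
    by apply: lerD; rewrite ler_norml; apply/andP; split; lra.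
  have -> : G (cpt u v) - A (cpt u v) = G (cpt u v) - G p - G' * (cpt u v - p).
    by rewrite /A; ring.
  apply: le_trans (Hr _ _) _; first by apply: le_lt_trans zp _; lra.
  by rewrite ler_wpM2l // divr_ge0 // ltW.
Qed.

End Goursat.

(** * The complex exponential and the chain rule *)

Section ComplexExp.
Context {R : realType}.
Local Notation C := (Cplx R).
Implicit Types (z w : C) (x y : R).

Definition cis y : C := cpt (cos y) (sin y).

Definition cexp z : C := cofR (expR (cRe z)) * cis (cIm z).

Lemma cmod_cis y : cmod (cis y) = 1.
Proof. by rewrite /cmod /= cos2Dsin2 sqrtr1. Qed.

Lemma cisD x y : cis (x + y) = cis x * cis y.
Proof.
apply: cplx_eq; rewrite ?cReM ?cImM /=; first by rewrite cosD.
by rewrite sinD addrC [cos x * _ in RHS]mulrC; congr (_ + _); rewrite mulrC.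
Qed.

Lemma cis0 : cis 0 = 1.
Proof. by rewrite /cis cos0 sin0. Qed.

Lemma cis2pi : cis (2 * pi) = 1.
Proof. by rewrite /cis mulr_natl cos2pi sin2pi. Qed.

Lemma cexpD z w : cexp (z + w) = cexp z * cexp w.
Proof. by rewrite /cexp cReD cImD expRD cisD cofRM mulrACA. Qed.

Lemma cexp0 : cexp 0 = 1.
Proof. by rewrite /cexp /= expR0 cis0 mulr1. Qed.

Lemma cmod_cexp z : cmod (cexp z) = expR (cRe z).
Proof. by rewrite cmodM cmod_cofR cmod_cis mulr1 gtr0_norm // expR_gt0. Qed.

Lemma cexp_neq0 z : cexp z != 0.
Proof. by rewrite -cmod_gt0 cmod_cexp expR_gt0. Qed.

Lemma cexpN z : cexp (- z) = (cexp z)^-1.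
Proof.
by apply: (mulfI (cexp_neq0 z)); rewrite -cexpD subrr cexp0 mulfV // cexp_neq0.
Qed.

Lemma cexpB z w : cexp (z - w) = cexp z / cexp w.
Proof. by rewrite cexpD cexpN. Qed.

Lemma cexp_cofR x : cexp (cofR x) = cofR (expR x).
Proof. by rewrite /cexp /= cis0 mulr1. Qed.

Lemma cexp_cpt x y : cexp (cpt x y) = cofR (expR x) * cis y.
Proof. by []. Qed.

Lemma is_derive_cexp0 : is_derive (0 : C) 1 cexp 1.
Proof.
apply/deriveCP => e e0.
have e4 : 0 < e / 4 by rewrite divr_gt0.
have e8 : 0 < e / 8 by rewrite divr_gt0.
have [r1 r10 H1] := (deriveRP expR 0 _).1 (is_derive_expR 0) _ e4.
have [r2 r20 H2] := (deriveRP cos 0 _).1 (is_derive_cos 0) _ e8.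
have [r3 r30 H3] := (deriveRP sin 0 _).1 (is_derive_sin 0) _ e8.
(* The [1] yields [expR x <= 2], which explains the tolerance [e / 8] for [cos] and [sin]; the
   [e / 4] pays for the term [(expR x - 1) * y]. *)
have [r4 r40 H4] := (contRRP expR 0).1 (@continuous_expR R 0) (Num.min 1 (e / 4)) ltac:(by rewrite lt_min ltr01 e4).
exists (Num.min (Num.min r1 r2) (Num.min r3 r4)); first by rewrite !lt_min r10 r20 r30 r40.
move=> z; rewrite !subr0 !lt_min => /andP[/andP[z1 z2] /andP[z3 z4]].
set x := cRe z; set y := cIm z.
have hx : `|x| <= cmod z := cRe_le_cmod z; have hy : `|y| <= cmod z := cIm_le_cmod z.
have := H1 x; rewrite !subr0 expR0 mul1r => /(_ (le_lt_trans hx z1)) h1.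
have := H2 y; rewrite !subr0 cos0 sin0 oppr0 mul0r subr0 => /(_ (le_lt_trans hy z2)) h2.
have := H3 y; rewrite !subr0 sin0 cos0 mul1r subr0 => /(_ (le_lt_trans hy z3)) h3.
have := H4 x; rewrite !subr0 expR0 lt_min => /(_ (le_lt_trans hx z4)) /andP[h4 h5].
rewrite cexp0 mul1r; apply: le_trans (cmod_le_ReIm _) _.
rewrite !cReB !cImB cRe_real cIm_real /= -/x -/y subr0.
set E := expR x in h1 h4 h5 *; have E2 : `|E| <= 2.
  have := ler_normD (E - 1) 1; rewrite subrK normr1 => /le_trans; apply.
  by rewrite (_ : 2 = 1 + 1) // lerD2r ltW.
have -> : E * cos y - 1 - x = E * (cos y - 1) + (E - 1 - x) by ring.
have -> : E * sin y - y = E * (sin y - y) + (E - 1) * y by ring.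
have q1 : `|E * (cos y - 1)| <= e / 4 * cmod z.
  rewrite normrM (le_trans (ler_pM _ _ E2 h2)) // mulrA.
  by rewrite (_ : 2 * (e / 8) = e / 4) ?ler_wpM2l ?(ltW e4) //; field.
have q2 : `|E - 1 - x| <= e / 4 * cmod z.
  by apply: le_trans h1 _; rewrite ler_wpM2l ?(ltW e4).
have q3 : `|E * (sin y - y)| <= e / 4 * cmod z.
  rewrite normrM (le_trans (ler_pM _ _ E2 h3)) // mulrA.
  by rewrite (_ : 2 * (e / 8) = e / 4) ?ler_wpM2l ?(ltW e4) //; field.
have q4 : `|(E - 1) * y| <= e / 4 * cmod z.
  by rewrite normrM ler_pM // ltW.
apply: le_trans (lerD (ler_normD _ _) (ler_normD _ _)) _.
have -> : e * cmod z = e / 4 * cmod z + e / 4 * cmod z + (e / 4 * cmod z + e / 4 * cmod z).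
  by field.
by rewrite !lerD.
Qed.

Lemma is_derive_cexp z : is_derive z 1 cexp (cexp z).
Proof.
apply/deriveCP => e e0; have c0 : 0 < cmod (cexp z) by rewrite cmod_gt0 cexp_neq0.
have [|r r0 H] := (deriveCP cexp 0 1).1 is_derive_cexp0 (e / cmod (cexp z)).
  by rewrite divr_gt0.
exists r => // w wz; have := H (w - z); rewrite subr0 cexp0 mul1r => /(_ wz) h.
have -> : cexp w - cexp z - cexp z * (w - z) = cexp z * (cexp (w - z) - 1 - (w - z)).
  by rewrite {1}(_ : w = z + (w - z)) ?cexpD; [ring|rewrite addrC subrK].
rewrite cmodM; have := ler_wpM2l (cmod_ge0 (cexp z)) h.
by rewrite mulrA mulrCA divff ?mulr1 // gt_eqF.
Qed.

Lemma derive_cont (f : C -> C) z d : is_derive z 1 f d -> {for z, continuous f}.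
Proof.
by move=> [df _]; exact: differentiable_continuous ((derivable1_diffP f z).1 df).
Qed.

Lemma derive_diff (f : C -> C) z d : is_derive z 1 f d -> differentiable f z.
Proof. by move=> [df _]; exact: (derivable1_diffP f z).1. Qed.

Lemma diff_derive (f : C -> C) z : differentiable f z -> is_derive z 1 f ('D_1 f z).
Proof. by move=> df; exact: derivableP ((derivable1_diffP f z).2 df). Qed.

Lemma is_derive_comp (f h : C -> C) z (d p : C) :
  is_derive (h z) 1 f d -> is_derive z 1 h p ->
  is_derive z 1 (fun w => f (h w)) (d * p).
Proof.
move=> /deriveCP hf hd; have hc := (contCP h z).1 (derive_cont hd).
move/deriveCP : hd => hp.
apply/deriveCP => e e0.
have pd : 0 < cmod p + 1 by rewrite ltr_wpDl ?cmod_ge0.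
have dd : 0 < cmod d + 1 by rewrite ltr_wpDl ?cmod_ge0.
have e1 : 0 < e / 2 / (cmod p + 1) by rewrite !divr_gt0.
have e2 : 0 < e / 2 / (cmod d + 1) by rewrite !divr_gt0.
have [r1 r10 H1] := hf _ e1; have [r2 r20 H2] := hp _ e2.
have [r3 r30 H3] := hp _ ltr01; have [r4 r40 H4] := hc r1 r10.
exists (Num.min (Num.min r2 r3) r4); first by rewrite !lt_min r20 r30 r40.
move=> w; rewrite !lt_min => /andP[/andP[/H2 h2 /H3 h3] /H4/H1 h1].
have h4 : cmod (h w - h z) <= (cmod p + 1) * cmod (w - z).
  have -> : h w - h z = (h w - h z - p * (w - z)) + p * (w - z) by rewrite subrK.
  by rewrite (le_trans (cmodD _ _)) // cmodM mulrDl addrC lerD2l.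
have -> : f (h w) - f (h z) - d * p * (w - z) =
   (f (h w) - f (h z) - d * (h w - h z)) + d * (h w - h z - p * (w - z)) by ring.
rewrite (le_trans (cmodD _ _)) // cmodM.
have := ler_wpM2l (ltW e1) h4.
rewrite mulrA divfK ?gt_eqF // => h5.
have h6 : cmod d * cmod (h w - h z - p * (w - z)) <= e / 2 * cmod (w - z).
  have := ler_wpM2l (cmod_ge0 d) h2 => /le_trans; apply.
  rewrite mulrA ler_wpM2r ?cmod_ge0 // mulrCA ler_piMr //; first by rewrite divr_ge0 // ltW.
  by rewrite ler_pdivrMr // mul1r lerDl.
rewrite (le_trans (lerD (le_trans h1 h5) h6)) // -mulrDl.
by rewrite (_ : e / 2 + e / 2 = e) //; field.
Qed.

Lemma rderiv_cis y : rderiv cis y (cis y * cI).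
Proof.
have -> : cis = (fun t => cexp (cpt 0 t)).
  by apply/funext => t; rewrite cexp_cpt expR0 mul1r.
apply: (rderiv_comp (phi := cpt 0) (is_derive_cexp _)).
move=> e e0; exists 1 => // t _.
rewrite !cptE opprD addrACA subrr add0r cofRB [cI * _]mulrC -mulrBl subrr cmod0.
by rewrite mulr_ge0 // ltW.
Qed.

Lemma cont_cis y : {for y, continuous cis}.
Proof. exact: rderiv_cont (rderiv_cis y). Qed.

Lemma cont_circle (f : C -> C) (r y : R) :
  {for cofR r * cis y, continuous f} -> {for y, continuous (fun t => f (cofR r * cis t))}.
Proof.
move=> fc.
have h : {for y, continuous (fun t => cofR r * cis t)}.
  exact: (contM (cont_cst _ _) (@cont_cis y)).
exact: (@continuous_comp _ _ _ (fun t => cofR r * cis t) f y h fc).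
Qed.

End ComplexExp.

(** * Means over circles centred at the origin *)

Section CircleMean.
Context {R : realType}.
Local Notation C := (Cplx R).
Implicit Types (f : C -> C) (r : R).

(** This is the contour integral of [f z / z] over the circle of radius [r], divided by [2 pi i].
    Cauchy's formula and Taylor coefficients are expressed by such means. *)
Definition cmean f r : C :=
  cofR (2 * pi)^-1 * cint 0 (2 * pi) (fun t => f (cofR r * cis t)).

Definition circle_cont f r := forall t, {for cofR r * cis t, continuous f}.

Lemma tpi_gt0 : 0 < 2 * pi :> R.
Proof. by rewrite mulr_gt0 // pi_gt0. Qed.

Lemma circle_path f r : circle_cont f r ->
  path_continuous 0 (2 * pi) (fun t => f (cofR r * cis t)).
Proof. by move=> h t _; apply: cont_circle. Qed.

Lemma cmean_eq f h r : (forall t, f (cofR r * cis t) = h (cofR r * cis t)) ->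
  cmean f r = cmean h r.
Proof. by move=> fh; congr (_ * _); apply: cint_eq => t _. Qed.

Lemma cmeanB f h r : circle_cont f r -> circle_cont h r ->
  cmean (fun z => f z - h z) r = cmean f r - cmean h r.
Proof.
by move=> fc hc; rewrite /cmean -mulrBr -(cintB (circle_path fc) (circle_path hc)).
Qed.

Lemma cmeanD f h r : circle_cont f r -> circle_cont h r ->
  cmean (fun z => f z + h z) r = cmean f r + cmean h r.
Proof.
by move=> fc hc; rewrite /cmean -mulrDr -(cintD (circle_path fc) (circle_path hc)).
Qed.

Lemma cmeanZ (c : C) f r : circle_cont f r ->
  cmean (fun z => c * f z) r = c * cmean f r.
Proof.
by move=> fc; rewrite /cmean [RHS]mulrCA -(cintZ _ (circle_path fc)).
Qed.

Lemma cmean_cst (c : C) r : cmean (fun=> c) r = c.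
Proof.
rewrite /cmean cint_cst ?(ltW tpi_gt0) // subr0 mulrCA -cofRM mulVf ?mulr1 //.
by rewrite gt_eqF // tpi_gt0.
Qed.

Lemma cmean_bound f r M : circle_cont f r ->
  (forall t, cmod (f (cofR r * cis t)) <= M) -> cmod (cmean f r) <= 2 * M.
Proof.
move=> fc fM; rewrite /cmean cmodM cmod_cofR gtr0_norm ?invr_gt0 ?tpi_gt0 //.
have := cint_bound (ltW tpi_gt0) (circle_path fc) (fun t _ => fM t).
by rewrite subr0 [_^-1 * _]mulrC ler_pdivrMr // tpi_gt0.
Qed.

(** The exponential maps [[ln r0, ln r1] x [0, 2 pi]] onto the annulus. In Goursat's theorem for
    [f o cexp] the horizontal sides cancel by periodicity, and the vertical ones are the two
    means. *)
Lemma cmean_annulus f r0 r1 : 0 < r0 <= r1 ->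
  (forall z, r0 <= cmod z <= r1 -> differentiable f z) ->
  cmean f r0 = cmean f r1.
Proof.
move=> /andP[r00 r01] df; have r10 := lt_le_trans r00 r01.
pose G z := f (cexp z).
have ab : ln r0 <= ln r1 by rewrite ler_ln.
have dG x y : ln r0 <= x <= ln r1 -> 0 <= y <= 2 * pi -> differentiable G (cpt x y).
  move=> /andP[x0 x1] _; apply: (@differentiable_comp _ _ _ _ cexp f).
    exact: derive_diff (is_derive_cexp _).
  apply: df; rewrite cmod_cexp /=; apply/andP; split.
    by rewrite -[leLHS]lnK ?posrE // ler_expR.
  by rewrite -[leRHS]lnK ?posrE // ler_expR.
have := goursat ab (ltW tpi_gt0) dG; rewrite /rect_int.
have -> : cint (ln r0) (ln r1) (fun x => G (cpt x 0)) =
          cint (ln r0) (ln r1) (fun x => G (cpt x (2 * pi))).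
  by apply: cint_eq => x _; rewrite /G !cexp_cpt cis0 cis2pi.
rewrite subrr add0r => /eqP; rewrite mulf_eq0 => /orP[|].
  by rewrite -cmod_eq0 cmod_cI oner_eq0.
rewrite subr_eq0 => /eqP h; rewrite /cmean; congr (_ * _).
have E r : 0 < r -> cint 0 (2 * pi) (fun t => f (cofR r * cis t)) =
    cint 0 (2 * pi) (fun t => G (cpt (ln r) t)).
  by move=> rp; apply: cint_eq => t _; rewrite /G cexp_cpt lnK.
by apply: etrans (E _ r00) _; apply: etrans _ (esym (E _ r10)); exact: esym h.
Qed.

(** Compactness of [[0, 2 pi]] makes the continuity of [f] along the circle of radius [r0] uniform
    in the angle. *)
Lemma cmean_continuous f r0 (rho : R) : 0 <= r0 < rho ->
  (forall z, cmod z < rho -> {for z, continuous f}) ->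
  forall e : R, 0 < e -> exists2 d : R, 0 < d &
    forall r, 0 <= r -> `|r - r0| < d -> cmod (cmean f r - cmean f r0) <= e.
Proof.
move=> /andP[r00 r0rho] fc e e0.
have cc r : 0 <= r < rho -> circle_cont f r.
  move=> /andP[rp rr] t; apply: fc.
  by rewrite cmodM cmod_cofR cmod_cis mulr1 ger0_norm.
have e2 : 0 < e / 2 by rewrite divr_gt0.
pose P (r t : R) := cmod (f (cofR r * cis t) - f (cofR r0 * cis t)) < e / 2.
have near_r0 : \forall r \near r0, `[0, 2 * pi] `<=` P r.
  have ncov := (compact_near_coveringP _).1 (@segment_compact R 0 (2 * pi)).
  apply: (ncov R (nbhs r0) P (nbhs_filter r0)) => t _; rewrite /P.
  have [d d0 Hd] := (contCP f (cofR r0 * cis t)).1 (cc r0 ltac:(by rewrite r00) t)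
     (e / 4) ltac:(by rewrite divr_gt0).
  have [d1 d10 Hd1] := (contRP cis t).1 (@cont_cis R t) (d / 2 / (r0 + 1))
     ltac:(by rewrite !divr_gt0 // ltr_wpDl).
  exists ([set s | `|s - t| < d1], [set r | `|r - r0| < d / 2]) => /=.
    split; apply/nbhsRP; first by exists d1.
    by exists (d / 2) => //; rewrite divr_gt0.
  move=> [s r] /= [st rr0].
  have k1 : cmod (cofR r0 * cis s - cofR r0 * cis t) < d / 2.
    rewrite -mulrBr cmodM cmod_cofR ger0_norm //.
    apply: le_lt_trans (_ : (r0 + 1) * cmod (cis s - cis t) < _).
      by rewrite ler_wpM2r ?cmod_ge0 // lerDl.
    by rewrite mulrC -ltr_pdivlMr ?Hd1 // ltr_wpDl.
  have k2 : cmod (cofR r * cis s - cofR r0 * cis s) < d / 2.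
    by rewrite -mulrBl -cofRB cmodM cmod_cis mulr1 cmod_cofR.
  have q1 : cmod (f (cofR r * cis s) - f (cofR r0 * cis t)) < e / 4.
    apply: Hd; have -> : cofR r * cis s - cofR r0 * cis t =
      (cofR r * cis s - cofR r0 * cis s) + (cofR r0 * cis s - cofR r0 * cis t) by ring.
    by apply: le_lt_trans (cmodD _ _) _; rewrite [d]splitr ltrD.
  have q2 : cmod (f (cofR r0 * cis s) - f (cofR r0 * cis t)) < e / 4.
    by apply: Hd; apply: lt_trans k1 _; rewrite ltr_pdivrMr // mulr_natr mulr2n ltrDl.
  have -> : f (cofR r * cis s) - f (cofR r0 * cis s) =
    (f (cofR r * cis s) - f (cofR r0 * cis t)) -
    (f (cofR r0 * cis s) - f (cofR r0 * cis t)) by ring.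
  apply: le_lt_trans (cmodD _ _) _; rewrite cmodN.
  have -> : e / 2 = e / 4 + e / 4 by field.
  exact: ltrD.
have [d d0 Hd] := (nbhsRP _ _).1 near_r0.
exists (Num.min d (rho - r0)); first by rewrite lt_min d0 subr_gt0.
move=> r rp; rewrite lt_min => /andP[rd rr].
have rrho : r < rho.
  by have := le_lt_trans (ler_norm _) rr; rewrite ltrBlDr subrK.
have c1 : circle_cont f r by apply: cc; rewrite rp.
have c0 : circle_cont f r0 by apply: cc; rewrite r00.
pose u t := f (cofR r * cis t) - f (cofR r0 * cis t).
have -> : cmean f r - cmean f r0 = cofR (2 * pi)^-1 * cint 0 (2 * pi) u.
  by rewrite /cmean -mulrBr -(cintB (circle_path c1) (circle_path c0)).
have uc : path_continuous 0 (2 * pi) u.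
  exact: (path_continuousB (circle_path c1) (circle_path c0)).
have := cint_bound (ltW tpi_gt0) uc (M := e / 2).
rewrite cmodM cmod_cofR gtr0_norm ?invr_gt0 ?tpi_gt0 // subr0.
have -> : 2 * (e / 2) = e by field.
rewrite [_^-1 * _]mulrC ler_pdivrMr ?tpi_gt0 //; apply => t tt.
by apply/ltW; apply: (Hd r rd); rewrite /= in_itv.
Qed.

End CircleMean.

#[global] Arguments cmod : simpl never.

(** * Holomorphic functions on discs *)

Section CauchyFormula.
Context {R : realType}.
Local Notation C := (Cplx R).
Implicit Types (f h : C -> C) (r s rho : R) (z w u a : C).

Lemma circle_norm r (t : R) : 0 <= r -> cmod (cofR r * cis t) = r.
Proof. by move=> r0; rewrite cmodM cmod_cofR cmod_cis mulr1 ger0_norm. Qed.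

Lemma diff_id z : differentiable (fun w : C => w) z.
Proof. exact: derive_diff (is_derive_id z 1). Qed.

Lemma diff_cstC (c : C) z : differentiable (fun _ : C => c) z.
Proof. exact: differentiable_cst. Qed.

Lemma diffC_D f h z : differentiable f z -> differentiable h z ->
  differentiable (fun w => f w + h w) z.
Proof. exact: differentiableD. Qed.

Lemma diffC_B f h z : differentiable f z -> differentiable h z ->
  differentiable (fun w => f w - h w) z.
Proof. exact: differentiableB. Qed.

Lemma diffC_M f h z : differentiable f z -> differentiable h z ->
  differentiable (fun w => f w * h w) z.
Proof. exact: differentiableM. Qed.

Lemma diffC_V f z : f z != 0 -> differentiable f z ->
  differentiable (fun w => (f w)^-1) z.
Proof. by move=> f0 df; exact: differentiableV. Qed.

Lemma diffC_X f z k : differentiable f z -> differentiable (fun w => f w ^+ k) z.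
Proof.
move=> df; elim: k => [|k IH]; first exact: diff_cstC.
have -> : (fun w => f w ^+ k.+1) = (fun w => f w * f w ^+ k).
  by apply/funext => w; rewrite exprS.
exact: diffC_M.
Qed.

Lemma diffC_comp f h z : differentiable h z -> differentiable f (h z) ->
  differentiable (fun w => f (h w)) z.
Proof. by move=> dh df; exact: (@differentiable_comp _ _ _ _ h f z dh df). Qed.

Lemma diffC_cont f z : differentiable f z -> {for z, continuous f}.
Proof. exact: differentiable_continuous. Qed.

Lemma eq_near_diff f h z (e : R) : 0 < e ->
  (forall w, cmod (w - z) < e -> f w = h w) -> differentiable f z ->
  differentiable h z.
Proof.
move=> e0 fh /diff_derive/deriveCP df.
apply: (@derive_diff _ _ _ ('D_1 f z)); apply/deriveCP => d d0.
have [r r0 H] := df d d0; exists (Num.min e r); first by rewrite lt_min e0 r0.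
move=> w; rewrite lt_min => /andP[we wr]; rewrite -!fh //; last by rewrite subrr cmod0.
exact: H.
Qed.

Lemma eq_near_cont f h z (e : R) : 0 < e ->
  (forall w, cmod (w - z) < e -> f w = h w) -> {for z, continuous f} ->
  {for z, continuous h}.
Proof.
move=> e0 fh /contCP df; apply/contCP => d d0.
have [r r0 H] := df d d0; exists (Num.min e r); first by rewrite lt_min e0 r0.
move=> w; rewrite lt_min => /andP[we wr]; rewrite -!fh //; last by rewrite subrr cmod0.
exact: H.
Qed.

Lemma disc_compact r : compact [set z : C | cmod z <= r].
Proof.
pose p (q : R * R) : C := cpt q.1 q.2.
have pc : continuous p.
  move=> q; apply: (cvgCP (F := nbhs q) _ _).2 => e e0.
  have e2 : 0 < e / 2 by rewrite divr_gt0.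
  exists ([set x | `|x - q.1| < e / 2], [set y | `|y - q.2| < e / 2]) => /=.
    by split; apply/nbhsRP; exists (e / 2).
  move=> [x y] [xq yq].
  apply: le_lt_trans (cmod_cpt (x - q.1) (y - q.2)) _.
  rewrite [e]splitr; exact: ltrD.
have K : compact (p @` (`[-r, r] `*` `[-r, r])).
  apply: continuous_compact; first exact: continuous_subspaceT.
  by apply: compact_setX; exact: segment_compact.
apply: (subclosed_compact _ K).
  rewrite -[X in closed X]setCK; apply: open_closedC.
  rewrite openE => z /= /negP; rewrite -ltNge => rz.
  apply/nbhsCP; exists (cmod z - r); first by rewrite subr_gt0.
  move=> w wz; apply/negP; rewrite -ltNge.
  have := cmod_triB z w; rewrite cmodB => /le_lt_trans /(_ wz).
  by rewrite ltrD2l ltrN2.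
move=> z /= zr; exists (cRe z, cIm z); last by case: z zr.
have := le_trans (cRe_le_cmod z) zr; have := le_trans (cIm_le_cmod z) zr.
by rewrite !ler_norml => h1 h2; split; rewrite /= in_itv.
Qed.

Lemma cont_cmod f z : {for z, continuous f} ->
  {for z, continuous (fun w => cmod (f w) : R)}.
Proof.
move=> /contCP fc; apply: (cvgrPdist_lt (F := nbhs z) _ _).2 => e e0.
have [d d0 H] := fc e e0; apply/nbhsCP; exists d => // w wd.
apply: le_lt_trans (H w wd).
rewrite ler_norml; apply/andP; split; last by rewrite cmodB cmod_triB.
by rewrite lerNl opprB cmod_triB.
Qed.

Lemma disc_min f r : 0 <= r ->
  (forall z, cmod z <= r -> {for z, continuous f}) ->
  exists2 z, cmod z <= r & forall w, cmod w <= r -> cmod (f z) <= cmod (f w).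
Proof.
move=> r0 fc.
have [||c + hc] := @compact_EVT_min C R (fun z => cmod (f z)) _ _ (@disc_compact r).
- by exists 0; rewrite /= cmod0.
- by apply: continuous_in_subspaceT => z; rewrite inE => zr; apply: cont_cmod; exact: fc.
- rewrite inE => cr; exists c => // w wr; apply: hc; by rewrite inE.
Qed.

Lemma disc_bounded f r : (forall z, cmod z <= r -> {for z, continuous f}) ->
  exists2 M : R, 0 < M & forall z, cmod z <= r -> cmod (f z) <= M.
Proof.
move=> fc; have [r0|r0] := ltP r 0.
  by exists 1 => // z zr; have := le_trans (cmod_ge0 z) zr; rewrite leNgt r0.
have [||c + hc] := @compact_EVT_max C R (fun z => cmod (f z)) _ _ (@disc_compact r).
- by exists 0; rewrite /= cmod0.
- by apply: continuous_in_subspaceT => z; rewrite inE => zr; apply: cont_cmod; exact: fc.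
- rewrite inE => cr; exists (cmod (f c) + 1); first by rewrite ltr_wpDl ?cmod_ge0.
  by move=> w wr; rewrite (@le_trans _ _ (cmod (f c))) ?lerDl //; apply: hc; rewrite inE.
Qed.

(* The exceptional centre lets difference quotients at [0] qualify; a posteriori
   it is not exceptional, see [removable]. *)
Definition hol_off0 f rho :=
  (forall z, cmod z < rho -> {for z, continuous f}) /\
  (forall z, z != 0 -> cmod z < rho -> differentiable f z).

Lemma hol_circle_cont f rho r : hol_off0 f rho -> 0 <= r < rho -> circle_cont f r.
Proof.
by move=> [fc _] /andP[r0 rrho] t; apply: fc; rewrite circle_norm.
Qed.

Lemma cmean0 f : cmean f 0 = f 0.
Proof.
rewrite -[RHS](cmean_cst (f 0) 0); apply: cmean_eq => t.
by rewrite cofR0 mul0r.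
Qed.

(* The mean over circles is locally constant off the exceptional radius [s] and
   continuous across it. *)
Lemma mean_value f s rho : 0 <= s ->
  (forall z, cmod z < rho -> {for z, continuous f}) ->
  (forall z, z != 0 -> cmod z < rho -> cmod z != s -> differentiable f z) ->
  forall r, 0 <= r < rho -> cmean f r = f 0.
Proof.
move=> s0 fc df.
have below r r' : 0 < r <= r' -> r' < s -> r' < rho -> cmean f r = cmean f r'.
  move=> /andP[r0 rr'] r's r'rho; apply: cmean_annulus; first by rewrite r0.
  move=> z /andP[rz zr']; apply: df.
  - by rewrite -cmod_gt0 (lt_le_trans r0).
  - exact: le_lt_trans zr' _.
  - by rewrite lt_eqF // (le_lt_trans zr').
have above r r' : s < r <= r' -> r' < rho -> cmean f r = cmean f r'.
  move=> /andP[sr rr'] r'rho; have r0 := le_lt_trans s0 sr.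
  apply: cmean_annulus; first by rewrite r0.
  move=> z /andP[rz zr']; apply: df.
  - by rewrite -cmod_gt0 (lt_le_trans r0).
  - exact: le_lt_trans zr' _.
  - by rewrite gt_eqF // (lt_le_trans sr).
have A r : 0 < r < s -> r < rho -> cmean f r = f 0.
  move=> /andP[r0 rs] rrho; apply/eqP; rewrite -subr_eq0; apply/eqP.
  apply: cmod_arbitrarily_small => e e0.
  have [|d d0 Hd] := cmean_continuous (r0 := 0) (rho := rho) _ fc e0.
    by rewrite lexx (lt_trans r0).
  have m0 : 0 < Num.min r (d / 2) by rewrite lt_min r0 divr_gt0.
  have mr : Num.min r (d / 2) <= r by rewrite ge_min lexx.
  rewrite -(below (Num.min r (d / 2)) r) ?m0 // -(cmean0 f).
  apply: Hd; first exact: ltW.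
  rewrite subr0 gtr0_norm // (le_lt_trans (_ : _ <= d / 2)) ?ge_min ?lexx ?orbT //.
  by rewrite ltr_pdivrMr // mulr_natr mulr2n ltrDl.
have B : s < rho -> cmean f s = f 0.
  move=> srho; move: s0; rewrite le_eqVlt => /predU1P[<-|s0]; first exact: cmean0.
  apply/eqP; rewrite -subr_eq0; apply/eqP; apply: cmod_arbitrarily_small => e e0.
  have [|d d0 Hd] := cmean_continuous (r0 := s) (rho := rho) _ fc e0.
    by rewrite (ltW s0).
  pose r := Num.max (s / 2) (s - d / 2).
  have r0 : 0 < r by rewrite lt_max divr_gt0.
  have rs : r < s.
    rewrite gt_max; apply/andP; split; last by rewrite ltrBlDr ltrDl divr_gt0.
    by rewrite ltr_pdivrMr // mulr_natr mulr2n ltrDl.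
  rewrite -(A r) ?r0 //; last exact: lt_trans rs srho.
  rewrite cmodB; apply: Hd; first exact: ltW.
  rewrite ltr0_norm ?subr_lt0 // opprB ltrBlDr -ltrBlDl lt_max.
  by apply/orP; right; rewrite ltrD2l ltrN2 ltr_pdivrMr // mulr_natr mulr2n ltrDl.
have D r : s < r -> r < rho -> cmean f r = f 0.
  move=> sr rrho; apply/eqP; rewrite -subr_eq0; apply/eqP.
  apply: cmod_arbitrarily_small => e e0.
  have [|d d0 Hd] := cmean_continuous (r0 := s) (rho := rho) _ fc e0.
    by rewrite s0 (lt_trans sr).
  pose r' := Num.min r (s + d / 2).
  have sr' : s < r' by rewrite lt_min sr ltrDl divr_gt0.
  have r'r : r' <= r by rewrite ge_min lexx.
  rewrite -(above r' r) ?sr' // -B; last exact: lt_trans sr rrho.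
  apply: Hd; first exact: le_trans s0 (ltW sr').
  rewrite gtr0_norm ?subr_gt0 // ltrBlDr addrC.
  rewrite (le_lt_trans (_ : _ <= s + d / 2)) ?ge_min ?lexx ?orbT // ltrD2l.
  by rewrite ltr_pdivrMr // mulr_natr mulr2n ltrDl.
move=> r /andP[]; rewrite le_eqVlt => /predU1P[<- _|r0 rrho]; first exact: cmean0.
have [rs|sr|rs] := ltgtP r s.
- by apply: A; rewrite ?r0.
- exact: D.
- by rewrite rs; apply: B; rewrite -rs.
Qed.

(** The kernel is holomorphic outside the closed disc of radius [cmod z], so its mean does not
    depend on the radius, and the kernel tends to 1 at infinity. *)
Lemma cmean_kernel r z : cmod z < r -> cmean (fun w => w / (w - z)) r = 1.
Proof.
move=> zr; have r0 : 0 < r := le_lt_trans (cmod_ge0 z) zr.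
have wz w : cmod z < cmod w -> w - z != 0.
  by move=> h; rewrite subr_eq0; apply: contraTneq h => ->; rewrite ltxx.
have dk w : cmod z < cmod w -> differentiable (fun w => w / (w - z)) w.
  move=> h; apply: diffC_M; first exact: diff_id.
  apply: diffC_V; first exact: wz.
  by apply: diffC_B; [exact: diff_id|exact: diff_cstC].
apply/eqP; rewrite -subr_eq0; apply/eqP; apply: cmod_arbitrarily_small => e e0.
(* Chosen so that [cmod z <= e / 2 * (r' - cmod z)], which bounds the kernel minus 1 by [e / 2]. *)
pose r' := r + 2 * cmod z / e.
have rr' : r <= r' by rewrite lerDl divr_ge0 ?mulr_ge0 ?cmod_ge0 // ltW.
have zr' : cmod z < r' := lt_le_trans zr rr'.
have r'0 : 0 < r' := lt_le_trans r0 rr'.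
rewrite (cmean_annulus (r1 := r')) ?r0 //; last first.
  by move=> w /andP[rw _]; apply: dk; exact: lt_le_trans zr rw.
rewrite -(cmean_cst 1 r') -cmeanB; first last.
- by move=> t; exact: cont_cst.
- by move=> t; apply: diffC_cont; apply: dk; rewrite circle_norm // ltW.
apply: le_trans (cmean_bound (M := e / 2) _ _) _; last by rewrite mulrC divfK.
  move=> t; apply: contB; last exact: cont_cst.
  by apply: diffC_cont; apply: dk; rewrite circle_norm // ltW.
move=> t; set w := cofR r' * cis t.
have wr : cmod w = r' by rewrite circle_norm // ltW.
have w0 : w - z != 0 by apply: wz; rewrite wr.
have -> : w / (w - z) - 1 = z / (w - z) by field.
rewrite cmodM cmodV ler_pdivrMr ?cmod_gt0 //.
apply: le_trans (_ : e / 2 * (r' - cmod z) <= _); last first.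
  by rewrite ler_wpM2l ?divr_ge0 ?(ltW e0) // -wr cmod_triB.
have -> : e / 2 * (r' - cmod z) = e / 2 * (r - cmod z) + cmod z.
  by rewrite /r'; field; rewrite gt_eqF.
by rewrite lerDr mulr_ge0 ?divr_ge0 ?(ltW e0) // subr_ge0 ltW.
Qed.

Lemma cont_sub z u : {for u, continuous (fun w : C => w - z)}.
Proof. exact: (contB (cont_idC _) (cont_cst _ _)). Qed.

Lemma cont_subV z u : u - z != 0 -> {for u, continuous (fun w : C => (w - z)^-1)}.
Proof. by move=> uz; exact: (contV (f := fun w => w - z) uz (@cont_sub z u)). Qed.

(** Iterated at the centre [0], this operation peels off the Taylor coefficients one at a time. *)
Definition slope f z w : C := if w == z then 'D_1 f z else (f w - f z) / (w - z).

Lemma slopeE f z w : f w = f z + (w - z) * slope f z w.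
Proof.
rewrite /slope; case: eqVneq => [->|wz]; first by rewrite subrr mul0r addr0.
by rewrite mulrCA mulfV ?subr_eq0 // mulr1 addrC subrK.
Qed.

Lemma slope_cont_center f z : differentiable f z -> {for z, continuous (slope f z)}.
Proof.
move=> /diff_derive/deriveCP df; apply/contCP => e e0.
have [|r r0 H] := df (e / 2); first by rewrite divr_gt0.
exists r => // w wr; rewrite /slope eqxx; case: eqVneq => [_|wz].
  by rewrite subrr cmod0.
have wz0 : w - z != 0 by rewrite subr_eq0.
have -> : (f w - f z) / (w - z) - 'D_1 f z = (f w - f z - 'D_1 f z * (w - z)) / (w - z).
  by rewrite [RHS]mulrBl mulfK.
rewrite cmodM cmodV ltr_pdivrMr ?cmod_gt0 // (le_lt_trans (H w wr)) //.
rewrite ltr_pM2r ?cmod_gt0 //.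
by rewrite ltr_pdivrMr // mulr_natr mulr2n ltrDl.
Qed.

Lemma slope_near f z w : w != z -> exists2 e : R, 0 < e & forall u, cmod (u - w) < e ->
  (f u - f z) / (u - z) = slope f z u.
Proof.
move=> wz; exists (cmod (w - z)); first by rewrite cmod_gt0 subr_eq0.
move=> u uw; rewrite /slope ifN //; apply: contraTneq uw => ->.
by rewrite cmodB ltxx.
Qed.

Lemma slope_cont f z w : w != z -> {for w, continuous f} -> {for w, continuous (slope f z)}.
Proof.
move=> wz fc; have [e e0 He] := slope_near f wz; apply: (eq_near_cont e0 He).
apply: contM; first exact: (contB fc (cont_cst _ _)).
apply: contV; first by rewrite subr_eq0.
exact: (contB (cont_idC _) (cont_cst _ _)).
Qed.

Lemma slope_diff f z w : w != z -> differentiable f w -> differentiable (slope f z) w.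
Proof.
move=> wz fc; have [e e0 He] := slope_near f wz; apply: (eq_near_diff e0 He).
apply: diffC_M; first exact: (diffC_B fc (diff_cstC _ _)).
apply: diffC_V; first by rewrite subr_eq0.
exact: (diffC_B (diff_id _) (diff_cstC _ _)).
Qed.

(** The function [slope f z w * w] is continuous, vanishes at 0 and is holomorphic off the circle
    through [z], so its mean is 0 by [mean_value]; by [cmean_kernel] this mean is the difference of
    the two sides. At [z = 0], where [f] is only known to be continuous, the mean value property of
    [f] is used directly. *)
Lemma cauchy_formula f rho r z : hol_off0 f rho -> cmod z < r < rho ->
  cmean (fun w => f w * (w / (w - z))) r = f z.
Proof.
move=> fh /andP[zr rrho]; have [fc df] := fh.
have r0 : 0 < r := le_lt_trans (cmod_ge0 z) zr.
have fcc : circle_cont f r by apply: (hol_circle_cont fh); rewrite (ltW r0).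
have [->|z0] := eqVneq z 0.
  have <- : cmean f r = f 0.
    apply: (mean_value (lexx 0) fc) => [w w0 wr _|]; first exact: df.
    by rewrite (ltW r0).
  apply: cmean_eq => t; rewrite subr0 mulfV ?mulr1 //.
  by rewrite -cmod_gt0 circle_norm // ltW.
have zrho : cmod z < rho := lt_trans zr rrho.
have Fc w : cmod w < rho -> {for w, continuous (fun w => slope f z w * w)}.
  move=> wr; apply: contM; last exact: cont_idC.
  have [->|wz] := eqVneq w z; first by apply: slope_cont_center; exact: df.
  by apply: slope_cont => //; exact: fc.
have Fd w : w != 0 -> cmod w < rho -> cmod w != cmod z ->
    differentiable (fun w => slope f z w * w) w.
  move=> w0 wr wz; apply: diffC_M; last exact: diff_id.
  apply: slope_diff; last exact: df.
  by apply: contra wz => /eqP ->.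
have := mean_value (cmod_ge0 z) Fc Fd (r := r); rewrite (ltW r0) rrho mulr0.
move=> /(_ isT).
have wz t : cofR r * cis t - z != 0.
  rewrite subr_eq0; apply: contraTneq zr => <-.
  by rewrite circle_norm ?ltxx // ltW.
have kc : circle_cont (fun w => w / (w - z)) r.
  move=> t; apply: contM; first exact: cont_idC.
  exact: (cont_subV (wz t)).
have -> : cmean (fun w => slope f z w * w) r =
    cmean (fun w => f w * (w / (w - z)) - f z * (w / (w - z))) r.
  apply: cmean_eq => t; rewrite /slope ifN; last by rewrite -subr_eq0.
  by rewrite -mulrBl [RHS]mulrA mulrAC.
rewrite cmeanB; first last.
- by move=> t; apply: contM; [exact: cont_cst|exact: kc].
- by move=> t; apply: contM; [exact: fcc|exact: kc].
by rewrite cmeanZ // cmean_kernel // mulr1 => /eqP; rewrite subr_eq0 => /eqP.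
Qed.

(** Cauchy's formula on a circle of radius [r] between [s] and [rho] transfers the expansion to the
    kernel [u / (u - z)], whose first divided difference is [k] and whose second-order remainder is
    [(z - w) ^+ 2 * k2]. *)
Lemma taylor2_bound f rho s : hol_off0 f rho -> 0 <= s < rho ->
  exists D : C -> C, exists2 K : R, 0 < K &
  (forall w, cmod w <= s -> cmod (D w) <= K) /\
  (forall z w, cmod z <= s -> cmod w <= s ->
    cmod (f z - f w - D w * (z - w)) <= K * cmod (z - w) ^+ 2).
Proof.
move=> fh /andP[s0 srho]; have [fc df] := fh.
pose r := (s + rho) / 2.
have sr : s < r by rewrite /r midf_lt.
have rrho : r < rho by rewrite /r midf_lt.
have r0 : 0 < r := le_lt_trans s0 sr.
have [|M M0 HM] := disc_bounded (f := f) (r := r).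
  by move=> z zr; apply: fc; exact: le_lt_trans zr rrho.
have rs : 0 < r - s by rewrite subr_gt0.
pose k z w u : C := u / ((u - z) * (u - w)).
pose k2 z w u : C := u / ((u - z) * (u - w) ^+ 2).
have nz z t : cmod z <= s -> cofR r * cis t - z != 0 /\
    r - s <= cmod (cofR r * cis t - z).
  move=> zs; have h : r - s <= cmod (cofR r * cis t - z).
    apply: le_trans (cmod_triB _ _); rewrite circle_norm ?(ltW r0) //.
    by rewrite lerD2l lerN2.
  by split => //; rewrite -cmod_gt0 (lt_le_trans rs).
have fcc : circle_cont f r by apply: (hol_circle_cont fh); rewrite (ltW r0).
have subc := @cont_sub.
have kc z w : cmod z <= s -> cmod w <= s -> circle_cont (k z w) r.
  move=> zs ws t; apply: contM; first exact: cont_idC.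
  apply: contV; first by rewrite mulf_neq0 //; [case: (nz z t)|case: (nz w t)].
  exact: (contM (subc _ _) (subc _ _)).
have k2c z w : cmod z <= s -> cmod w <= s -> circle_cont (k2 z w) r.
  move=> zs ws t; apply: contM; first exact: cont_idC.
  apply: contV; first by rewrite mulf_neq0 ?expf_neq0 //; [case: (nz z t)|case: (nz w t)].
  exact: (contM (subc _ _) (contM (subc _ _) (subc _ _))).
have k1c z : cmod z <= s -> circle_cont (fun u => u / (u - z)) r.
  move=> zs t; apply: contM; first exact: cont_idC.
  exact: (cont_subV (nz z t zs).1).
have mc h : circle_cont h r -> circle_cont (fun u => f u * h u) r.
  by move=> hc t; apply: contM; [exact: fcc|exact: hc].
pose D w := cmean (fun u => f u * k w w u) r.
(* The power [-2] bounds [k] and the power [-3] bounds [k2]; their sum serves both claims, and the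
   factor 2 is that of [cmean_bound]. *)
pose K : R := 2 * (M * r * ((r - s) ^- 2 + (r - s) ^- 3)).
have i2 : 0 < (r - s) ^- 2 by rewrite invr_gt0 exprn_gt0.
have i3 : 0 < (r - s) ^- 3 by rewrite invr_gt0 exprn_gt0.
have K0 : 0 < K.
  apply: mulr_gt0; first exact: ltr0Sn.
  apply: mulr_gt0; first exact: mulr_gt0.
  exact: addr_gt0.
exists D; exists K => //.
have cr t : cmod (cofR r * cis t) = r by rewrite circle_norm // ltW.
split.
  move=> w ws; apply: cmean_bound; first by apply: mc; exact: kc.
  move=> t; rewrite cmodM -mulrA; apply: ler_pM; rewrite ?cmod_ge0 //.
    by apply: HM; rewrite cr.
  rewrite /k cmodM cr cmodV cmodM ler_wpM2l ?(ltW r0) //.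
  apply: (@le_trans _ _ ((r - s) ^- 2)); last by rewrite lerDl ltW.
  have [n1 n2] := nz w t ws.
  rewrite lef_pV2 ?posrE ?exprn_gt0 ?mulr_gt0 ?cmod_gt0 //.
  by rewrite expr2 ler_pM // ltW.
move=> z w zs ws.
have zr : cmod z < r := le_lt_trans zs sr.
have wr : cmod w < r := le_lt_trans ws sr.
rewrite -(cauchy_formula (r := r) fh) ?zr // -[X in cmod (_ - X - _)](cauchy_formula (r := r) fh) ?wr //.
rewrite /D mulrC -cmeanZ; last by apply: mc; exact: kc.
rewrite -cmeanB; [|by apply: mc; exact: k1c|by apply: mc; exact: k1c].
rewrite -cmeanB; first last.
- by move=> t; apply: contM; [exact: cont_cst|apply: mc; exact: kc].
- by move=> t; apply: contB; apply: mc; exact: k1c.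
have -> : cmean (fun u => f u * (u / (u - z)) - f u * (u / (u - w)) - (z - w) * (f u * k w w u)) r =
  cmean (fun u => (z - w) ^+ 2 * (f u * k2 z w u)) r.
  apply: cmean_eq => t; have [n1 _] := nz z t zs; have [n2 _] := nz w t ws.
  by rewrite /k /k2; field; rewrite n1 n2.
have m2 : circle_cont (fun u => f u * k2 z w u) r by apply: mc; exact: k2c.
rewrite cmeanZ // cmodM cmodX mulrC ler_wpM2r ?exprn_ge0 ?cmod_ge0 //.
apply: cmean_bound => // t; rewrite cmodM -mulrA; apply: ler_pM; rewrite ?cmod_ge0 //.
  by apply: HM; rewrite cr.
rewrite /k2 cmodM cr cmodV cmodM cmodX ler_wpM2l ?(ltW r0) //.
apply: (@le_trans _ _ ((r - s) ^- 3)); last by rewrite lerDr ltW.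
have [n1 n2] := nz z t zs; have [n3 n4] := nz w t ws.
rewrite lef_pV2 ?posrE ?exprn_gt0 ?mulr_gt0 ?exprn_gt0 ?cmod_gt0 //.
by rewrite exprS ler_pM ?exprn_ge0 ?(ltW rs) // ler_pXn2r ?nnegrE ?cmod_ge0 // ltW.
Qed.

End CauchyFormula.

(** * Removable points, maximum principle, open mapping, order of a zero *)

Section HolomorphicFunctions.
Context {R : realType}.
Local Notation C := (Cplx R).
Implicit Types (f h : C -> C) (r s rho : R) (z w u a : C).

Lemma derive_unique f z (d e : C) : is_derive z 1 f d -> is_derive z 1 f e -> d = e.
Proof. by move=> [_ <-] [_ <-]. Qed.

Lemma deriveC_eq f z (d e : C) : d = e -> is_derive z 1 f d -> is_derive z 1 f e.
Proof. by move=> ->. Qed.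

Lemma deriveC_cst (c : C) z : is_derive z 1 (fun _ : C => c) 0.
Proof. exact: is_derive_cst. Qed.

Lemma deriveC_id z : is_derive z 1 (fun w : C => w) 1.
Proof. exact: is_derive_id. Qed.

Lemma deriveC_D f h z (d e : C) : is_derive z 1 f d -> is_derive z 1 h e ->
  is_derive z 1 (fun w => f w + h w) (d + e).
Proof. by move=> df dh; exact: (is_deriveD df dh). Qed.

Lemma deriveC_B f h z (d e : C) : is_derive z 1 f d -> is_derive z 1 h e ->
  is_derive z 1 (fun w => f w - h w) (d - e).
Proof. by move=> df dh; exact: (is_deriveB df dh). Qed.

Lemma deriveC_M f h z (d e : C) : is_derive z 1 f d -> is_derive z 1 h e ->
  is_derive z 1 (fun w => f w * h w) (d * h z + f z * e).
Proof.
move=> df dh; apply: (@deriveC_eq _ _ (f z *: e + h z *: d)).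
by rewrite -![_ *: _]/(_ * _) addrC; congr (_ + _); rewrite mulrC.
Qed.

Lemma deriveC_X z k : is_derive z 1 (fun w : C => w ^+ k.+1) (k.+1%:R * z ^+ k).
Proof.
elim: k => [|k IH].
  by apply: (deriveC_eq _ (deriveC_id z)); rewrite expr0 mulr1.
have -> : (fun w : C => w ^+ k.+2) = (fun w => w * w ^+ k.+1).
  by apply/funext => w; rewrite exprS.
apply: (deriveC_eq _ (deriveC_M (deriveC_id z) IH)).
by rewrite -[k.+2]addn1 natrD !exprS; ring.
Qed.

Lemma deriveC_V f z (d : C) : f z != 0 -> is_derive z 1 f d ->
  is_derive z 1 (fun w => (f w)^-1) (- d / f z ^+ 2).
Proof.
move=> f0 df; apply: (@deriveC_eq _ _ (- f z ^- 2 *: d)).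
  by rewrite -[_ *: _]/(_ * _) mulrC mulrN mulNr.
case: df => dv <-; split; last exact: (deriveV f0 dv).
exact: (derivableV f0 dv).
Qed.

Lemma derive_quadratic f (D : C -> C) (s K : R) w :
  (forall z w, cmod z <= s -> cmod w <= s ->
    cmod (f z - f w - D w * (z - w)) <= K * cmod (z - w) ^+ 2) ->
  0 < K -> cmod w < s -> is_derive w 1 f (D w).
Proof.
move=> H K0 ws; apply/deriveCP => e e0.
exists (Num.min (s - cmod w) (e / K)); first by rewrite lt_min subr_gt0 ws divr_gt0.
move=> z; rewrite lt_min => /andP[zs ze].
have zs' : cmod z <= s.
  have := cmodD (z - w) w; rewrite subrK => /le_trans; apply.
  by rewrite -lerBrDr ltW.
apply: le_trans (H z w zs' (ltW ws)) _.
rewrite expr2 mulrA ler_wpM2r ?cmod_ge0 //.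
by move: ze; rewrite ltr_pdivlMr // mulrC => /ltW.
Qed.

(** Cauchy's formula tolerates the exceptional centre, and the quadratic remainder it provides
    forces differentiability at every point, [0] included. *)
Lemma removable f rho z : hol_off0 f rho -> cmod z < rho -> differentiable f z.
Proof.
move=> fh zr; pose s := (cmod z + rho) / 2.
have zs : cmod z < s by rewrite midf_lt.
have sr : s < rho by rewrite midf_lt.
have [|D [K K0 [_ H]]] := taylor2_bound fh (s := s).
  by rewrite sr (le_trans (cmod_ge0 z)) ?(ltW zs).
exact: derive_diff (derive_quadratic H K0 zs).
Qed.

Lemma hol_intro f rho : (forall z, cmod z < rho -> differentiable f z) ->
  hol_off0 f rho.
Proof. by move=> df; split=> [z /df|z _ /df //]; exact: diffC_cont. Qed.

Lemma hol_sub f rho rho' : rho' <= rho -> hol_off0 f rho -> hol_off0 f rho'.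
Proof.
move=> rr [fc df]; split=> [z zr|z z0 zr].
  by apply: fc; exact: lt_le_trans zr rr.
by apply: df => //; exact: lt_le_trans zr rr.
Qed.

Lemma taylor2 f rho s : hol_off0 f rho -> 0 <= s < rho ->
  exists2 K : R, 0 < K &
  (forall w, cmod w <= s -> cmod ('D_1 f w) <= K) /\
  (forall z w, cmod z <= s -> cmod w <= s ->
    cmod (f z - f w - 'D_1 f w * (z - w)) <= K * cmod (z - w) ^+ 2).
Proof.
move=> fh /andP[s0 srho]; pose s' := (s + rho) / 2.
have ss' : s < s' by rewrite midf_lt.
have s'r : s' < rho by rewrite midf_lt.
have [|D [K K0 [DK H]]] := taylor2_bound fh (s := s').
  by rewrite s'r (le_trans s0) ?(ltW ss').
have DE w : cmod w <= s -> 'D_1 f w = D w.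
  move=> ws; have ws' := le_lt_trans ws ss'.
  apply: (derive_unique (diff_derive (removable fh (lt_trans ws' s'r)))).
  exact: derive_quadratic H K0 ws'.
exists K => //; split=> [w ws|z w zs ws]; rewrite DE //.
  by apply: DK; exact: le_trans ws (ltW ss').
by apply: H; exact: le_trans _ (ltW ss').
Qed.

Lemma hol_slope f rho : 0 < rho -> hol_off0 f rho -> hol_off0 (slope f 0) rho.
Proof.
move=> rho0 fh; have [fc df] := fh; split=> [z zr|z z0 zr].
  have [->|z0] := eqVneq z 0; last by apply: slope_cont => //; exact: fc.
  by apply: slope_cont_center; apply: (removable fh); rewrite cmod0.
by apply: slope_diff => //; exact: df.
Qed.

Lemma cauchy_bound f rho r z (M : R) : hol_off0 f rho -> cmod z < r < rho ->
  (forall t, cmod (f (cofR r * cis t)) <= M) ->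
  cmod (f z) <= 2 * M * (r / (r - cmod z)).
Proof.
move=> fh zrr fM; have /andP[zr rrho] := zrr.
have r0 : 0 < r := le_lt_trans (cmod_ge0 z) zr.
have rz : 0 < r - cmod z by rewrite subr_gt0.
have wz t : r - cmod z <= cmod (cofR r * cis t - z).
  by apply: le_trans (cmod_triB _ _); rewrite circle_norm ?(ltW r0).
have wz0 t : cofR r * cis t - z != 0 by rewrite -cmod_gt0 (lt_le_trans rz).
rewrite -(cauchy_formula fh zrr) -mulrA; apply: cmean_bound.
  move=> t; apply: contM; first by apply: (hol_circle_cont fh); rewrite (ltW r0).
  exact: (contM (cont_idC _) (cont_subV (wz0 t))).
move=> t; rewrite cmodM; apply: ler_pM; rewrite ?cmod_ge0 //.
rewrite cmodM cmodV circle_norm ?(ltW r0) // ler_wpM2l ?(ltW r0) //.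
by rewrite lef_pV2 ?posrE ?cmod_gt0.
Qed.

Lemma hol_X f rho k : hol_off0 f rho -> hol_off0 (fun z => f z ^+ k) rho.
Proof.
move=> [fc df]; split=> [z zr|z z0 zr]; first exact: contX (fc z zr).
exact: diffC_X (df z z0 zr).
Qed.

(** Bernoulli's inequality: the powers of a number above 1 are unbounded. *)
Lemma power_bound (x c : R) : (forall k, x ^+ k <= c) -> x <= 1.
Proof.
move=> h; rewrite leNgt; apply/negP => x1.
have y0 : 0 < x - 1 by rewrite subr_gt0.
have bern k : 1 + (x - 1) *+ k <= x ^+ k.
  elim: k => [|k IH]; first by rewrite expr0 mulr0n addr0.
  rewrite exprS; have x0 : 0 <= x by rewrite (le_trans ler01) // ltW.
  apply: le_trans (ler_wpM2l x0 IH); rewrite mulrS -[(x - 1) *+ k]mulr_natr.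
  have k0 : 0 <= (x - 1) * ((x - 1) * k%:R) by rewrite !mulr_ge0 ?(ltW y0).
  by move: k0; lra.
have c0 : 0 <= c by rewrite (le_trans _ (h 0%N)).
have := archi_boundP (divr_ge0 c0 (ltW y0)); set k := Num.Def.archi_bound _.
rewrite ltr_pdivrMr // mulrC mulr_natr => ck.
have := le_trans (bern k) (h k); rewrite leNgt => /negP; apply.
by apply: lt_le_trans ck _; rewrite lerDr.
Qed.

(* The factor [2] and the kernel in [cauchy_bound] disappear when the estimate is
   applied to the powers of [f]. *)
Lemma maximum_principle f rho r z (M : R) : hol_off0 f rho -> cmod z < r < rho ->
  0 < M -> (forall t, cmod (f (cofR r * cis t)) <= M) -> cmod (f z) <= M.
Proof.
move=> fh zrr M0 fM; have /andP[zr rrho] := zrr.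
suff : cmod (f z) / M <= 1 by rewrite ler_pdivrMr // mul1r.
apply: (@power_bound _ (2 * (r / (r - cmod z)))) => k.
rewrite expr_div_n ler_pdivrMr ?exprn_gt0 // -cmodX.
rewrite mulrAC; apply: (cauchy_bound (hol_X k fh) zrr) => t.
by rewrite cmodX lerXn2r ?nnegrE ?cmod_ge0 ?(ltW M0).
Qed.

Lemma hol_shift f a rho : (forall z, cmod (z - a) < rho -> differentiable f z) ->
  hol_off0 (fun z => f (z + a)) rho.
Proof.
move=> df; apply: hol_intro => z zr.
apply: (@diffC_comp _ f (fun z => z + a)); last by apply: df; rewrite addrK.
exact: diffC_D (diff_id _) (diff_cstC _ _).
Qed.

Lemma derive_shift1 a z : is_derive z 1 (fun w : C => w + a) 1.
Proof.
apply/deriveCP => e e0; exists 1 => // w _.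
rewrite mul1r opprD addrACA subrr addr0 subrr cmod0.
by rewrite mulr_ge0 ?cmod_ge0 // ltW.
Qed.

Lemma derive_translate f a z : differentiable f (z + a) ->
  'D_1 (fun w => f (w + a)) z = 'D_1 f (z + a).
Proof.
move=> df; rewrite -[RHS]mulr1.
have := is_derive_comp (h := fun w => w + a) (diff_derive df) (derive_shift1 a z).
by case.
Qed.

(** Adding the quadratic expansions at [w] and at [a] shows that the derivative varies at most
    linearly, so the slope at [w] can be replaced by the slope at [a]. With [w = a] this is a Taylor
    estimate; with both points free it yields local injectivity. *)
Lemma strict_diff f a rho : 0 < rho ->
  (forall z, cmod (z - a) < rho -> differentiable f z) ->
  exists2 K : R, 0 < K & exists2 s : R, 0 < s & forall z w,
    cmod (z - a) <= s -> cmod (w - a) <= s ->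
    cmod (f z - f w - 'D_1 f a * (z - w)) <=
      K * (cmod (z - a) + cmod (w - a)) * cmod (z - w).
Proof.
move=> rho0 df; have fh := hol_shift df.
have s0 : 0 < rho / 2 by rewrite divr_gt0.
have sr : rho / 2 < rho by rewrite ltr_pdivrMr // mulr_natr mulr2n ltrDl.
have [|K K0 [_ H]] := taylor2 fh (s := rho / 2); first by rewrite ltW.
exists (4 * K); first by rewrite mulr_gt0.
exists (rho / 2) => // z w zs ws.
have H' u v : cmod (u - a) <= rho / 2 -> cmod (v - a) <= rho / 2 ->
    cmod (f u - f v - 'D_1 f v * (u - v)) <= K * cmod (u - v) ^+ 2.
  move=> us vs; have := H (u - a) (v - a) us vs; rewrite !subrK derive_translate.
    by rewrite subrK (_ : u - a - (v - a) = u - v) //; ring.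
  by apply: df; rewrite subrK; exact: le_lt_trans vs sr.
have aa : cmod (a - a) <= rho / 2 by rewrite subrr cmod0 ltW.
have Dlip : cmod ('D_1 f w - 'D_1 f a) <= 2 * K * cmod (w - a).
  have [->|wa] := eqVneq w a; first by rewrite !subrr cmod0 mulr0.
  have wa0 : 0 < cmod (w - a) by rewrite cmod_gt0 subr_eq0.
  rewrite -(ler_pM2r wa0) -cmodM.
  have h1 := H' w a ws aa; have h2 := H' a w aa ws.
  have alg (p q x y u v : C) :
    (p - q) * (u - v) = (x - y - q * (u - v)) + (y - x - p * (v - u)) by ring.
  rewrite (alg _ _ (f w) (f a)).
  apply: le_trans (cmodD _ _) _.
  rewrite (cmodB a w) in h2; move: h1 h2; rewrite expr2.
  by move: (cmod (w - a)) (cmod _) (cmod _) => x y z0 *; lra.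
have alg (p q x y t : C) : x - y - q * t = (x - y - p * t) + (p - q) * t by ring.
rewrite (alg ('D_1 f w)).
apply: le_trans (cmodD _ _) _; rewrite cmodM.
have h1 := H' z w zs ws; have h2 := ler_wpM2r (cmod_ge0 (z - w)) Dlip.
have zw : cmod (z - w) <= cmod (z - a) + cmod (w - a).
  by have -> : z - w = (z - a) - (w - a); [ring|rewrite -(cmodN (w - a)) cmodD].
have h3 := ler_wpM2r (mulr_ge0 (ltW K0) (cmod_ge0 (z - w))) zw.
have h4 : 0 <= K * cmod (z - w) * cmod (z - a) by rewrite !mulr_ge0 ?cmod_ge0 // ltW.
have h5 : 0 <= K * cmod (z - w) * cmod (w - a) by rewrite !mulr_ge0 ?cmod_ge0 // ltW.
move: h1 h2 h3 h4 h5; rewrite expr2.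
move: (cmod (z - w)) (cmod (z - a)) (cmod (w - a)) (cmod _) (cmod _) => x y t p q.
by move=> *; lra.
Qed.

Lemma circle_compact r : compact [set z : C | cmod z = r].
Proof.
have -> : [set z : C | cmod z = r] = [set z | cmod z <= r] `&` [set z | r <= cmod z].
  apply/seteqP; split=> z /=; first by move=> ->.
  by case=> h1 h2; apply/eqP; rewrite eq_le h1 h2.
apply: compact_closedI; first exact: disc_compact.
rewrite -[X in closed X]setCK; apply: open_closedC.
rewrite openE => z /= /negP; rewrite -ltNge => rz.
apply/nbhsCP; exists (r - cmod z); first by rewrite subr_gt0.
move=> w wz; apply/negP; rewrite -ltNge.
by have := le_lt_trans (cmod_triB w z) wz; rewrite ltrBlDr subrK.
Qed.

Lemma circle_min f r : 0 <= r ->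
  (forall z, cmod z = r -> {for z, continuous f}) ->
  (forall z, cmod z = r -> f z != 0) ->
  exists2 m : R, 0 < m & forall z, cmod z = r -> m <= cmod (f z).
Proof.
move=> r0 fc fn0.
have [||c + hc] := @compact_EVT_min C R (fun z => cmod (f z)) _ _ (@circle_compact r).
- by exists (cofR r); rewrite /mkset cmod_cofR ger0_norm.
- by apply: continuous_in_subspaceT => z; rewrite inE => zr; apply: cont_cmod; exact: fc.
rewrite inE => cr; exists (cmod (f c)); first by rewrite cmod_gt0 fn0.
by move=> w wr; apply: hc; rewrite inE.
Qed.

(** Were [w] omitted, [1 / (f - w)] would be holomorphic. Its value at [a] has modulus above
    [4 / m], but the mean value property bounds it by twice its maximum on a circle where
    [|f - f a| >= m], that is by [8 / (3 * m)]. *)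
Lemma open_mapping f a rho : 0 < rho ->
  (forall z, cmod (z - a) < rho -> differentiable f z) ->
  (forall z, cmod (z - a) < rho -> f z = f a -> z = a) ->
  forall e : R, 0 < e -> exists2 d : R, 0 < d & forall w, cmod (w - f a) < d ->
    exists2 z, cmod (z - a) < e & f z = w.
Proof.
move=> rho0 df fa e e0; pose rho' := Num.min e rho.
have rho'0 : 0 < rho' by rewrite lt_min e0 rho0.
have fh : hol_off0 (fun z => f (z + a)) rho'.
  by apply: (hol_sub _ (hol_shift df)); rewrite ge_min lexx orbT.
pose r := rho' / 2.
have r0 : 0 < r by rewrite divr_gt0.
have rr : r < rho' by rewrite ltr_pdivrMr // mulr_natr mulr2n ltrDl.
have [||m m0 Hm] := circle_min (f := fun z => f (z + a) - f a) (ltW r0).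
- move=> z zr; apply: contB; last exact: cont_cst.
  by case: fh => fc _; apply: fc; rewrite zr.
- move=> z zr; rewrite subr_eq0; apply/eqP => /fa; rewrite addrK => h.
  have /(canRL (addrK _)) : z + a = a.
    by apply: h; rewrite zr (lt_le_trans rr) // ge_min lexx orbT.
  rewrite subrr => z0; move: zr; rewrite z0 cmod0 => r00.
  by rewrite -r00 ltxx in r0.
(* With [m / 4] the contradiction reads [1 <= 2 / 3], despite the factor 2 in [cmean_bound]. *)
exists (m / 4); first by rewrite divr_gt0.
move=> w wd; apply: contrapT => nw.
have nz z : cmod z < rho' -> f (z + a) - w != 0.
  move=> zr; rewrite subr_eq0; apply/eqP => fzw; apply: nw; exists (z + a) => //.
  by rewrite addrK (lt_le_trans zr) // ge_min lexx.
have ph : hol_off0 (fun z => (f (z + a) - w)^-1) rho'.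
  apply: hol_intro => z zr.
  apply: (@diffC_V _ (fun z => f (z + a) - w)); first exact: nz.
  exact: diffC_B (removable fh zr) (diff_cstC _ _).
have [pc pd] := ph.
have r01 : 0 <= r < rho' by rewrite (ltW r0).
have mv : cmean (fun z => (f (z + a) - w)^-1) r = (f a - w)^-1.
  rewrite -[in RHS](add0r a); apply: (mean_value (lexx 0) pc _ r01) => z z0 zr _.
  exact: pd.
have bd t : cmod ((f (cofR r * cis t + a) - w)^-1) <= 4 / (3 * m).
  have := Hm (cofR r * cis t); rewrite circle_norm ?(ltW r0) // => /(_ erefl) h.
  have h2 : 3 * m / 4 <= cmod (f (cofR r * cis t + a) - w).
    have := cmod_triB (f (cofR r * cis t + a) - f a) (w - f a).
    have -> : f (cofR r * cis t + a) - f a - (w - f a) = f (cofR r * cis t + a) - w by ring.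
    by move: wd h; move: (cmod _) (cmod _) (cmod _) => x y z *; lra.
  rewrite cmodV -[4 / _]invf_div lef_pV2 // ?posrE; last by rewrite !divr_gt0 ?mulr_gt0.
  by apply: lt_le_trans h2; rewrite divr_gt0 ?mulr_gt0.
have := cmean_bound (hol_circle_cont ph r01) bd; rewrite mv cmodV => h.
have faw : 0 < cmod (f a - w).
  by rewrite cmod_gt0; have := nz 0; rewrite add0r cmod0 => /(_ rho'0).
move: h; rewrite -(ler_pM2r faw) mulVf ?gt_eqF // cmodB => h.
have : 2 * (4 / (3 * m)) * cmod (w - f a) < 2 * (4 / (3 * m)) * (m / 4).
  by rewrite ltr_pM2l // mulr_gt0 // divr_gt0 // mulr_gt0.
have -> : 2 * (4 / (3 * m)) * (m / 4) = 2 / 3 by field; rewrite gt_eqF.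
by move=> /(le_lt_trans h); rewrite ltr_pdivlMr // mul1r ltr_nat.
Qed.

Lemma inverse_derive f (ga : C -> C) w0 (d : C) (e : R) :
  is_derive (ga w0) 1 f d -> d != 0 -> {for w0, continuous ga} -> 0 < e ->
  (forall w, cmod (w - w0) < e -> f (ga w) = w) -> is_derive w0 1 ga d^-1.
Proof.
move=> /deriveCP df d0 /contCP gc e0 fg; apply/deriveCP => c c0.
have dd : 0 < cmod d by rewrite cmod_gt0.
(* The first bound makes [ga] Lipschitz at [w0] with constant [2 / cmod d]; the second is the
   accuracy wanted after multiplication by this constant and by [cmod d ^-1]. *)
pose c' := Num.min (cmod d / 2) (c * cmod d ^+ 2 / 2).
have c'0 : 0 < c' by rewrite lt_min !divr_gt0 ?mulr_gt0 ?exprn_gt0.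
have [r r0 Hr] := df c' c'0; have [r1 r10 Hr1] := gc r r0.
exists (Num.min e r1); first by rewrite lt_min e0.
move=> w; rewrite lt_min => /andP[we wr]; have := Hr _ (Hr1 _ wr).
have fw0 : f (ga w0) = w0 by apply: fg; rewrite subrr cmod0.
rewrite fg // fw0; set y := ga w - ga w0; set x := w - w0 => h.
have h1 : c' <= cmod d / 2 by rewrite ge_min lexx.
have h2 : c' <= c * cmod d ^+ 2 / 2 by rewrite ge_min lexx orbT.
have yx : cmod y <= 2 / cmod d * cmod x.
  have := cmodD (- (x - d * y)) x; have -> : - (x - d * y) + x = d * y by ring.
  rewrite cmodM cmodN => h3.
  have h4 := le_trans h (ler_wpM2r (cmod_ge0 y) h1).
  rewrite mulrAC ler_pdivlMr //; move: h3 h4.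
  by move: (cmod d) (cmod y) (cmod x) (cmod _) => a b z t *; lra.
have -> : y - d^-1 * x = - (d^-1 * (x - d * y)) by field.
rewrite cmodN cmodM cmodV mulrC ler_pdivrMr //.
apply: le_trans h _; apply: le_trans (ler_wpM2r (cmod_ge0 y) h2) _.
have := ler_wpM2l (ltW (_ : 0 < c * cmod d ^+ 2 / 2)) yx.
rewrite !divr_gt0 ?mulr_gt0 ?exprn_gt0 // => /(_ isT) /le_trans; apply.
by rewrite le_eqVlt; apply/orP; left; apply/eqP; field; rewrite gt_eqF.
Qed.

Lemma iter_slope_hol f rho k : 0 < rho -> hol_off0 f rho ->
  hol_off0 (iter k (fun h => slope h 0) f) rho.
Proof. by move=> rho0 fh; elim: k => //= k IH; exact: hol_slope. Qed.

Lemma iter_slopeE f k z :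
  (forall j, (0 < j < k)%N -> iter j (fun h => slope h 0) f 0 = 0) ->
  (0 < k)%N -> f z = f 0 + z ^+ k * iter k (fun h => slope h 0) f z.
Proof.
elim: k => // k IH h _; case: k IH h => [|k] IH h.
  by rewrite {1}(slopeE f 0 z) subr0 expr1.
rewrite {1}IH //; last by move=> j /andP[j0 jk]; apply: h; rewrite j0 ltnS ltnW.
rewrite (slopeE _ 0 z) h ?ltnSn // add0r subr0 [z ^+ k.+2]exprSr mulrA //.
Qed.

(* An injective map has a finite order of contact with the constant [f 0]: if all
   Taylor coefficients vanished, Cauchy estimates would make it constant. *)
Lemma injective_order f rho : 0 < rho -> hol_off0 f rho ->
  (forall z, cmod z < rho -> f z = f 0 -> z = 0) ->
  exists k (Q : C -> C), [/\ hol_off0 Q rho, Q 0 != 0 &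
    forall z, f z = f 0 + z ^+ k.+1 * Q z].
Proof.
move=> rho0 fh finj; pose sl k := iter k (fun h => slope h 0) f.
have [ex|nex] := pselect (exists k, sl k.+1 0 != 0).
  have [k slk mk] := ex_minnP ex; exists k, (sl k.+1); split => //.
    exact: iter_slope_hol.
  move=> z; apply: iter_slopeE => // -[//|j] /andP[_ jk].
  apply/eqP; apply: contraTT jk; rewrite -/(sl j.+1) => /mk.
  by rewrite -ltnS -leqNgt.
have sl0 j : sl j.+1 0 = 0.
  by apply/eqP; apply: contrapT => h; apply: nex; exists j; apply/negP.
(* Since [cmod z = r / 2], vanishing to order [k.+1] gains a factor [2 ^- k.+1] on the bound over
   the circle of radius [r]. *)
pose r := rho / 2; pose z := cofR (rho / 4) : C.
have r0 : 0 < r by rewrite divr_gt0.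
have rr : r < rho by rewrite ltr_pdivrMr // mulr_natr mulr2n ltrDl.
have zE : cmod z = rho / 4 by rewrite cmod_cofR gtr0_norm // divr_gt0.
have zr : cmod z < r by rewrite zE /r ltr_pM2l // ltf_pV2 ?posrE // ltr_nat.
have [|M M0 HM] := disc_bounded (f := f) (r := r).
  by move=> w wr; case: fh => fc _; apply: fc; exact: le_lt_trans wr rr.
have key k : (2 ^+ k.+1) * cmod (f z - f 0) <= 2 * (2 * M) * (r / (r - cmod z)).
  have Ek w : f w = f 0 + w ^+ k.+1 * sl k.+1 w.
    by apply: iter_slopeE => // -[//|j] _; exact: sl0.
  rewrite (Ek z) addrC addKr cmodM cmodX.
  have slh : hol_off0 (sl k.+1) rho by exact: iter_slope_hol.
  have := cauchy_bound slh (z := z) (r := r) (M := 2 * M / r ^+ k.+1).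
  rewrite zr rr => /(_ isT) h.
  have {}h : cmod (sl k.+1 z) <= 2 * (2 * M / r ^+ k.+1) * (r / (r - cmod z)).
    apply: h => t; rewrite ler_pdivlMr ?exprn_gt0 //.
    rewrite -{2}(circle_norm t (ltW r0)) -cmodX -cmodM mulrC.
    have -> : (cofR r * cis t) ^+ k.+1 * sl k.+1 (cofR r * cis t) =
      f (cofR r * cis t) - f 0 by rewrite (Ek (cofR r * cis t)) addrC addKr.
    apply: le_trans (cmodD _ _) _; rewrite cmodN mulr_natl mulr2n.
    by apply: lerD; apply: HM; rewrite ?circle_norm ?cmod0 // ltW.
  have c2 : 0 <= 2 ^+ k.+1 * cmod z ^+ k.+1 by rewrite mulr_ge0 ?exprn_ge0 ?cmod_ge0.
  rewrite [leLHS]mulrA; apply: le_trans (ler_wpM2l c2 h) _.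
  rewrite -exprMn zE (_ : 2 * (rho / 4) = r); last by rewrite /r; field.
  rewrite le_eqVlt; apply/orP; left; apply/eqP; field.
  have -> : r * 4 - rho = rho by rewrite /r; field.
  by rewrite expf_neq0 !gt_eqF.
exfalso; have fz : 0 < cmod (f z - f 0).
  rewrite cmod_gt0 subr_eq0; apply/eqP => /finj; rewrite (lt_trans zr rr) => /(_ isT).
  by move=> z0; move: zE; rewrite z0 cmod0 => /esym/eqP; rewrite gt_eqF // divr_gt0.
have : 2 <= 1 :> R; last by rewrite leNgt ltr1n.
apply: (@power_bound _ (Num.max 1 (2 * (2 * M) * (r / (r - cmod z)) / cmod (f z - f 0)))).
move=> [|k]; first by rewrite expr0 le_max lexx.
by rewrite le_max ler_pdivlMr // key orbT.
Qed.

(** In [f z = f 0 + z ^+ k.+1 * Q z] the derivative is [z ^+ k * (k.+1 * Q z + z * Q' z)], and near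
    0 the term with [Q 0 != 0] dominates the bracket. *)
Lemma derive_neq0_near f rho : 0 < rho -> hol_off0 f rho ->
  (forall z, cmod z < rho -> f z = f 0 -> z = 0) ->
  exists2 r : R, 0 < r < rho & forall z, z != 0 -> cmod z < r -> 'D_1 f z != 0.
Proof.
move=> rho0 fh finj; have [k [Q [Qh Q0 fE]]] := injective_order rho0 fh finj.
have s0 : 0 < rho / 2 by rewrite divr_gt0.
have sr : rho / 2 < rho by rewrite ltr_pdivrMr // mulr_natr mulr2n ltrDl.
have [|K K0 [HK _]] := taylor2 Qh (s := rho / 2); first by rewrite ltW.
have q0 : 0 < cmod (Q 0) by rewrite cmod_gt0.
have Qc : {for 0, continuous Q} by case: Qh => Qc _; apply: Qc; rewrite cmod0.
have q2 : 0 < cmod (Q 0) / 2 by rewrite divr_gt0.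
have [d d0 Hd] := (contCP Q 0).1 Qc _ q2.
pose r := Num.min (Num.min (rho / 2) d) (cmod (Q 0) / 2 / K).
exists r; first by rewrite !lt_min s0 d0 !divr_gt0 //= !gt_min sr.
move=> z z0; rewrite !lt_min => /andP[/andP[zs zd] zK].
have zrho : cmod z < rho := lt_trans zs sr.
have dQ := diff_derive (removable Qh zrho).
have -> : 'D_1 f z = z ^+ k * (k.+1%:R * Q z + z * 'D_1 Q z).
  apply: (derive_unique (diff_derive (removable fh zrho))).
  have -> : f = (fun w => f 0 + w ^+ k.+1 * Q w) by apply/funext => w.
  apply: (deriveC_eq _ (deriveC_D (deriveC_cst (f 0) z)
    (deriveC_M (deriveC_X z k) dQ))).
  have alg (n p q e : C) : 0 + (n * p * q + z * p * e) = p * (n * q + z * e) by ring.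
  by rewrite exprS alg.
rewrite mulf_neq0 ?expf_neq0 //; apply/negP => /eqP h.
have h1 : cmod (k.+1%:R * Q z) = cmod (z * 'D_1 Q z).
  by rewrite -[in RHS]cmodN; congr cmod; apply/eqP; rewrite -subr_eq0 opprK h.
have h2 : cmod (z * 'D_1 Q z) < cmod (Q 0) / 2.
  rewrite cmodM; apply: le_lt_trans (ler_wpM2l (cmod_ge0 z) (HK _ (ltW zs))) _.
  by rewrite -ltr_pdivlMr.
have h3 : cmod (Q z) <= cmod (k.+1%:R * Q z).
  rewrite cmodM -cofR_nat cmod_cofR ger0_norm ?ler0n //.
  by rewrite ler_peMl ?cmod_ge0 // ler1n.
have := Hd z; rewrite subr0 => /(_ zd); have := cmod_triB (Q 0) (Q z).
rewrite cmodB; move: h1 h2 h3; move: (cmod _) (cmod (Q 0)) (cmod (Q z)) (cmod _) (cmod _).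
by move=> *; lra.
Qed.

End HolomorphicFunctions.

(** * Holomorphic inverses, Schwarz lemma, second coefficient, primitives *)

Section InverseAndSchwarz.
Context {R : realType}.
Local Notation C := (Cplx R).
Implicit Types (f h : C -> C) (r s rho : R) (z w u a : C).

Lemma eq_near_derive f h z (d : C) (e : R) : 0 < e ->
  (forall w, cmod (w - z) < e -> f w = h w) -> is_derive z 1 f d ->
  is_derive z 1 h d.
Proof.
move=> e0 fh /deriveCP df; apply/deriveCP => c c0.
have [r r0 H] := df c c0; exists (Num.min e r); first by rewrite lt_min e0 r0.
move=> w; rewrite lt_min => /andP[we wr]; rewrite -!fh //; last by rewrite subrr cmod0.
exact: H.
Qed.

(** Off the image of the disc the value is the default [0], so each use has to exhibit a
    preimage. *)
Definition disc_inverse f rho w : C := xget 0 [set z | cmod z < rho /\ f z = w].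

Lemma disc_inverseP f rho w z : cmod z < rho -> f z = w ->
  cmod (disc_inverse f rho w) < rho /\ f (disc_inverse f rho w) = w.
Proof.
move=> zr fz; rewrite /disc_inverse; case: xgetP => [y -> [] //|] /(_ z) [].
by split.
Qed.

Definition inj_on_disc f rho := forall z w, cmod z < rho -> cmod w < rho ->
  f z = f w -> z = w.

Lemma disc_inverseK f rho z : inj_on_disc f rho -> cmod z < rho ->
  disc_inverse f rho (f z) = z.
Proof.
by move=> fi zr; have [h1 h2] := disc_inverseP zr (erefl (f z)); exact: fi.
Qed.

Lemma disc_image_open f rho z : hol_off0 f rho -> inj_on_disc f rho ->
  cmod z < rho -> forall e : R, 0 < e ->
  exists2 d : R, 0 < d & forall w, cmod (w - f z) < d ->
    exists u, [/\ cmod u < rho, cmod (u - z) < e & f u = w].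
Proof.
move=> fh fi zr e e0; have rz : 0 < rho - cmod z by rewrite subr_gt0.
have near_z u : cmod (u - z) < rho - cmod z -> cmod u < rho.
  move=> uz; have := cmodD (u - z) z; rewrite subrK => /le_lt_trans; apply.
  by rewrite -ltrBrDr.
have h1 u : cmod (u - z) < rho - cmod z -> differentiable f u.
  by move=> /near_z ur; exact: removable fh ur.
have h2 u : cmod (u - z) < rho - cmod z -> f u = f z -> u = z.
  by move=> /near_z ur; exact: fi.
have e1 : 0 < Num.min e (rho - cmod z) by rewrite lt_min e0.
have [d d0 Hd] := open_mapping rz h1 h2 e1.
exists d => // w /Hd [u]; rewrite lt_min => /andP[ue /near_z ur] fu.
by exists u.
Qed.

Lemma disc_inverse_cont f rho z : hol_off0 f rho -> inj_on_disc f rho ->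
  cmod z < rho -> {for f z, continuous (disc_inverse f rho)}.
Proof.
move=> fh fi zr; apply/contCP => e e0.
have [d d0 Hd] := disc_image_open fh fi zr e0; exists d => // w /Hd [u [ur uz <-]].
by rewrite !disc_inverseK.
Qed.

Lemma disc_inverse_derive_at f rho z : hol_off0 f rho -> inj_on_disc f rho ->
  cmod z < rho -> 'D_1 f z != 0 ->
  is_derive (f z) 1 (disc_inverse f rho) ('D_1 f z)^-1.
Proof.
move=> fh fi zr fz0; have [d d0 Hd] := disc_image_open fh fi zr ltr01.
apply: (inverse_derive (f := f) (e := d) _ fz0 (disc_inverse_cont fh fi zr) d0).
  by rewrite disc_inverseK //; exact: diff_derive (removable fh zr).
by move=> w /Hd [u [ur _ fu]]; have [_ ->] := disc_inverseP ur fu.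
Qed.

Lemma shift_cont f a z : {for z + a, continuous f} ->
  {for z, continuous (fun w => f (w + a))}.
Proof.
move=> /contCP fc; apply/contCP => e /fc [d d0 Hd]; exists d => // w wz.
by apply: Hd; rewrite opprD addrACA subrr addr0.
Qed.

Lemma shift_diff f a z : differentiable f (z + a) ->
  differentiable (fun w => f (w + a)) z.
Proof.
move=> df.
exact: (@diffC_comp _ f (fun w => w + a) z (diffC_D (diff_id _) (diff_cstC _ _)) df).
Qed.

(* The inverse is continuous at [f 0] and holomorphic nearby off that point, hence
   holomorphic there too, and the chain rule gives [f' 0 <> 0]. *)
Lemma injective_derive0_neq0 f rho : 0 < rho -> hol_off0 f rho ->
  inj_on_disc f rho -> 'D_1 f 0 != 0.
Proof.
move=> rho0 fh fi.
have c0 : cmod (0 : C) < rho by rewrite cmod0.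
have [|r /andP[r0 rr] Hr] := derive_neq0_near rho0 fh.
  by move=> z zr; exact: fi.
have fhr : hol_off0 f r := hol_sub (ltW rr) fh.
have fir : inj_on_disc f r.
  by move=> z w zr wr; apply: fi; [exact: lt_trans rr|exact: lt_trans rr].
have c0r : cmod (0 : C) < r by rewrite cmod0.
have [d d0 Hd] := disc_image_open fhr fir c0r ltr01.
pose ga := disc_inverse f r; pose Ga u := ga (u + f 0).
have img u : cmod u < d -> exists2 z, cmod z < r & f z = u + f 0.
  move=> ud; have [|z [zr _ fz]] := Hd (u + f 0); first by rewrite addrK.
  by exists z.
have GaH : hol_off0 Ga d.
  split=> [u ud|u u0 ud]; have [z zr fz] := img u ud.
    by apply: shift_cont; rewrite -fz; exact: disc_inverse_cont.
  apply: shift_diff; rewrite -fz; apply: derive_diff.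
  apply: disc_inverse_derive_at => //; apply: Hr => //.
  apply: contra u0 => /eqP z0; move: fz; rewrite z0 => /eqP.
  by rewrite -subr_eq0 opprD addrCA subrr addr0 oppr_eq0.
have c0d : cmod (0 : C) < d by rewrite cmod0.
have dGa := diff_derive (removable GaH c0d).
have df := deriveC_B (diff_derive (removable fh c0)) (deriveC_cst (f 0) 0).
have dcomp : is_derive (0 : C) 1 (fun z => Ga (f z - f 0)) ('D_1 Ga 0 * ('D_1 f 0 - 0)).
  by apply: (is_derive_comp (f := Ga) (h := fun z => f z - f 0)); rewrite ?subrr.
have /(eq_near_derive r0) : forall z, cmod (z - 0) < r -> Ga (f z - f 0) = z.
  by move=> z; rewrite subr0 => zr; rewrite /Ga subrK; exact: disc_inverseK.
move=> /(_ _ dcomp) /derive_unique /(_ (deriveC_id 0)); rewrite subr0 => h.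
by apply: contra_eq_neq h => ->; rewrite mulr0 eq_sym oner_neq0.
Qed.

Lemma injective_derive_neq0 f rho z : hol_off0 f rho -> inj_on_disc f rho ->
  cmod z < rho -> 'D_1 f z != 0.
Proof.
move=> fh fi zr; have rz : 0 < rho - cmod z by rewrite subr_gt0.
have near_z u : cmod u < rho - cmod z -> cmod (u + z) < rho.
  by move=> uz; apply: le_lt_trans (cmodD _ _) _; rewrite -ltrBrDr.
have := @injective_derive0_neq0 (fun w => f (w + z)) _ rz.
rewrite derive_translate ?add0r; last exact: removable fh zr.
apply.
  by apply: hol_shift => u uz; apply: (removable fh); rewrite -(subrK z u) near_z.
move=> u v /near_z uz /near_z vz /(fi _ _ uz vz); exact: addIr.
Qed.

Lemma disc_inverse_derive f rho z : hol_off0 f rho -> inj_on_disc f rho ->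
  cmod z < rho -> is_derive (f z) 1 (disc_inverse f rho) ('D_1 f z)^-1.
Proof.
by move=> fh fi zr; apply: disc_inverse_derive_at => //; exact: injective_derive_neq0 fh fi zr.
Qed.

(** The maximum principle bounds [slope f 0] by [1 / r] on the disc of radius [r], for every
    [r < 1]. *)
Lemma schwarz f z : hol_off0 f 1 -> f 0 = 0 -> (forall w, cmod w < 1 -> cmod (f w) <= 1) ->
  cmod z < 1 -> cmod (f z) <= cmod z.
Proof.
move=> fh f0 f1 z1; rewrite (slopeE f 0 z) f0 add0r subr0 cmodM.
rewrite ler_piMr ?cmod_ge0 //.
have Sh := hol_slope ltr01 fh.
have key r : cmod z < r < 1 -> cmod (slope f 0 z) * r <= 1.
  move=> /andP[zr r1]; have r0 : 0 < r := le_lt_trans (cmod_ge0 z) zr.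
  rewrite -ler_pdivlMr // div1r; apply: (maximum_principle (r := r) Sh).
  - by rewrite zr.
  - by rewrite invr_gt0.
  - move=> t; set w := cofR r * cis t.
    have wr : cmod w = r by rewrite circle_norm // ltW.
    have := f1 w; rewrite wr r1 => /(_ isT).
    rewrite (slopeE f 0 w) f0 add0r subr0 cmodM wr => h.
    by rewrite -(ler_pM2l r0) divff ?gt_eqF.
rewrite leNgt; apply/negP => S1; have S0 := lt_trans ltr01 S1.
(* A radius beyond both [cmod z] and the inverse of the slope, but below 1, contradicts [key]. *)
pose r := (Num.max (cmod z) (cmod (slope f 0 z))^-1 + 1) / 2.
have m1 : Num.max (cmod z) (cmod (slope f 0 z))^-1 < 1 by rewrite gt_max z1 invf_lt1.
have := midf_lt m1; rewrite -/r => -[h1 h2].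
have := key r; rewrite h2 (le_lt_trans _ h1) ?le_max ?lexx // => /(_ isT).
rewrite leNgt => /negP; apply.
by rewrite mulrC -ltr_pdivrMr // div1r (le_lt_trans _ h1) // le_max lexx orbT.
Qed.

Lemma subordination g phi z : hol_off0 g 1 -> inj_on_disc g 1 ->
  hol_off0 phi 1 -> phi 0 = g 0 ->
  (forall w, cmod w < 1 -> exists2 u, cmod u < 1 & g u = phi w) ->
  cmod z < 1 -> exists2 u, cmod u <= cmod z & g u = phi z.
Proof.
move=> gh gi [pc pd] p0 img z1; pose om w := disc_inverse g 1 (phi w).
have omP w : cmod w < 1 -> cmod (om w) < 1 /\ g (om w) = phi w.
  by move=> w1; have [u u1 gu] := img w w1; exact: disc_inverseP gu.
have omh : hol_off0 om 1.
  split=> [w w1|w w0 w1]; have [u u1 gu] := img w w1.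
    apply: (@continuous_comp _ _ _ phi (disc_inverse g 1)); first exact: pc.
    by rewrite -gu; exact: disc_inverse_cont.
  apply: (@diffC_comp _ (disc_inverse g 1) phi); first exact: pd.
  by rewrite -gu; exact: derive_diff (disc_inverse_derive gh gi u1).
have om0 : om 0 = 0 by rewrite /om p0 disc_inverseK // cmod0.
exists (om z); last by have [] := omP z z1.
by apply: schwarz => // w /omP [/ltW].
Qed.

(** The mean is the same on all larger circles, where it becomes arbitrarily small. *)
Lemma cmean_invX r k : 0 < r -> cmean (fun w : C => (w ^+ k.+1)^-1) r = 0.
Proof.
move=> r0; apply: cmod_arbitrarily_small => e e0.
pose r' := Num.max r (Num.max 1 (2 / e)).
have rr' : r <= r' by rewrite le_max lexx.
have r'1 : 1 <= r' by rewrite !le_max lexx orbT.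
have r'e : 2 / e <= r' by rewrite !le_max lexx !orbT.
have r'0 : 0 < r' := lt_le_trans r0 rr'.
have dk w : w != 0 -> differentiable (fun w : C => (w ^+ k.+1)^-1) w.
  move=> w0; apply: (@diffC_V _ (fun w => w ^+ k.+1)); first by rewrite expf_neq0.
  exact: diffC_X (diff_id _).
have cn0 t : cofR r' * cis t != 0 by rewrite -cmod_gt0 circle_norm // ltW.
rewrite (@cmean_annulus _ _ r r'); last first.
- by move=> w /andP[rw _]; apply: dk; rewrite -cmod_gt0 (lt_le_trans r0).
- by rewrite r0.
apply: le_trans (@cmean_bound _ _ r' r'^-1 _ _) _.
- by move=> t; apply: diffC_cont; exact: dk.
- move=> t; rewrite cmodV cmodX circle_norm ?(ltW r'0) //.
  by rewrite lef_pV2 ?posrE ?exprn_gt0 // ler_eXnr.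
by rewrite ler_pdivrMr // mulrC -ler_pdivrMr.
Qed.

(** For holomorphic [f] this is [f''(0) / 2]. *)
Definition coef2 f : C := 'D_1 (slope f 0) 0.

(** Dividing [f w = f 0 + w * f'(0) + w ^+ 2 * S w] by [w ^+ 2] leaves two negative powers of mean 0
    and the function [S], whose mean is [S 0]. *)
Lemma cmean_coef2 f rho r : hol_off0 f rho -> 0 < r < rho ->
  cmean (fun w => f w / w ^+ 2) r = coef2 f.
Proof.
move=> fh /andP[r0 rr]; have rho0 := lt_trans r0 rr.
have S1 := hol_slope rho0 fh; have S2 := hol_slope rho0 S1.
have wn0 t : cofR r * cis t != 0 :> C by rewrite -cmod_gt0 circle_norm // ltW.
have rr0 : 0 <= r < rho by rewrite ltW.
have ic k : circle_cont (fun w : C => (w ^+ k.+1)^-1) r.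
  move=> t; apply: (@contV _ _ (fun w : C => w ^+ k.+1)); first by rewrite expf_neq0.
  exact: (@contX _ _ (fun w : C => w) _ k.+1 (cont_idC _)).
have cc c k : circle_cont (fun w : C => c * (w ^+ k.+1)^-1) r.
  by move=> t; exact: contM (cont_cst _ _) (ic k t).
pose S := slope (slope f 0) 0.
have Sc : circle_cont S r := hol_circle_cont S2 rr0.
have -> : cmean (fun w => f w / w ^+ 2) r =
   cmean (fun w => (f 0 * (w ^+ 2)^-1 + slope f 0 0 * (w ^+ 1)^-1) + S w) r.
  apply: cmean_eq => t; set w := cofR r * cis t; have w0 : w != 0 := wn0 t.
  rewrite (slopeE f 0 w) (slopeE (slope f 0) 0 w) subr0 -/S.
  have alg (x y s : C) : (x + w * (y + w * s)) / w ^+ 2 =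
    x * (w ^+ 2)^-1 + y * (w ^+ 1)^-1 + s by field.
  exact: alg.
have cAB : circle_cont (fun w => f 0 * (w ^+ 2)^-1 + slope f 0 0 * (w ^+ 1)^-1) r.
  by move=> t; exact: contD (cc (f 0) 1%N t) (cc (slope f 0 0) 0%N t).
rewrite (cmeanD cAB Sc) (cmeanD (cc (f 0) 1%N) (cc (slope f 0 0) 0%N)).
rewrite (cmeanZ _ (ic 1%N)) (cmeanZ _ (ic 0%N)) !cmean_invX //.
rewrite !mulr0 !add0r; have [s1 s2] := S2.
rewrite (mean_value (lexx 0) s1 _ rr0) //; last by move=> z z0 zr _; exact: s2.
by rewrite /S /slope eqxx.
Qed.

Lemma derive_lipschitz f rho s : hol_off0 f rho -> 0 <= s < rho ->
  exists2 K : R, 0 < K & forall z w, cmod z <= s -> cmod w <= s ->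
    cmod ('D_1 f z - 'D_1 f w) <= K * cmod (z - w).
Proof.
move=> fh sr; have [K K0 [_ H]] := taylor2 fh sr.
exists (2 * K); first by rewrite mulr_gt0.
move=> z w zs ws; have [->|zw] := eqVneq z w; first by rewrite !subrr cmod0 mulr0.
have zw0 : 0 < cmod (z - w) by rewrite cmod_gt0 subr_eq0.
rewrite -(ler_pM2r zw0) -cmodM.
have h1 := H z w zs ws; have h2 := H w z ws zs.
have alg (p q x y u v : C) :
  (p - q) * (u - v) = (x - y - q * (u - v)) + (y - x - p * (v - u)) by ring.
rewrite (alg _ _ (f z) (f w)).
apply: le_trans (cmodD _ _) _.
rewrite (cmodB w z) in h2; move: h1 h2; rewrite expr2.
by move: (cmod (z - w)) (cmod _) (cmod _) => x y z0 *; lra.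
Qed.

Lemma derive_cont_hol f rho z : hol_off0 f rho -> cmod z < rho ->
  {for z, continuous (fun w => 'D_1 f w : C)}.
Proof.
move=> fh zr; pose s := (cmod z + rho) / 2.
have zs : cmod z < s by rewrite midf_lt.
have sr : s < rho by rewrite midf_lt.
have [|K K0 H] := derive_lipschitz fh (s := s).
  by rewrite sr (le_trans (cmod_ge0 z)) // ltW.
apply/contCP => e e0; exists (Num.min (s - cmod z) (e / K)).
  by rewrite lt_min subr_gt0 zs divr_gt0.
move=> w; rewrite lt_min => /andP[w1 w2].
have ws : cmod w <= s.
  have := cmodD (w - z) z; rewrite subrK => /le_trans; apply.
  by rewrite -lerBrDr ltW.
apply: le_lt_trans (H w z ws (ltW zs)) _.
by rewrite mulrC -ltr_pdivlMr.
Qed.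

(** Integration along the ray to [z]. There is no differentiation under the integral sign: [k z] is
    written as the integral of the derivative of [t k (t z)], after which the remainder of the
    increment is an integral of second-order terms controlled by [taylor2]. *)
Lemma primitive k rho : 0 < rho -> hol_off0 k rho -> exists Phi : C -> C,
  Phi 0 = 0 /\ forall z, cmod z < rho -> is_derive z 1 Phi (k z).
Proof.
move=> rho0 kh.
exists (fun z => z * cint 0 1 (fun t => k (cofR t * z))).
split=> [|z zr]; first by rewrite mul0r.
have [s [zs sr]] : exists s, cmod z < s /\ s < rho.
  by exists ((cmod z + rho) / 2); rewrite !midf_lt.
have s0 : 0 < s := le_lt_trans (cmod_ge0 z) zs.
have [|K K0 [HK H]] := taylor2 kh (s := s); first by rewrite sr ltW.
(* [s * K] bounds the Taylor remainder multiplied by [w], [K] the term with ['D_1 k], and the factor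
   2 is that of [cint_bound]. *)
pose K' := 2 * (s * K + K).
have K'0 : 0 < K' by rewrite /K' mulr_gt0 // addr_gt0 // mulr_gt0.
apply: (derive_quadratic (s := s) (K := K') (D := k) _ K'0 zs) => {z zr zs}.
move=> w z ws zs.
have tz (u : C) t : cmod u <= s -> 0 <= t <= 1 -> cmod (cofR t * u) <= s.
  move=> us /andP[t0 t1]; rewrite cmodM cmod_cofR ger0_norm //.
  by apply: le_trans us; rewrite ler_piMl ?cmod_ge0.
have sc (u : C) t : {for t, continuous (fun t : R => cofR t * u)}.
  exact: (contM (rderiv_cont (rderiv_cofR t)) (cont_cst u t)).
have kc u : cmod u <= s -> path_continuous 0 1 (fun t => k (cofR t * u)).
  move=> us t t01; apply: (@continuous_comp _ _ _ (fun t => cofR t * u) k t (sc u t)).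
  by case: kh => kc _; apply: kc; apply: le_lt_trans sr; exact: tz.
have dkc u : cmod u <= s -> path_continuous 0 1 (fun t => 'D_1 k (cofR t * u)).
  move=> us t t01.
  apply: (@continuous_comp _ _ _ (fun t => cofR t * u) (fun w => 'D_1 k w : C) t (sc u t)).
  by apply: (derive_cont_hol kh); apply: le_lt_trans sr; exact: tz.
(* The derivative of [t k (t z)], whose increment over [[0, 1]] is [k z]. *)
pose A t := k (cofR t * z) + cofR t * ('D_1 k (cofR t * z) * z).
have Ac : path_continuous 0 1 A.
  move=> t t01; apply: (contD (kc z zs t t01)).
  apply: (contM (rderiv_cont (rderiv_cofR t))).
  exact: (contM (dkc z zs t t01) (cont_cst z t)).
have kzE : k z = cint 0 1 A.
  rewrite (cint_FTC (F := fun t => cofR t * k (cofR t * z)) ler01 _ Ac).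
    by rewrite cofR0 cofR1 !mul1r mul0r subr0.
  move=> t t01; rewrite -[A t]mulr1.
  apply: (rderiv_comp (f := fun u => u * k (u * z)) (phi := fun t => cofR t)); last exact: rderiv_cofR.
  have tzr : cmod (cofR t * z) < rho by apply: le_lt_trans sr; exact: tz.
  have dkz : is_derive (cofR t) 1 (fun u => k (u * z)) ('D_1 k (cofR t * z) * z).
    apply: (is_derive_comp (f := k) (h := fun u => u * z)).
      exact: diff_derive (removable kh tzr).
    apply: (deriveC_eq _ (deriveC_M (deriveC_id _) (deriveC_cst z _))).
    by rewrite mul1r mulr0 addr0.
  apply: (deriveC_eq _ (deriveC_M (deriveC_id _) dkz)).
  by rewrite mul1r.
pose B t := w * k (cofR t * w) - z * k (cofR t * z) - (w - z) * A t.
have wkc u : cmod u <= s -> path_continuous 0 1 (fun t => u * k (cofR t * u)).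
  by move=> us; exact: (path_continuousM (@path_continuous_cst _ 0 1 u) (kc u us)).
have wac : path_continuous 0 1 (fun t => (w - z) * A t).
  exact: (path_continuousM (@path_continuous_cst _ 0 1 (w - z)) Ac).
have -> : w * cint 0 1 (fun t => k (cofR t * w)) - z * cint 0 1 (fun t => k (cofR t * z))
    - k z * (w - z) = cint 0 1 B.
  rewrite kzE /B (cintB (path_continuousB (wkc w ws) (wkc z zs)) wac).
  rewrite (cintB (wkc w ws) (wkc z zs)).
  by rewrite (cintZ w (kc w ws)) (cintZ z (kc z zs)) (cintZ (w - z) Ac) [(w - z) * _]mulrC.
have Bc : path_continuous 0 1 B.
  exact: (path_continuousB (path_continuousB (wkc w ws) (wkc z zs)) wac).
have -> : K' * cmod (w - z) ^+ 2 = 2 * ((s * K + K) * cmod (w - z) ^+ 2) * (1 - 0).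
  by rewrite /K'; ring.
apply: (cint_bound ler01 Bc) => t t01.
have -> : B t = w * (k (cofR t * w) - k (cofR t * z) - 'D_1 k (cofR t * z) * (cofR t * w - cofR t * z))
   + cofR t * (w - z) ^+ 2 * 'D_1 k (cofR t * z).
  rewrite /B /A; move: ('D_1 k _) (k _) (k _) => p q x; ring.
have /andP[t0 t1] := t01.
apply: le_trans (cmodD _ _) _; rewrite mulrDl; apply: lerD.
  rewrite cmodM -mulrA; apply: ler_pM; rewrite ?cmod_ge0 //.
  apply: le_trans (H _ _ (tz w t ws t01) (tz z t zs t01)) _.
  rewrite ler_wpM2l ?(ltW K0) // -mulrBr cmodM cmod_cofR ger0_norm //.
  by rewrite lerXn2r ?nnegrE ?mulr_ge0 ?cmod_ge0 // ler_piMl ?cmod_ge0.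
rewrite cmodM mulrC; apply: ler_pM; rewrite ?cmod_ge0 //.
  by apply: HK; exact: tz.
rewrite cmodM cmodX cmod_cofR ger0_norm //.
by rewrite ler_piMl // exprn_ge0 // cmod_ge0.
Qed.

End InverseAndSchwarz.

(** * Injectivity of starlike maps *)

Section Starlike.
Context {R : realType}.
Local Notation C := (Cplx R).
Variables F g : C -> C.
Hypothesis Fh : hol_off0 F 1.
Hypothesis F0 : F 0 = 0.
Hypothesis F_neq0 : forall z, cmod z < 1 -> z != 0 -> F z != 0.
Hypothesis dF_neq0 : forall z, cmod z < 1 -> 'D_1 F z != 0.
Hypothesis g_Re : forall z, cmod z < 1 -> 0 < cRe (g z).
Hypothesis FE : forall z, cmod z < 1 -> F z = z * g z * 'D_1 F z.

Lemma disc_diff z : cmod z < 1 -> forall w, cmod (w - z) < 1 - cmod z ->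
  differentiable F w.
Proof.
move=> z1 w wz; apply: (removable Fh).
have := cmodD (w - z) z; rewrite subrK => /le_lt_trans; apply.
by rewrite -ltrBrDr.
Qed.

(* Following the flow of [w' = - w g(w)] for a short time: [F] is multiplied by
   [1 - c] while the modulus decreases. *)
Lemma local_flow z (e : R) : cmod z < 1 -> z != 0 -> 0 < e ->
  exists2 d : R, 0 < d & forall c : R, 0 < c < d -> exists w,
    [/\ cmod (w - z) < e, cmod w < cmod z & F w = cofR (1 - c) * F z].
Proof.
move=> z1 z0 e0; have z1' : 0 < 1 - cmod z by rewrite subr_gt0.
have [K K0 [s s0 HK]] := strict_diff z1' (disc_diff z1).
set D : C := 'D_1 F z in HK; have D0 : 0 < cmod D by rewrite cmod_gt0 dF_neq0.
have HK1 u : cmod (u - z) <= s -> cmod (F u - F z - D * (u - z)) <= K * cmod (u - z) ^+ 2.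
  move=> us; have := HK u z us; rewrite subrr cmod0 addr0 expr2 mulrA; apply.
  exact: ltW.
have nz : 0 < cmod z by rewrite cmod_gt0.
(* Within [rh] the quadratic error is at most half the linear term, so [z] is the only preimage of
   [F z] there. *)
pose rh : R := Num.min (1 - cmod z) (Num.min s (cmod D / 2 / K)).
have rh0 : 0 < rh by rewrite !lt_min z1' s0 !divr_gt0.
have half u : cmod (u - z) < rh -> K * cmod (u - z) ^+ 2 <= cmod D / 2 * cmod (u - z).
  rewrite !lt_min => /andP[_ /andP[_ h]].
  by rewrite expr2 mulrA ler_wpM2r ?cmod_ge0 // mulrC -ler_pdivlMr // ltW.
have inS u : cmod (u - z) < rh -> cmod (u - z) <= s.
  by rewrite !lt_min => /andP[_ /andP[/ltW]].
have om1 u : cmod (u - z) < rh -> differentiable F u.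
  by rewrite !lt_min => /andP[h _]; exact: disc_diff z1 u h.
have om2 u : cmod (u - z) < rh -> F u = F z -> u = z.
  move=> ur Fuz; have := HK1 u (inS u ur); rewrite Fuz subrr sub0r cmodN cmodM.
  move=> /le_trans /(_ (half u ur)) h; apply/eqP; rewrite -subr_eq0 -cmod_eq0.
  rewrite eq_le cmod_ge0 andbT leNgt; apply/negP => h2.
  move: h; rewrite ler_pM2r // ler_pdivlMr // ger_pMr // => h.
  by move: h; rewrite leNgt ltr1n.
have e1 : 0 < Num.min e rh by rewrite lt_min e0 rh0.
have [d1 d10 Hd1] := open_mapping rh0 om1 om2 e1.
have Fz : 0 < cmod (F z) by rewrite cmod_gt0 F_neq0.
have gz : 0 < cRe (g z) := g_Re z1.
set G := cmod (g z); have G0 : 0 < G := lt_le_trans gz (cRe_le _).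
(* [A * c ^+ 2] collects the second-order terms of [cmod (1 + eta) ^+ 2] below; the bound imposed on
   [c] keeps them under the first-order gain [2 * c * cRe (g z)]. *)
pose A := 2 * (K * (4 * cmod z * G ^+ 2) / cmod D) + 4 * G ^+ 2.
have A0 : 0 < A.
  rewrite /A addr_gt0 // ?mulr_gt0 ?invr_gt0 ?exprn_gt0 //.
exists (Num.min (d1 / cmod (F z)) (2 * cRe (g z) / A)).
  by rewrite lt_min divr_gt0 //= divr_gt0 // mulr_gt0.
move=> c; rewrite lt_min => /andP[c0 /andP[cd cA]].
have [|u + FuE] := Hd1 (cofR (1 - c) * F z).
  have -> : cofR (1 - c) * F z - F z = - (cofR c * F z) by rewrite cofRB cofR1; ring.
  by rewrite cmodN cmodM cmod_cofR gtr0_norm // -ltr_pdivlMr.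
rewrite lt_min => /andP[ue ur]; exists u; split => //.
have h1 := HK1 u (inS u ur); have h2 := half u ur.
(* The relative displacement [eta] equals [- c g(z)] to first order, by [FE]; its real part is thus
   negative for small [c], which makes the modulus decrease. *)
pose eta := (u - z) / z; pose err := F u - F z - D * (u - z).
have uE : u = z * (1 + eta) by rewrite /eta; field.
have errE : err = - (D * z * (cofR c * g z + eta)).
  by rewrite /err FuE (FE z1) -/D cofRB cofR1 /eta; field.
have y1 : cmod (u - z) <= 2 * c * cmod z * G.
  have h3 := le_trans h1 h2; have := cmodD (- err) (F u - F z).
  have -> : - err + (F u - F z) = D * (u - z) by rewrite /err; ring.
  have -> : F u - F z = - (cofR c * (z * g z * D)).
    by rewrite FuE (FE z1) -/D cofRB cofR1; ring.
  rewrite !cmodN !cmodM cmod_cofR gtr0_norm // -/G => h4.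
  have h5 : cmod D * cmod (u - z) <= cmod D * (2 * c * cmod z * G).
    move: h3 h4; rewrite -/err; move: (cmod err) (cmod (u - z)) => x y h3 h4.
    have -> : cmod D * (2 * c * cmod z * G) = 2 * (c * (cmod z * G * cmod D)) by ring.
    by move: h3 h4; move: (c * (cmod z * G * cmod D)) => p; lra.
  by move: h5; rewrite ler_pM2l.
have eta1 : cmod eta <= 2 * c * G.
  rewrite /eta cmodM cmodV ler_pdivrMr // mulrAC.
  by rewrite (_ : 2 * c * cmod z * G = 2 * c * G * cmod z) in y1 *; [|ring].
have err1 : cmod (cofR c * g z + eta) <= K * (4 * cmod z * G ^+ 2) / cmod D * c ^+ 2.
  have Dz : 0 < cmod D * cmod z by rewrite mulr_gt0.
  rewrite -(ler_pM2l Dz) -!cmodM -cmodN -errE.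
  apply: le_trans h1 _.
  have -> : cmod (D * z) * (K * (4 * cmod z * G ^+ 2) / cmod D * c ^+ 2) =
    K * (2 * c * cmod z * G) ^+ 2 by rewrite cmodM; field; rewrite gt_eqF.
  rewrite ler_wpM2l ?(ltW K0) // lerXn2r ?nnegrE ?cmod_ge0 //.
  by rewrite !mulr_ge0 ?ltW.
have Reta : cRe eta <= - (c * cRe (g z)) + K * (4 * cmod z * G ^+ 2) / cmod D * c ^+ 2.
  have := le_trans (cRe_le _) err1; rewrite cReD cRe_real.
  by rewrite -lerBrDl addrC.
have sq : cmod (1 + eta) ^+ 2 < 1.
  have -> : cmod (1 + eta) ^+ 2 = 1 + 2 * cRe eta + cmod eta ^+ 2.
    rewrite !cmod_sq cReD cImD (_ : cRe 1 = 1) // (_ : cIm 1 = 0) // add0r; ring.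
  have e2 : cmod eta ^+ 2 <= 4 * G ^+ 2 * c ^+ 2.
    have -> : 4 * G ^+ 2 * c ^+ 2 = (2 * c * G) ^+ 2 by ring.
    by rewrite lerXn2r ?nnegrE ?cmod_ge0 // !mulr_ge0 ?ltW.
  have cA2 : A * c ^+ 2 < 2 * cRe (g z) * c.
    by move: cA; rewrite ltr_pdivlMr // expr2 mulrA ltr_pM2r // mulrC.
  move: cA2; rewrite /A mulrDl => cA2.
  have alg (a x y b t : R) : 2 * a * c ^+ 2 + b * c ^+ 2 < 2 * t * c ->
    x <= - (c * t) + a * c ^+ 2 -> y <= b * c ^+ 2 -> 1 + 2 * x + y < 1.
    by clear; move=> h3 h4 h5; lra.
  exact: alg cA2 Reta e2.
rewrite uE cmodM gtr_pMr // -(ltr_pXn2r (n := 2)) ?nnegrE ?cmod_ge0 //.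
by rewrite expr1n.
Qed.

(** Consider the least factor [b >= c] for which [b F(z0)] is attained in the disc of radius
    [cmod z0]. If [b > c], the local flow from a preimage would reach a smaller factor without
    leaving that disc. *)
Lemma starlike z0 c : cmod z0 < 1 -> 0 <= c <= 1 ->
  exists2 z, cmod z <= cmod z0 & F z = cofR c * F z0.
Proof.
move=> z01 /andP[c0 c1].
have [->|z00] := eqVneq z0 0; first by exists 0 => //; rewrite F0 mulr0.
move: c0; rewrite le_eqVlt => /predU1P[<-|c0].
  by exists 0; rewrite ?cmod0 ?cmod_ge0 // F0 cofR0 mul0r.
pose T := [set b : R | c <= b <= 1 /\ exists2 z, cmod z <= cmod z0 & F z = cofR b * F z0].
have T1 : T 1 by split; [rewrite c1 lexx|exists z0; rewrite // cofR1 mul1r].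
have lbT : has_lbound T by exists c => b [/andP[]].
have hiT : has_inf T by split => //; exists 1.
pose b := inf T.
have cb : c <= b by apply: lb_le_inf; [exists 1|move=> x [/andP[]]].
have b1 : b <= 1 by exact: ge_inf.
have Fz0 : 0 < cmod (F z0) by rewrite cmod_gt0 F_neq0.
(* The infimum is attained: a minimiser of [|F z - b F z0|] on the closed disc gives the value 0,
   since admissible factors come arbitrarily close to [b]. *)
have Tb : exists2 z, cmod z <= cmod z0 & F z = cofR b * F z0.
  have [|z zz0 Hz] := disc_min (f := fun z => F z - cofR b * F z0) (cmod_ge0 z0).
    move=> z zz0; apply: contB; last exact: cont_cst.
    by apply: (Fh.1); exact: le_lt_trans zz0 z01.
  exists z => //; apply/eqP; rewrite -subr_eq0 -cmod_eq0 eq_le cmod_ge0 andbT leNgt.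
  apply/negP => m0.
  have [x [/andP[cx x1] [w wz0 Fw]]] := inf_adherent (divr_gt0 m0 Fz0) hiT.
  have bx : b <= x by apply: ge_inf => //; split; [rewrite cx|exists w].
  rewrite -/b => xb; have := Hz w wz0; rewrite Fw -mulrBl -cofRB cmodM cmod_cofR.
  rewrite ger0_norm ?subr_ge0 // leNgt => /negP; apply.
  by rewrite -ltr_pdivlMr // ltrBlDl.
have [z zz0 Fz] := Tb.
have [bc|bc] := leP b c.
  by exists z => //; rewrite Fz (_ : b = c) //; apply/eqP; rewrite eq_le bc cb.
have z1 := le_lt_trans zz0 z01; have b0 := lt_trans c0 bc.
have zn0 : z != 0.
  apply: contraTneq Fz0 => z00'; move: Fz; rewrite z00' F0 => /esym/eqP.
  by rewrite mulf_eq0 cofR_eq0 gt_eqF //= => /eqP ->; rewrite cmod0 ltxx.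
have [d d0 Hd] := local_flow z1 zn0 ltr01.
(* The second bound keeps the new factor [(1 - x) * b] at least [c]. *)
pose x := Num.min (d / 2) (1 - c / b).
have cb1 : 0 < 1 - c / b by rewrite subr_gt0 ltr_pdivrMr // mul1r.
have x0 : 0 < x by rewrite lt_min divr_gt0.
have [|w [_ wz Fw]] := Hd x.
  rewrite x0 /=; apply: le_lt_trans (_ : x <= d / 2) _; first by rewrite ge_min lexx.
  by rewrite ltr_pdivrMr // mulr_natr mulr2n ltrDl.
have xb : (1 - x) * b < b by rewrite gtr_pMl // ltrBlDr ltrDl.
suff /(ge_inf lbT) : T ((1 - x) * b) by rewrite -/b leNgt xb.
split.
  rewrite (le_trans (ltW xb) b1) andbT -ler_pdivrMr // lerBrDr addrC -lerBrDr.
  by rewrite ge_min lexx orbT.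
by exists w; [exact: le_trans (ltW wz) zz0|rewrite Fw Fz mulrA cofRM].
Qed.

Lemma local_injective z : cmod z < 1 -> exists2 s : R, 0 < s & forall u v,
  cmod (u - z) < s -> cmod (v - z) < s -> F u = F v -> u = v.
Proof.
move=> z1; have z1' : 0 < 1 - cmod z by rewrite subr_gt0.
have [K K0 [s s0 HK]] := strict_diff z1' (disc_diff z1).
set D : C := 'D_1 F z in HK; have D0 : 0 < cmod D by rewrite cmod_gt0 dF_neq0.
exists (Num.min s (cmod D / 2 / K)); first by rewrite lt_min s0 !divr_gt0.
move=> u v; rewrite !lt_min => /andP[us uD] /andP[vs vD] Fuv.
have := HK u v (ltW us) (ltW vs); rewrite Fuv subrr sub0r cmodN cmodM.
have h : K * (cmod (u - z) + cmod (v - z)) < cmod D.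
  by rewrite mulrC -ltr_pdivlMr // [cmod D]splitr mulrDl ltrD.
rewrite leNgt => /negP hn; apply/eqP; rewrite -subr_eq0 -cmod_eq0 eq_le cmod_ge0.
by rewrite andbT leNgt; apply/negP => uv; apply: hn; rewrite ltr_pM2r.
Qed.

(* Among the pairs violating injectivity choose one closest to the origin and move
   both points along the local flow. *)
Lemma starlike_injective : inj_on_disc F 1.
Proof.
move=> a b a1 b1 Fab; apply: contrapT => /eqP ab.
pose m := Num.max (cmod a) (cmod b).
have m1 : m < 1 by rewrite gt_max a1.
pose A := [set p : C * C | [/\ cmod p.1 <= m, cmod p.2 <= m, F p.1 = F p.2 & p.1 != p.2]].
have Acompact : compact A.
  apply: (subclosed_compact _ (compact_setX (@disc_compact R m) (@disc_compact R m))).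
  - move=> [u v] cuv.
    have ball_uv (e : R) : 0 < e -> exists u' v', [/\ A (u', v'), cmod (u' - u) < e & cmod (v' - v) < e].
      move=> e0; have [|[u' v'] [Auv' [h1 h2]]] := cuv ([set x | cmod (x - u) < e] `*` [set y | cmod (y - v) < e]).
        by exists ([set x | cmod (x - u) < e], [set y | cmod (y - v) < e]) => //=;
          split; apply/nbhsCP; exists e.
      by exists u', v'.
    have lem w : (forall e : R, 0 < e -> exists2 w', cmod w' <= m & cmod (w' - w) < e) -> cmod w <= m.
      move=> h; rewrite leNgt; apply/negP => mw.
      have [|w' w'm w'w] := h (cmod w - m); first by rewrite subr_gt0.
      have := cmod_triB w w'; rewrite cmodB => /le_lt_trans/(_ w'w).
      by rewrite ltrD2l ltrN2 ltNge w'm.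
    have um : cmod u <= m.
      apply: (lem u) => e /ball_uv [u' [v' [[/= h _ _ _] hu _]]]; by exists u'.
    have vm : cmod v <= m.
      apply: (lem v) => e /ball_uv [u' [v' [[/= _ h _ _] _ hv]]]; by exists v'.
    have u1 := le_lt_trans um m1; have v1 := le_lt_trans vm m1.
    split => //=.
      apply/eqP; rewrite -subr_eq0; apply/eqP; apply: cmod_arbitrarily_small => e e0.
      have e2 : 0 < e / 2 by rewrite divr_gt0.
      have [d d0 Hd] := (contCP F u).1 (Fh.1 u u1) _ e2.
      have [d' d'0 Hd'] := (contCP F v).1 (Fh.1 v v1) _ e2.
      have [|u' [v' [[_ _ /= Fuv _] hu hv]]] := ball_uv (Num.min d d').
        by rewrite lt_min d0.
      move: hu hv; rewrite !lt_min => /andP[hu _] /andP[_ hv].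
      have -> : F u - F v = (F v' - F v) - (F u' - F u) by rewrite Fuv; ring.
      apply: le_trans (cmodD _ _) _; rewrite cmodN [e]splitr.
      by apply: lerD; apply/ltW; [exact: Hd'|exact: Hd].
    (* Being off the diagonal is not a closed condition; that limits of violating pairs satisfy it
       comes from local injectivity. *)
    apply/negP => /eqP uv; have [s s0 Hs] := local_injective u1.
    have [u' [v' [[_ _ /= Fuv uv'] hu hv]]] := ball_uv s s0.
    by move/eqP: uv'; apply; apply: Hs; rewrite // uv.
  - by move=> [u v] [/= h1 h2 _ _]; split.
have A0 : A !=set0.
  by exists (a, b); split => //=; rewrite le_max lexx ?orbT.
pose N (p : C * C) : R := cmod p.1 + cmod p.2.
have Nc : continuous N.
  move=> p; apply: cvgD.
    by apply: (cvg_comp _ _ (@cvg_fst _ _ _ _ _)); apply: (cont_cmod (f := fun z => z)); exact: cont_idC.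
  by apply: (cvg_comp _ _ (@cvg_snd _ _ _ _ _)); apply: (cont_cmod (f := fun z => z)); exact: cont_idC.
have [[u v]] := compact_EVT_min A0 Acompact (continuous_subspaceT Nc).
rewrite inE => -[/= um vm Fuv uv] Nmin.
have u1 := le_lt_trans um m1; have v1 := le_lt_trans vm m1.
have u0 : u != 0.
  apply: contraNneq uv => u0; have : F v = 0 by rewrite -Fuv u0 F0.
  by case: (eqVneq v 0) => [->|/(F_neq0 v1) /eqP //]; rewrite u0.
have v0 : v != 0.
  apply: contraNneq uv => v0; have : F u = 0 by rewrite Fuv v0 F0.
  by case: (eqVneq u 0) => [->|/(F_neq0 u1) /eqP //]; rewrite v0.
(* Displacements below half the distance keep the two moved points distinct; a common [c] then keeps
   their images equal. *)
have e0 : 0 < cmod (u - v) / 2 by rewrite divr_gt0 // cmod_gt0 subr_eq0.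
have [d d0 Hd] := local_flow u1 u0 e0; have [d' d'0 Hd'] := local_flow v1 v0 e0.
pose c := Num.min d d' / 2.
have c0 : 0 < c by rewrite divr_gt0 // lt_min d0.
have cdd : c < Num.min d d'.
  by rewrite ltr_pdivrMr // mulr_natr mulr2n ltrDl lt_min d0.
move: cdd; rewrite lt_min => /andP[cd cd'].
have [|u' [uu lu Fu']] := Hd c; first by rewrite c0.
have [|v' [vv lv Fv']] := Hd' c; first by rewrite c0.
have : (u', v') \in A.
  rewrite inE; split => /=; [exact: le_trans (ltW lu) um|exact: le_trans (ltW lv) vm| |].
    by rewrite Fu' Fv' Fuv.
  apply: contraTneq uu => u'v'; rewrite -leNgt.
  have := cmodD (u' - v) (u - u'); have -> : u' - v + (u - u') = u - v by ring.
  rewrite u'v' -/v' (cmodB u v'); move: vv; move: (cmod _) (cmod _) (cmod _) => x y z.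
  by move=> *; lra.
by move/Nmin; rewrite /N /= leNgt ltrD.
Qed.

End Starlike.

(** * Norms and functionals on row vectors *)

Section RowVectors.
Context {R : realType} {n : nat}.
Local Notation C := (Cplx R).
Local Notation X := 'rV[Cplx R]_n.
Implicit Types (x y z : X) (a : C).

Definition supnorm x : R := cRe `|x|.

Lemma supnormE x : `|x| = cofR (supnorm x).
Proof.
have := normr_ge0 x; rewrite /supnorm; case: (`|x|) => a b.
by rewrite lecE /= => /andP[/eqP -> _].
Qed.

Lemma supnorm_ge0 x : 0 <= supnorm x.
Proof. by rewrite -cofR_le cofR0 -supnormE. Qed.

Lemma supnormZ a x : supnorm (a *: x) = cmod a * supnorm x.
Proof.
have := normrZ a x; rewrite normCE !supnormE -cofRM => h.
by apply/eqP; rewrite eq_le -!cofR_le h lexx.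
Qed.

Lemma supnormD x y : supnorm (x + y) <= supnorm x + supnorm y.
Proof. by rewrite -cofR_le cofRD -!supnormE ler_normD. Qed.

Lemma supnormN x : supnorm (- x) = supnorm x.
Proof. by rewrite /supnorm normrN. Qed.

Lemma supnorm_coord x j : cmod (x 0 j) <= supnorm x.
Proof.
rewrite -cofR_le -supnormE -normCE [leRHS]mx_normE.
exact: (le_bigmax _ (fun i : 'I_1 * 'I_n => `|x i.1 i.2|%:nng) (0, j)).
Qed.

Lemma nbhsXP x (P : X -> Prop) :
  (\forall y \near x, P y) <->
  exists2 e : R, 0 < e & forall y, supnorm (y - x) < e -> P y.
Proof.
split.
  move=> h; have [e /= /pos_cofR[r r0 ->] He] := (nbhs_normP x P).1 h; exists r => // y yx.
  by apply: He; rewrite /= supnormE cofR_lt -supnormN opprB.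
move=> [r r0 He]; apply: (nbhs_normP x P).2; exists (cofR r); first by rewrite /= -cofR0 cofR_lt.
by move=> y /=; rewrite supnormE cofR_lt -supnormN opprB; exact: He.
Qed.

Lemma cvgXP {T : Type} (F : set_system T) {FF : Filter F} (f : T -> X) x :
  f @ F --> x <-> forall e : R, 0 < e -> \forall t \near F, supnorm (f t - x) < e.
Proof.
split.
  move=> /cvgrPdist_lt h e e0; have := h (cofR e); rewrite -cofR0 cofR_lt.
  by move=> /(_ e0); apply: filterS => t; rewrite supnormE cofR_lt -supnormN opprB.
move=> h; apply/cvgrPdist_lt => e /pos_cofR[r r0 ->].
by apply: filterS (h r r0) => t; rewrite supnormE cofR_lt -supnormN opprB.
Qed.

Lemma row_decomp x : x = \sum_j x 0 j *: delta_mx 0 j.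
Proof. exact: row_sum_delta. Qed.

Lemma functionalZ (l : {linear X -> C}) a x : l (a *: x) = a * l x.
Proof. by rewrite linearZ. Qed.

Lemma linear_bound (l : {linear X -> C}) :
  exists2 K : R, 0 < K & forall x, cmod (l x) <= K * supnorm x.
Proof.
exists (1 + \sum_j cmod (l (delta_mx 0 j))).
  by rewrite ltr_pwDl // sumr_ge0 // => j _; exact: cmod_ge0.
move=> x; rewrite {1}[x]row_decomp linear_sum.
apply: le_trans (cmod_sum _ _ _) _.
rewrite mulrDl mulr_suml -[leLHS]add0r; apply: lerD.
  by rewrite mul1r supnorm_ge0.
apply: ler_sum => j _; rewrite linearZ cmodM mulrC.
by rewrite ler_wpM2l ?cmod_ge0 // supnorm_coord.
Qed.

Lemma linear_cont (l : {linear X -> C}) : continuous l.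
Proof.
move=> x; have [K K0 HK] := linear_bound l.
apply: (cvgCP (F := nbhs x) l (l x)).2 => e e0; apply: (nbhsXP x _).2; exists (e / K); first by rewrite divr_gt0.
move=> y yx; rewrite -linearB; apply: le_lt_trans (HK _) _.
by rewrite mulrC -ltr_pdivlMr.
Qed.

Variable N : X -> R.
Hypothesis hN : is_norm N.

Lemma normN_D x y : N (x + y) <= N x + N y. Proof. by case: hN. Qed.
Lemma normN_Z a x : N (a *: x) = cmod a * N x. Proof. by case: hN. Qed.
Lemma normN_eq0 x : N x = 0 -> x = 0. Proof. by case: hN => _ _; apply. Qed.

Lemma normN_0 : N 0 = 0.
Proof. by rewrite -(scale0r 0) normN_Z cmod0 mul0r. Qed.

Lemma normN_N x : N (- x) = N x.
Proof. by rewrite -scaleN1r normN_Z cmodN cmod1 mul1r. Qed.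

Lemma normN_ge0 x : 0 <= N x.
Proof.
by have := normN_D x (- x); rewrite subrr normN_0 normN_N -mulr2n pmulrn_lge0.
Qed.

Lemma normN_gt0 x : x != 0 -> 0 < N x.
Proof.
move=> x0; rewrite lt_def normN_ge0 andbT.
by apply: contra x0 => /eqP /normN_eq0 ->.
Qed.

Lemma normN_triB x y : N x - N y <= N (x - y).
Proof. by rewrite lerBlDr -{1}(subrK y x) normN_D. Qed.

Definition sublinear (p : X -> R) :=
  (forall x y, p (x + y) <= p x + p y) /\
  (forall t x, 0 <= t -> p (cofR t *: x) = t * p x).

Lemma sublinear0 p : sublinear p -> p 0 = 0.
Proof. by move=> [_ /(_ 0 0)]; rewrite lexx scaler0 mul0r; apply. Qed.

(* The functional is made odd in the direction [b] by subtracting as much of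
   [p b] as possible. *)
Lemma sublinear_odd_at p b : sublinear p -> exists p' : X -> R,
  [/\ sublinear p', forall x, p' x <= p x & p' (- b) = - p' b] /\
  p' (- b) <= - p b.
Proof.
move=> psub; have [pD pZ] := psub; have p0 := sublinear0 psub.
pose S x := [set p (x + cofR t *: b) - t * p b | t in [set t : R | 0 <= t]].
have Slb x t : 0 <= t -> - p (- x) <= p (x + cofR t *: b) - t * p b.
  move=> t0; have := pD (x + cofR t *: b) (- x).
  rewrite addrAC subrr add0r pZ //; lra.
have Sne x : S x !=set0 by exists (p (x + cofR 0 *: b) - 0 * p b), 0 => /=.
have Slow x : has_lbound (S x) by exists (- p (- x)) => _ [t t0 <-]; exact: Slb.
have Sinf x : has_inf (S x) by split.
pose p' x := inf (S x).
have p'le x t : 0 <= t -> p' x <= p (x + cofR t *: b) - t * p b.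
  by move=> t0; apply: ge_inf => //; exists t.
have p'adh x (e : R) : 0 < e -> exists2 t, 0 <= t & p (x + cofR t *: b) - t * p b < p' x + e.
  by move=> /inf_adherent /(_ (Sinf x)) [_ [t t0 <-] h]; exists t.
have p'p x : p' x <= p x.
  by have := p'le x 0 (lexx 0); rewrite cofR0 scale0r addr0 mul0r subr0.
have p'D x y : p' (x + y) <= p' x + p' y.
  apply/ler_addgt0Pr => e e0; have e2 : 0 < e / 2 by rewrite divr_gt0.
  have [t t0 ht] := p'adh x _ e2; have [s s0 hs] := p'adh y _ e2.
  have h1 := p'le (x + y) (t + s) (addr_ge0 t0 s0).
  have h2 := pD (x + cofR t *: b) (y + cofR s *: b).
  rewrite cofRD scalerDl addrACA in h1.
  have arith (q qx qy pb u v w : R) : w <= q - (t + s) * pb -> q <= qx + qy ->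
      qx - t * pb < u + e / 2 -> qy - s * pb < v + e / 2 -> w <= u + v + e.
    by clear; move=> *; lra.
  exact: arith h1 h2 ht hs.
have p'Zle x (a : R) : 0 < a -> p' (cofR a *: x) <= a * p' x.
  move=> a0; apply/ler_addgt0Pr => e e0.
  have [t t0 ht] := p'adh x _ (divr_gt0 e0 a0).
  have at0 : 0 <= a * t by rewrite mulr_ge0 // ltW.
  have := p'le (cofR a *: x) (a * t) at0.
  rewrite cofRM -scalerA -scalerDr (pZ _ _ (ltW a0)) -mulrA -mulrBr => /le_trans; apply.
  have := ler_wpM2l (ltW a0) (ltW ht) => /le_trans; apply.
  by rewrite mulrDr lerD2l mulrCA divff ?mulr1 // gt_eqF.
have p'0 : p' 0 = 0.
  apply/eqP; rewrite eq_le (le_trans (p'p 0)) ?p0 //=.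
  have := @lb_le_inf _ (S 0) 0 (Sne 0); apply => _ [t t0 <-].
  by rewrite add0r pZ // subrr.
have p'sub : sublinear p'.
  split=> // t x; rewrite le_eqVlt => /predU1P[<-|t0].
    by rewrite cofR0 scale0r mul0r.
  apply/eqP; rewrite eq_le p'Zle //=.
  have ti : 0 < t^-1 by rewrite invr_gt0.
  have := p'Zle (cofR t *: x) _ ti.
  rewrite scalerA -cofRM mulVf ?gt_eqF // cofR1 scale1r.
  by rewrite ler_pdivlMl.
have nb : p' (- b) <= - p b.
  by have := p'le (- b) 1 ler01; rewrite cofR1 scale1r addNr p0 mul1r sub0r.
exists p'; split=> //; split=> //.
have h1 := p'D b (- b); rewrite subrr p'0 in h1; have h2 := p'p b.
by move: nb h1 h2; move: (p' (- b)) (p' b) (p b) => *; lra.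
Qed.

Definition odd_at (p : X -> R) b := p (- b) = - p b.

Lemma odd_at_le p p' b : sublinear p' -> (forall x, p' x <= p x) -> odd_at p b ->
  odd_at p' b.
Proof.
move=> p's le; rewrite /odd_at => pb; have p'0 := sublinear0 p's.
case: p's => [p'D _]; have h1 := p'D b (- b); have h2 := le b; have h3 := le (- b).
rewrite subrr p'0 in h1; rewrite pb in h3.
by move: h1 h2 h3; move: (p' b) (p' (- b)) (p b) => *; lra.
Qed.

(** Oddness once gained survives the later steps, because they only decrease the functional
    ([odd_at_le]). *)
Lemma sublinear_odd_seq (s : seq X) p : sublinear p -> exists p' : X -> R,
  [/\ sublinear p', forall x, p' x <= p x & forall b, b \in s -> odd_at p' b].
Proof.
elim: s p => [|b s IH] p ps; first by exists p; split.
have [p1 [[p1s p1p p1b] _]] := sublinear_odd_at b ps.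
have [p2 [p2s p2p p2o]] := IH p1 p1s; exists p2; split=> //.
  by move=> x; exact: le_trans (p2p x) (p1p x).
move=> c; rewrite inE => /predU1P[->|/p2o //].
exact: odd_at_le p2p p1b.
Qed.

Lemma odd_atD p x y : sublinear p -> odd_at p x -> odd_at p y ->
  odd_at p (x + y) /\ p (x + y) = p x + p y.
Proof.
move=> ps; have p0 := sublinear0 ps; case: ps => pD _; rewrite /odd_at => ox oy.
have h1 := pD x y; have := pD (- x) (- y); rewrite -opprD ox oy => h2.
have := pD (x + y) (- (x + y)); rewrite subrr p0 => h3.
by move: h1 h2 h3; move: (p (x + y)) (p (- (x + y))) (p x) (p y) => *; split; lra.
Qed.

Lemma odd_atZ p t x : sublinear p -> odd_at p x ->
  odd_at p (cofR t *: x) /\ p (cofR t *: x) = t * p x.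
Proof.
move=> [pD pZ]; rewrite /odd_at => ox; have [t0|/ltW t0] := leP 0 t.
  by rewrite -scalerN !pZ // ox mulrN.
have nt : 0 <= - t by rewrite oppr_ge0.
have E : cofR t *: x = cofR (- t) *: (- x) by rewrite cofRN scaleNr scalerN opprK.
have E2 : - (cofR t *: x) = cofR (- t) *: x by rewrite cofRN scaleNr.
by rewrite E2 E !pZ // ox; split; ring.
Qed.

(** A sublinear minorant of [N] that is odd at the vectors of a real basis is real linear, so in
    finite dimension finitely many corrections replace the extension argument. The complex
    functional is recovered from its real part, and its modulus is bounded by rotating [x] until
    [l x] is nonnegative. *)
Lemma hahn_banach v : exists l : {linear X -> C},
  (forall x, cmod (l x) <= N x) /\ l v = cofR (N v).
Proof.
have Ns : sublinear N.
  split; first exact: normN_D.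
  by move=> t x t0; rewrite normN_Z cmod_cofR ger0_norm.
(* The direction [v] is treated while the functional is still [N]: this records [p1 (- v) <= - N v],
   which later forces [p v = N v]. *)
have [p1 [[p1s p1N p1v] p1v']] := sublinear_odd_at v Ns.
pose bs : seq X := [seq delta_mx 0 j | j <- enum 'I_n] ++
  [seq cI *: delta_mx 0 j | j <- enum 'I_n].
have [p [ps pp1 po]] := sublinear_odd_seq bs p1s.
have odd_all x : odd_at p x.
  rewrite [x]row_decomp; elim/big_ind: _ => [|y z oy oz|j _].
  - by rewrite /odd_at oppr0 (sublinear0 ps) oppr0.
  - by have [] := odd_atD ps oy oz.
  - rewrite (cplxE (x 0 j)) scalerDl -scalerA.
    have h1 : odd_at p (delta_mx 0 j).
      by apply: po; rewrite mem_cat map_f ?mem_enum.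
    have h2 : odd_at p (cI *: delta_mx 0 j).
      apply: po; rewrite mem_cat; apply/orP; right.
      by apply/mapP; exists j; rewrite ?mem_enum.
    have [h3 _] := odd_atZ (cRe (x 0 j)) ps h1.
    have [h4 _] := odd_atZ (cIm (x 0 j)) ps h2.
    by have [] := odd_atD ps h3 h4.
have pD x y : p (x + y) = p x + p y by have [] := odd_atD ps (odd_all x) (odd_all y).
have pZ t x : p (cofR t *: x) = t * p x by have [] := odd_atZ t ps (odd_all x).
(* The complex linear functional with real part [p]. *)
pose l0 x : C := cpt (p x) (- p (cI *: x)).
have lin : linear l0.
  move=> a x y; apply: cplx_eq; rewrite ?cReD ?cImD -?[_ *: l0 x]/(_ * _) ?cReM ?cImM /=.
    rewrite pD {1}(cplxE a) scalerDl -scalerA pD !pZ; ring.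
  rewrite scalerDr pD scalerA [cI * a]mulrC {1}(cplxE a) mulrDl scalerDl.
  rewrite -mulrA cIsq mulrN1 -scalerA pD pZ scaleNr (odd_all _) pZ; ring.
pose ladd := GRing.isLinear.Build _ _ _ _ _ lin.
have [l lE] : exists l : {linear X -> C}, forall x, l x = l0 x.
  by pose l1 : {linear X -> C} := HB.pack l0 ladd; exists l1.
have lN x : cmod (l x) <= N x.
  have [->|lx0] := eqVneq (l x) 0; first by rewrite cmod0 normN_ge0.
  have lx : 0 < cmod (l x) by rewrite cmod_gt0.
  pose c : C := cofR (cmod (l x)) / l x.
  have c1 : cmod c = 1.
    by rewrite cmodM cmodV cmod_cofR ger0_norm ?cmod_ge0 // divff // gt_eqF.
  have : l (c *: x) = cofR (cmod (l x)) by rewrite functionalZ divfK.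
  move=> /(congr1 (@cRe R)); rewrite cRe_cofR => <-.
  rewrite lE /=; apply: le_trans (pp1 _) _; apply: le_trans (p1N _) _.
  by rewrite normN_Z c1 mul1r.
exists l; split=> //.
have pv : p v = N v.
  have h1 := odd_all v; have h2 := pp1 (- v); have h3 := le_trans (pp1 v) (p1N v).
  by move: h1 h2 h3 p1v'; rewrite /odd_at; move: (p (- v)) (p v) (p1 (- v)) (N v) => *; lra.
have lv : cRe (l v) = N v by rewrite lE.
apply: cplx_eq => //; rewrite cIm_cofR.
have := lN v; rewrite -ler_sqr ?nnegrE ?cmod_ge0 ?normN_ge0 //.
by rewrite cmod_sq lv gerDl => h; apply/eqP; rewrite -sqrf_eq0 eq_le h sqr_ge0.
Qed.

End RowVectors.

(** * Differentials at the origin, supporting functionals, slices along complex lines *)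

Section BallMaps.
Context {R : realType} {n : nat}.
Local Notation C := (Cplx R).
Local Notation X := 'rV[Cplx R]_n.
Implicit Types (x y z : X) (a : C).

Lemma scaled_functional (l : {linear X -> C}) (e : C) :
  exists l' : {linear X -> C}, forall x, l' x = e * l x.
Proof.
have lin : linear (fun x => e * l x : C).
  by move=> a x y; rewrite linearD functionalZ mulrDr mulrCA.
pose ladd := GRing.isLinear.Build _ _ _ _ _ lin.
by pose l1 : {linear X -> C} := HB.pack (fun x => e * l x : C) ladd; exists l1.
Qed.

Lemma linear_diff (l : {linear X -> C}) z : differentiable l z.
Proof. by apply: linear_differentiable; exact: linear_cont. Qed.

Lemma differentiable_scale_id (c : X -> C) z : differentiable c z ->
  differentiable (fun x : X => c x *: x) z.
Proof.
move=> dc.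
have -> : (fun x : X => c x *: x) = \sum_j (fun x : X => (c x * x 0 j) *: (delta_mx 0 j : X)).
  apply/funext => x; rewrite fct_sumE {2}[x]row_decomp scaler_sumr.
  by apply: eq_bigr => j _; rewrite scalerA.
apply: differentiable_sum => j; apply: differentiableZl.
exact: (differentiableM dc (differentiable_coord z 0 j)).
Qed.

Lemma differential_eq (f : X -> X) : f 0 = 0 -> differentiable f 0 ->
  (forall e : R, 0 < e -> exists2 d : R, 0 < d & forall x, supnorm x < d ->
    supnorm (f x - x) <= e * supnorm x) -> ('d f 0 : X -> X) = idfun.
Proof.
move=> f0 df H.
apply: (@diff_unique _ _ _ f (idfun : {linear X -> X}) 0); first by move=> x; exact: cvg_id.
apply/eqaddoP => e /pos_cofR[r r0 ->].
have [d d0 Hd] := H r r0; apply: (nbhsXP 0 _).2; exists d => // x; rewrite subr0 => /Hd h.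
rewrite !supnormE -cofRM cofR_le.
by have -> : (f \o shift 0 - (cst (f 0) + idfun)) x = f x - x
  by rewrite !fctE /= f0 add0r addr0.
Qed.

Lemma differential_eqP (f : X -> X) : differentiable f 0 ->
  ('d f 0 : X -> X) = idfun -> f 0 = 0 ->
  (forall e : R, 0 < e -> exists2 d : R, 0 < d & forall x, supnorm x < d ->
    supnorm (f x - x) <= e * supnorm x).
Proof.
move=> df f1 f0 e e0; have := diff_locally df; rewrite f1.
move=> /eqaddoP /(_ (cofR e)); rewrite -cofR0 cofR_lt => /(_ e0) h.
have [d d0 Hd] := (nbhsXP 0 _).1 h.
exists d => // x xd; have := Hd x; rewrite subr0 => /(_ xd).
have -> : (f \o shift 0 - (cst (f 0) + idfun)) x = f x - x.
  by rewrite !fctE /= f0 add0r addr0.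
by rewrite !supnormE -cofRM cofR_le.
Qed.

Lemma uniform_cvgX (A : set X) (F : set_system (X -> X)) (f : X -> X) : Filter F ->
  (forall e : R, 0 < e -> \forall h \near F, forall x, A x -> supnorm (h x - f x) < e) ->
  {uniform A, F --> f}.
Proof.
move=> FF H P /uniform_nbhs [E [+ subP]]; rewrite -entourage_from_ballE.
case=> e /= /pos_cofR[r r0 ->] ballE; apply: filterS (H r r0) => h hr.
apply: subP => x Ax; apply: ballE; rewrite /= -ball_normE /=.
by rewrite supnormE cofR_lt -supnormN opprB; exact: hr.
Qed.

Lemma family_nbhsX (fam : set (set X)) (A : set X) (f : {family fam, X -> X}) (e : R) :
  0 < e -> fam A -> nbhs f [set h : {family fam, X -> X} | forall x, A x ->
    supnorm (h x - f x) < e].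
Proof.
move=> e0 famA; have ec : 0 < cofR e by rewrite -cofR0 cofR_lt.
have := fam_nbhs f (entourage_ball X (PosNum ec)) famA.
apply: filterS => h Hh x Ax; have := Hh x Ax; rewrite /= -ball_normE /=.
by rewrite supnormE cofR_lt -supnormN opprB.
Qed.

Variable N : X -> R.
Hypothesis hN : is_norm N.
Implicit Types (l : {linear X -> C}).

(** [sup] has the default value 0 on a set without supremum, so the value 1 itself shows that the
    set is bounded. *)
Lemma dual_norm_bound l : dual_norm N l = 1 -> forall x, cmod (l x) <= N x.
Proof.
rewrite /dual_norm; set S := [set _ | _ in _] => l1 x.
have hS : has_sup S.
  by apply: contrapT => nS; move: l1; rewrite sup_out // => /esym/eqP; rewrite oner_eq0.
have [->|x0] := eqVneq x 0; first by rewrite linear0 cmod0 normN_0.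
have Nx := normN_gt0 hN x0.
have : S (cmod (l (cofR (N x)^-1 *: x))).
  exists (cofR (N x)^-1 *: x) => //=.
  by rewrite (normN_Z hN) cmod_cofR ger0_norm ?invr_ge0 ?(ltW Nx) // mulVf ?gt_eqF.
move=> /(sup_upper_bound hS); rewrite l1 functionalZ cmodM cmod_cofR.
by rewrite ger0_norm ?invr_ge0 ?(ltW Nx) // mulrC ler_pdivrMr // mul1r.
Qed.

Lemma dual_norm_attained l z : (forall x, cmod (l x) <= N x) -> z != 0 ->
  l z = cofR (N z) -> support_functionals N z l.
Proof.
move=> lN z0 lz; split=> //; rewrite /dual_norm; set S := [set _ | _ in _].
have Nz := normN_gt0 hN z0.
have S1 : S 1.
  exists (cofR (N z)^-1 *: z) => /=.
    by rewrite (normN_Z hN) cmod_cofR ger0_norm ?invr_ge0 ?(ltW Nz) // mulVf ?gt_eqF.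
  by rewrite functionalZ lz -cofRM mulVf ?gt_eqF // cmod1.
have ubS : ubound S 1 by move=> _ [x /= x1 <-]; exact: le_trans (lN x) x1.
apply/eqP; rewrite eq_le; apply/andP; split.
  by apply: ge_sup => //; exists 1.
by apply: ub_le_sup => //; exists 1.
Qed.

Lemma support_functional_exists z : z != 0 -> exists l, support_functionals N z l.
Proof.
move=> z0; have [l [lN lz]] := hahn_banach hN z.
by exists l; exact: dual_norm_attained.
Qed.

Definition line_map (q : X -> X) l (u : X) : C -> C := fun w => l (q (w *: u)).

Lemma unit_ball_line u w : N u = 1 -> cmod w < 1 -> unit_ball N (w *: u).
Proof. by move=> u1 w1; rewrite /unit_ball /= (normN_Z hN) u1 mulr1. Qed.

Lemma line_map_diff q l u w : holB N q -> N u = 1 -> cmod w < 1 ->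
  differentiable (line_map q l u) w.
Proof.
move=> qh u1 w1.
have dl : differentiable (fun w : C => w *: u) w.
  by apply: differentiableZl; exact: diff_id.
have dq : differentiable q (w *: u) by apply: qh; exact: unit_ball_line.
have dqu := @differentiable_comp _ _ _ _ (fun w : C => w *: u) q w dl dq.
exact: (@differentiable_comp _ _ _ _ _ l w dqu (linear_diff l _)).
Qed.

Lemma line_map_hol q l u : holB N q -> N u = 1 -> hol_off0 (line_map q l u) 1.
Proof. by move=> qh u1; apply: hol_intro => w w1; exact: line_map_diff. Qed.

Lemma line_map_derive0 q l u : holB N q -> normalized q -> N u = 1 ->
  line_map q l u 0 = 0 /\ 'D_1 (line_map q l u) 0 = l u.
Proof.
move=> qh [q0 dq] u1; have lm0 : line_map q l u 0 = 0.
  by rewrite /line_map scale0r q0 linear0.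
split=> //.
have q0d : differentiable q 0 by apply: qh; rewrite /unit_ball /= normN_0.
have H := differential_eqP q0d dq q0.
suff h : is_derive (0 : C) 1 (line_map q l u) (l u) by case: h.
have [K K0 HK] := linear_bound l.
apply/deriveCP => e e0; have U0 : 0 < supnorm u + 1 by rewrite ltr_wpDl ?supnorm_ge0.
have [|d d0 Hd] := H (e / K / (supnorm u + 1)); first by rewrite !divr_gt0.
exists (d / (supnorm u + 1)); first by rewrite divr_gt0.
move=> w; rewrite subr0 lm0 subr0 => wd.
have -> : line_map q l u w - l u * w = l (q (w *: u) - w *: u).
  by rewrite linearB functionalZ mulrC.
apply: le_trans (HK _) _.
have wu : supnorm (w *: u) <= cmod w * (supnorm u + 1).
  by rewrite supnormZ ler_wpM2l ?cmod_ge0 // lerDl.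
have wud : supnorm (w *: u) < d.
  by apply: le_lt_trans wu _; rewrite -ltr_pdivlMr.
rewrite mulrC -ler_pdivlMr //; apply: le_trans (Hd _ wud) _.
rewrite -ler_pdivlMl ?divr_gt0 //; apply: le_trans wu _.
rewrite ler_pdivlMl ?divr_gt0 //.
rewrite le_eqVlt; apply/orP; left; apply/eqP; field.
by rewrite !gt_eqF.
Qed.

End BallMaps.

(** * The extremal map *)

Section ExtremalMap.
Context {R : realType}.
Local Notation C := (Cplx R).
Variables g Phi : C -> C.
Hypothesis gh : hol_off0 g 1.
Hypothesis g0 : g 0 = 1.
Hypothesis g_Re : forall z, cmod z < 1 -> 0 < cRe (g z).
Hypothesis Phi0 : Phi 0 = 0.
Hypothesis dPhi : forall z, cmod z < 1 ->
  is_derive z 1 Phi (slope (fun w => (g w)^-1) 0 z).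

Lemma g_neq0 z : cmod z < 1 -> g z != 0.
Proof. by move=> /g_Re; apply: contraTneq => ->; rewrite ltxx. Qed.

Definition kfun z : C := slope (fun w => (g w)^-1) 0 z.

Lemma kfunE z : z * kfun z = (g z)^-1 - 1.
Proof.
have := slopeE (fun w => (g w)^-1) 0 z; rewrite g0 invr1 subr0 => ->.
by rewrite addrC addKr.
Qed.

Lemma inv_g_hol : hol_off0 (fun w => (g w)^-1) 1.
Proof.
apply: hol_intro => z z1; apply: (@diffC_V _ g z (g_neq0 z1)).
exact: removable gh z1.
Qed.

Lemma kfun0 : kfun 0 = - 'D_1 g 0.
Proof.
have c0 : cmod (0 : C) < 1 by rewrite cmod0.
have := deriveC_V (g_neq0 c0) (diff_derive (removable gh c0)).
rewrite g0 expr1n divr1 => h; rewrite /kfun /slope eqxx.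
by case: h.
Qed.

Lemma derive_expPhi z : cmod z < 1 ->
  is_derive z 1 (fun w => cexp (Phi w)) (cexp (Phi z) * kfun z).
Proof. by move=> z1; exact: is_derive_comp (is_derive_cexp _) (dPhi z1). Qed.

Definition Fext z : C := z * cexp (Phi z).

Lemma derive_Fext z : cmod z < 1 -> is_derive z 1 Fext (cexp (Phi z) / g z).
Proof.
move=> z1; apply: (deriveC_eq _ (deriveC_M (deriveC_id z) (derive_expPhi z1))).
by rewrite mul1r mulrCA kfunE mulrBr mulr1 addrC subrK.
Qed.

Lemma Fext_hol : hol_off0 Fext 1.
Proof. by apply: hol_intro => z z1; exact: derive_diff (derive_Fext z1). Qed.

Lemma Fext0 : Fext 0 = 0.
Proof. by rewrite /Fext mul0r. Qed.

Lemma Fext_neq0 z : cmod z < 1 -> z != 0 -> Fext z != 0.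
Proof. by move=> _ z0; rewrite mulf_neq0 // cexp_neq0. Qed.

Lemma derive_FextE z : cmod z < 1 -> 'D_1 Fext z = cexp (Phi z) / g z.
Proof. by move=> /derive_Fext []. Qed.

Lemma derive_Fext_neq0 z : cmod z < 1 -> 'D_1 Fext z != 0.
Proof.
by move=> z1; rewrite derive_FextE // mulf_neq0 ?invr_eq0 ?cexp_neq0 ?g_neq0.
Qed.

Lemma FextE z : cmod z < 1 -> Fext z = z * g z * 'D_1 Fext z.
Proof.
move=> z1; rewrite derive_FextE // /Fext -mulrA; congr (_ * _).
by rewrite mulrCA divff ?mulr1 // g_neq0.
Qed.

Lemma Fext_inj : inj_on_disc Fext 1.
Proof.
exact: starlike_injective Fext_hol Fext0 Fext_neq0 derive_Fext_neq0 g_Re FextE.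
Qed.

(** The solution of [w' = - w g(w)] from [w0], obtained from the decay of [Fext] by [e^-u] along it.
    Time is complex so that complex differentiation rules apply. *)
Definition flow w0 u : C := disc_inverse Fext 1 (Fext w0 * cexp (- u)).

(* The trajectory of the field [g (l z) z] from [z] is [factor (l z) t *: z]. *)
Definition factor w0 u : C := cexp (Phi w0 - Phi (flow w0 u) - u).

Lemma flowP w0 (t : R) : cmod w0 < 1 -> 0 <= t ->
  cmod (flow w0 (cofR t)) <= cmod w0 /\
  Fext (flow w0 (cofR t)) = Fext w0 * cexp (- cofR t).
Proof.
move=> w01 t0.
have ct : 0 <= expR (- t) <= 1 by rewrite expR_ge0 -expR0 ler_expR oppr_le0.
have [z zw0 Fz] := starlike Fext_hol Fext0 Fext_neq0 derive_Fext_neq0 g_Re FextE w01 ct.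
have E : Fext w0 * cexp (- cofR t) = Fext z by rewrite Fz -cofRN cexp_cofR mulrC.
by rewrite /flow E (disc_inverseK Fext_inj) // (le_lt_trans zw0).
Qed.

(** The exponent in [factor] is a logarithm of [flow / w0]. Unlike the quotient it makes sense at
    [w0 = 0], where the factor is [e^-t]. *)
Lemma factorE w0 (t : R) : cmod w0 < 1 -> 0 <= t ->
  factor w0 (cofR t) * w0 = flow w0 (cofR t).
Proof.
move=> w01 t0; have [_] := flowP w01 t0; rewrite /factor /Fext.
set w := flow _ _; rewrite cexpN => h; rewrite !cexpB.
apply: (mulIf (cexp_neq0 (Phi w))); rewrite h; field.
by rewrite !cexp_neq0.
Qed.

Lemma flow0 w0 : cmod w0 < 1 -> flow w0 0 = w0.
Proof. by move=> w01; rewrite /flow oppr0 cexp0 mulr1 disc_inverseK //; exact: Fext_inj. Qed.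

Lemma factor0 w0 : cmod w0 < 1 -> factor w0 0 = 1.
Proof. by move=> w01; rewrite /factor flow0 // subrr subr0 cexp0. Qed.

Lemma cmod_factor w0 (t : R) : cmod w0 < 1 -> 0 <= t -> cmod (factor w0 (cofR t)) <= 1.
Proof.
move=> w01 t0; have [w00|w00] := eqVneq w0 0.
  have [+ _] := flowP w01 t0; rewrite w00 cmod0 => h.
  have -> : factor 0 (cofR t) = cexp (- cofR t).
    rewrite /factor (_ : flow 0 (cofR t) = 0) ?subrr ?sub0r //.
    by apply/eqP; rewrite -cmod_eq0 eq_le h cmod_ge0.
  by rewrite -cofRN cexp_cofR cmod_cofR ger0_norm ?expR_ge0 // -expR0 ler_expR oppr_le0.
have [+ _] := flowP w01 t0; rewrite -(factorE w01 t0) cmodM.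
by rewrite ger_pMl // cmod_gt0.
Qed.

Lemma derive_flow w0 (t : R) : cmod w0 < 1 -> 0 <= t ->
  is_derive (cofR t) 1 (flow w0) (- (flow w0 (cofR t) * g (flow w0 (cofR t)))).
Proof.
move=> w01 t0; have [wle Fw] := flowP w01 t0.
have w1 := le_lt_trans wle w01.
have dN : is_derive (cofR t) 1 (fun u : C => - u) (-1 : C).
  exact: is_deriveN (deriveC_id (cofR t)).
have dE : is_derive (cofR t) 1 (fun u => Fext w0 * cexp (- u)) (- (Fext w0 * cexp (- cofR t))).
  apply: (deriveC_eq _ (deriveC_M (deriveC_cst (Fext w0) _)
    (is_derive_comp (is_derive_cexp _) dN))).
  by rewrite mul0r add0r mulrN1 mulrN.
have dinv := disc_inverse_derive Fext_hol Fext_inj w1.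
rewrite Fw in dinv.
have dflow := is_derive_comp (f := disc_inverse Fext 1)
  (h := fun u => Fext w0 * cexp (- u)) dinv dE.
apply: (deriveC_eq _ dflow).
rewrite -Fw (FextE w1) mulrN; congr (- _).
by rewrite [LHS]mulrC mulfK // derive_Fext_neq0.
Qed.

Lemma derive_factor w0 (t : R) : cmod w0 < 1 -> 0 <= t ->
  is_derive (cofR t) 1 (factor w0) (- (g (flow w0 (cofR t)) * factor w0 (cofR t))).
Proof.
move=> w01 t0; have [wle _] := flowP w01 t0.
set w := flow w0 (cofR t) in wle *; have w1 := le_lt_trans wle w01.
have dP := is_derive_comp (dPhi w1) (derive_flow w01 t0).
have dI := deriveC_B (deriveC_B (deriveC_cst (Phi w0) (cofR t)) dP) (deriveC_id _).
apply: (deriveC_eq _ (is_derive_comp (is_derive_cexp _) dI)).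
rewrite -/(factor w0 (cofR t)) -/w -/(kfun w).
have E : kfun w * (w * g w) = 1 - g w.
  by rewrite mulrA [kfun w * w]mulrC kfunE mulrBl mulVf ?g_neq0 // mul1r.
rewrite mulrN sub0r opprK E; ring.
Qed.

Lemma factor_rderiv w0 (t : R) : cmod w0 < 1 -> 0 <= t ->
  rderiv (fun s => factor w0 (cofR s)) t (- (g (flow w0 (cofR t)) * factor w0 (cofR t))).
Proof.
move=> w01 t0; rewrite -[- _]mulr1.
exact: (rderiv_comp (phi := fun s => cofR s) (derive_factor w01 t0) (rderiv_cofR t)).
Qed.

Lemma rderiv_lipschitz (phi d : R -> C) (a b M : R) :
  (forall t, a <= t <= b -> rderiv phi t (d t)) ->
  (forall t, a <= t <= b -> cmod (d t) <= M) ->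
  forall s t, a <= s <= b -> a <= t <= b -> cmod (phi s - phi t) <= 2 * M * `|s - t|.
Proof.
move=> dphi dM.
have main s t : a <= s -> s <= t -> t <= b -> cmod (phi t - phi s) <= 2 * M * (t - s).
  move=> as_ st tb.
  have inab x : s <= x <= t -> a <= x <= b.
    by move=> /andP[sx xt]; rewrite (le_trans as_ sx) (le_trans xt tb).
  have part (u du : R -> R) : (forall x, s <= x <= t -> is_derive x 1 u (du x)) ->
      (forall x, s <= x <= t -> `|du x| <= M) -> `|u t - u s| <= M * (t - s).
    move=> hu hM.
    have hu' x : x \in `]s, t[ -> is_derive x 1 u (du x).
      by rewrite in_itv /= => /andP[/ltW sx /ltW xt]; apply: hu; rewrite sx.
    have cu : {within `[s, t], continuous u}.
      apply: within_cont => x xst; have [dx _] := hu x xst.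
      exact: differentiable_continuous ((derivable1_diffP u x).1 dx).
    have [c cst ->] := MVT_segment st hu' cu.
    rewrite normrM [`|t - s|]ger0_norm ?subr_ge0 // ler_wpM2r ?subr_ge0 //.
    by apply: hM; move: cst; rewrite in_itv.
  apply: le_trans (cmod_le_ReIm _) _; rewrite cReB cImB -mulrA mulr_natl mulr2n.
  apply: lerD.
    apply: (part (fun x => cRe (phi x)) (fun x => cRe (d x))) => x /inab xab.
      exact: rderiv_Re (dphi x xab).
    exact: le_trans (cRe_le_cmod _) (dM x xab).
  apply: (part (fun x => cIm (phi x)) (fun x => cIm (d x))) => x /inab xab.
    exact: rderiv_Im (dphi x xab).
  exact: le_trans (cIm_le_cmod _) (dM x xab).
move=> s t /andP[as_ sb] /andP[at_ tb]; have [st|/ltW ts] := leP s t.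
  by rewrite cmodB distrC ger0_norm ?subr_ge0 //; exact: main.
by rewrite ger0_norm ?subr_ge0 //; exact: main.
Qed.

Lemma factor_lipschitz w0 : cmod w0 < 1 -> exists2 M : R, 0 < M & forall s t : R,
  0 <= s -> 0 <= t -> cmod (factor w0 (cofR s) - factor w0 (cofR t)) <= M * `|s - t|.
Proof.
move=> w01; have [|M M0 HM] := disc_bounded (f := g) (r := cmod w0).
  by move=> z zw; apply: gh.1; exact: le_lt_trans zw w01.
exists (2 * M); first by rewrite mulr_gt0.
move=> s t s0 t0.
apply: (@rderiv_lipschitz (fun s => factor w0 (cofR s)) _ 0 (Num.max s t)).
- by move=> x /andP[x0 _]; exact: factor_rderiv.
- move=> x /andP[x0 _]; rewrite cmodN cmodM -[M]mulr1; apply: ler_pM; rewrite ?cmod_ge0 //.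
    by apply: HM; have [] := flowP w01 x0.
  exact: cmod_factor.
- by rewrite s0 le_max lexx.
- by rewrite t0 le_max lexx orbT.
Qed.

(** [e^t * factor] is the quotient of [cexp (Phi w0)] by [cexp (Phi (flow w0 t))], and the flow
    tends to 0 uniformly because the inverse of [Fext] is continuous at 0. *)
Lemma factor_limit (s e : R) : 0 <= s < 1 -> 0 < e -> exists T : R, forall t w0,
  T < t -> cmod w0 <= s ->
  cmod (cofR (expR t) * factor w0 (cofR t) - cexp (Phi w0)) <= e.
Proof.
move=> /andP[s0 s1] e0.
have [|M M0 HM] := disc_bounded (f := fun w => cexp (Phi w)) (r := s).
  by move=> z zw; apply: derive_cont (derive_expPhi _); exact: le_lt_trans zw s1.
have [|M' M'0 HM'] := disc_bounded (f := Fext) (r := s).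
  by move=> z zw; apply: Fext_hol.1; exact: le_lt_trans zw s1.
have c0 : cmod (0 : C) < 1 by rewrite cmod0.
have Ec : {for 0, continuous (fun w => (cexp (Phi w))^-1)}.
  apply: contV; first exact: cexp_neq0.
  exact: derive_cont (derive_expPhi c0).
have [eta eta0 Heta] := (contCP _ 0).1 Ec (e / M) (divr_gt0 e0 M0).
have [d d0 Hd] := (contCP _ _).1 (disc_inverse_cont Fext_hol Fext_inj c0) eta eta0.
(* From [e^t >= 1 + t > M' / d] it follows that [M' * e^-t < d]. *)
exists (M' / d) => t w0 Tt w0s.
have t0 : 0 < t by apply: lt_trans Tt; rewrite divr_gt0.
have w01 := le_lt_trans w0s s1.
have wsmall : cmod (flow w0 (cofR t)) < eta.
  have := Hd (Fext w0 * cexp (- cofR t)); rewrite disc_inverseK //; last exact: Fext_inj.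
  rewrite Fext0 !subr0; apply.
  rewrite cmodM -cofRN cexp_cofR cmod_cofR ger0_norm ?expR_ge0 // expRN.
  rewrite ltr_pdivrMr ?expR_gt0 //; apply: le_lt_trans (HM' _ w0s) _.
  rewrite -ltr_pdivrMl // mulrC; apply: lt_le_trans Tt _.
  by apply: le_trans (expR_ge1Dx t); rewrite lerDr.
have := Heta _ (_ : cmod (flow w0 (cofR t) - 0) < eta); rewrite subr0 => /(_ wsmall).
rewrite Phi0 cexp0 invr1 => h.
have -> : cofR (expR t) * factor w0 (cofR t) - cexp (Phi w0) =
   cexp (Phi w0) * ((cexp (Phi (flow w0 (cofR t))))^-1 - 1).
  rewrite /factor !cexpB cexp_cofR; field.
  by rewrite cexp_neq0 cofR_eq0 gt_eqF // expR_gt0.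
rewrite cmodM; apply: le_trans (ler_pM _ _ (HM _ w0s) (ltW h)) _; rewrite ?cmod_ge0 //.
by rewrite mulrC divfK // gt_eqF.
Qed.

Context {n : nat}.
Local Notation X := 'rV[Cplx R]_n.
Variable N : X -> R.
Hypothesis hN : is_norm N.
Variable l : {linear X -> C}.
Hypothesis lN : forall x, cmod (l x) <= N x.

Definition fext (z : X) : X := cexp (Phi (l z)) *: z.

Lemma l_ball z : unit_ball N z -> cmod (l z) < 1.
Proof. exact: le_lt_trans (lN z). Qed.

Lemma zero_in_ball : unit_ball N 0.
Proof. by rewrite /unit_ball /= (normN_0 hN). Qed.

Lemma scale_holB (c : C -> C) : hol_off0 c 1 -> holB N (fun z => c (l z) *: z).
Proof.
move=> ch z zB; apply: (@differentiable_scale_id _ _ (fun z => c (l z))).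
apply: (@differentiable_comp _ _ _ _ l c); first exact: linear_diff.
exact: removable ch (l_ball zB).
Qed.

Lemma scale_normalized (c : C -> C) : hol_off0 c 1 -> c 0 = 1 ->
  normalized (fun z => c (l z) *: z).
Proof.
move=> ch c1; split; first by rewrite scaler0.
apply: differential_eq; [by rewrite scaler0| |].
  by apply: (scale_holB ch); exact: zero_in_ball.
move=> e e0; have c0 : cmod (0 : C) < 1 by rewrite cmod0.
have [d d0 Hd] := (contCP c 0).1 (ch.1 0 c0) e e0.
have [K K0 HK] := linear_bound l.
exists (d / K); first by rewrite divr_gt0.
move=> x xd; have -> : c (l x) *: x - x = (c (l x) - 1) *: x.
  by rewrite scalerBl scale1r.
rewrite supnormZ ler_wpM2r ?supnorm_ge0 // -c1; apply/ltW/Hd.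
rewrite subr0; apply: le_lt_trans (HK x) _.
by rewrite mulrC -ltr_pdivlMr.
Qed.

Lemma unit_disc_g : forall z, cmod z < 1 -> (g @` unit_disc R) (g z).
Proof. by move=> z z1; exists z. Qed.

(** The field is a scalar multiple of [z], so every functional supporting [N] at [z] sees the same
    normalised value [g (l z)], whatever the norm. *)
Lemma hext_calMg : calMg N g (fun z => g (l z) *: z).
Proof.
split; [exact: scale_holB|exact: scale_normalized|].
move=> z l' zB z0 [_ l'z]; rewrite functionalZ l'z mulrCA -cofRM.
rewrite mulVf ?gt_eqF ?(normN_gt0 hN) // mulr1.
by apply: unit_disc_g; exact: l_ball.
Qed.

Lemma hext_calM : calM N (fun z => g (l z) *: z).
Proof.
split; [exact: scale_holB|exact: scale_normalized|].
move=> z l' zB z0 [_ l'z]; rewrite functionalZ l'z mulrC cRe_real.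
by rewrite mulr_gt0 ?(normN_gt0 hN) // g_Re // l_ball.
Qed.

Lemma vext_solution z : unit_ball N z ->
  loewner_solution N (fun z _ => g (l z) *: z) z (fun t => factor (l z) (cofR t) *: z).
Proof.
move=> zB; have lz := l_ball zB; split.
- move=> t t0; rewrite /unit_ball /= (normN_Z hN); apply: le_lt_trans zB.
  by rewrite ler_piMl ?(normN_ge0 hN) // cmod_factor.
- move=> t0 t00; have [M M0 HM] := factor_lipschitz lz.
  exists (M * N z), 1; split=> // s t s0 t0' _ _.
  rewrite -scalerBl (normN_Z hN) mulrAC ler_wpM2r ?(normN_ge0 hN) //.
  exact: HM.
- apply: aeW => t t0; apply: (cvgXP _ _).2 => e e0.
  have z1 : 0 < supnorm z + 1 by rewrite ltr_wpDl ?supnorm_ge0.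
  have [r r0 Hr] := factor_rderiv lz t0 (divr_gt0 e0 z1).
  apply: (nbhsRP 0 _).2; exists r => // s; rewrite subr0 => sr s0.
  have := Hr (t + s); rewrite [t + s - t]addrAC subrr add0r => /(_ sr) h.
  rewrite functionalZ (factorE lz t0).
  set w := flow _ _ in h *; set f1 := factor _ _ in h *; set f2 := factor _ _ in h *.
  have -> : cofR s^-1 *: (f1 *: z - f2 *: z) - - (g w *: (f2 *: z)) =
    (cofR s^-1 * (f1 - f2 - - (g w * f2) * cofR s)) *: z.
    rewrite -scalerBl !scalerA opprK -scalerDl; congr (_ *: _).
    by rewrite cofRV; field; rewrite cofR_eq0.
  rewrite supnormZ cmodM cmod_cofR normfV.
  have s1 : 0 < `|s| by rewrite normr_gt0.
  rewrite [_ * `|s|]mulrC -ler_pdivrMl // in h.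
  apply: le_lt_trans (ler_wpM2r (supnorm_ge0 z) h) _.
  by rewrite mulrAC ltr_pdivrMr // ltr_pM2l // ltrDl.
- by rewrite cofR0 factor0 // scale1r.
Qed.

Lemma fext_S0g : S0g N g fext.
Proof.
have eh : hol_off0 (fun w => cexp (Phi w)) 1.
  by apply: hol_intro => z z1; exact: derive_diff (derive_expPhi z1).
split; first exact: scale_holB eh.
  by apply: (scale_normalized eh); rewrite Phi0 cexp0.
exists (fun z _ => g (l z) *: z), (fun z t => factor (l z) (cofR t) *: z); split.
- split=> [t _|z zB]; first exact: hext_calM.
  exact: measurable_cst.
- by apply: aeW => t _; exact: hext_calMg.
- exact: vext_solution.
- apply/fam_cvgP => A [AB cA]; apply: uniform_cvgX => e e0.
  suff h : \forall t \near +oo, forall x, A x ->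
      supnorm (cofR (expR t) *: (factor (l x) (cofR t) *: x) - fext x) < e by exact: h.
  have [A0|/set0P/negP/negPn/eqP A0] := pselect (A !=set0); last first.
    by apply: nearW => t x; rewrite A0.
  have lcc : continuous (fun x : X => cmod (l x)).
    move=> x; apply: (@continuous_comp _ _ _ l (fun z : C => cmod z)).
      exact: linear_cont.
    exact: (cont_cmod (f := fun z => z) (cont_idC (l x))).
  have [c + Hc] := @compact_EVT_max X R (fun x => cmod (l x)) A A0 cA (continuous_subspaceT lcc).
  rewrite inE => Ac.
  have sc : continuous (fun x : X => supnorm x).
    move=> x; apply: (cvgrPdist_lt (F := nbhs x) _ _).2 => r r0.
    apply: (nbhsXP x _).2; exists r => // y yx.
    have h1 := supnormD (y - x) x; have h2 := supnormD (x - y) y.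
    rewrite subrK in h1; rewrite subrK -(supnormN (x - y)) opprB in h2.
    rewrite ltr_norml; move: yx h1 h2.
    by move: (supnorm (y - x)) (supnorm x) (supnorm y) => *; apply/andP; split; lra.
  have [c' _ Hc'] := @compact_EVT_max X R (fun x => supnorm x) A A0 cA (continuous_subspaceT sc).
  have B0 : 0 < supnorm c' + 1 by rewrite ltr_wpDl ?supnorm_ge0.
  have e1 : 0 < e / 2 / (supnorm c' + 1) by rewrite !divr_gt0.
  have lc : 0 <= cmod (l c) < 1 by rewrite cmod_ge0 l_ball //; exact: AB.
  have [T HT] := factor_limit lc e1.
  apply: filterS (nbhs_pinfty_gt (num_real T)) => t Tt x Ax; rewrite /fext scalerA -scalerBl supnormZ.
  have lx : cmod (l x) <= cmod (l c) by apply: Hc; rewrite inE.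
  have xc : supnorm x <= supnorm c' by apply: Hc'; rewrite inE.
  apply: le_lt_trans (ler_pM _ _ (HT t (l x) Tt lx) xc) _; rewrite ?cmod_ge0 ?supnorm_ge0 //.
  apply: lt_le_trans (_ : e / 2 / (supnorm c' + 1) * (supnorm c' + 1) <= _).
    by rewrite ltr_pM2l // ltrDl.
  by rewrite divfK ?gt_eqF //; move: e0; lra.
Qed.

End ExtremalMap.

(** * Growth along Loewner trajectories *)

Section LeftDiniMonotone.
Context {R : realType}.
Local Notation mu := (@lebesgue_measure R).
Implicit Types (u : R -> R) (a b s t : R).

(** Let [t] be the infimum of the points where [u] is at least [u b]. By continuity [t] is such a
    point, and if [t > a] a short step to the left would produce a smaller one. *)
Lemma left_nonincreasing u a b : a <= b ->
  (forall x, a <= x <= b -> forall e : R, 0 < e -> exists2 d : R, 0 < d &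
    forall y, a <= y <= b -> `|y - x| < d -> `|u y - u x| < e) ->
  (forall t, a < t <= b -> exists2 d : R, 0 < d &
    forall s, 0 < s < d -> a <= t - s -> u t <= u (t - s)) ->
  u b <= u a.
Proof.
move=> ab uc H; pose S := [set x | a <= x <= b /\ u b <= u x].
have Sb : S b by split; rewrite ?ab ?lexx.
have Slb : has_lbound S by exists a => x [/andP[]].
have Sinf : has_inf S by split => //; exists b.
pose t := inf S.
have at_ : a <= t by apply: lb_le_inf; [exists b|move=> x [/andP[]]].
have tb : t <= b by exact: ge_inf.
have ubt : u b <= u t.
  rewrite leNgt; apply/negP => lt; have e0 : 0 < u b - u t by rewrite subr_gt0.
  have [|d d0 Hd] := uc t _ _ e0; first by rewrite at_.
  have [x [xab ubx] xt] := inf_adherent d0 Sinf.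
  have tx : t <= x by apply: ge_inf.
  have := Hd x xab; rewrite ger0_norm ?subr_ge0 // ltrBlDl => /(_ xt).
  by move=> /(le_lt_trans (ler_norm _)); rewrite ltrD2r ltNge ubx.
have [ta|ta] := leP t a; first by rewrite (_ : a = t) //; apply/eqP; rewrite eq_le at_ ta.
have [|d d0 Hd] := H t; first by rewrite ta.
pose s := Num.min (d / 2) (t - a).
have s0 : 0 < s by rewrite lt_min divr_gt0 // subr_gt0.
have sd : s < d.
  apply: le_lt_trans (_ : s <= d / 2) _; first by rewrite ge_min lexx.
  by rewrite ltr_pdivrMr // mulr_natr mulr2n ltrDl.
have sa : a <= t - s by rewrite lerBrDr addrC -lerBrDr ge_min lexx orbT.
have : S (t - s).
  split; first by rewrite sa (le_trans _ tb) // gerBl ltW.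
  by apply: le_trans ubt _; apply: Hd => //; rewrite s0.
by move=> /(ge_inf Slb); rewrite -/t leNgt ltrBlDr ltrDl s0.
Qed.

Let cap_itv (O : set R) s t : open O -> s <= t ->
  exists2 m : R, mu (O `&` `]s, t]) = m%:E & 0 <= m <= t - s.
Proof.
move=> oO st; have mO : measurable O by exact: open_measurable.
have mI : measurable (O `&` `]s, t]) by exact: measurableI.
have le : (mu (O `&` `]s, t]) <= (t - s)%:E)%E.
  have leI : (mu (O `&` `]s, t]) <= mu `]s, t])%E.
    by apply: le_measure; rewrite ?inE //; exact: subIsetr.
  apply: le_trans leI _; rewrite lebesgue_measure_itv /= lte_fin; case: ltP => // _.
  by rewrite lee_fin subr_ge0.
have fin : mu (O `&` `]s, t]) \is a fin_num.
  by rewrite ge0_fin_numE ?measure_ge0 // (le_lt_trans le) // ltry.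
exists (fine (mu (O `&` `]s, t]))); first by rewrite fineK.
by rewrite fine_ge0 ?measure_ge0 //= -lee_fin fineK.
Qed.

(* The exceptional null set is covered by an open set [O] of small measure, on
   which the Lipschitz bound is paid for by the measure of [O]. *)
Lemma lipschitz_ae_nonincreasing u a b (K : R) (E : set R) : a <= b -> 0 <= K ->
  (forall s t, a <= s <= b -> a <= t <= b -> `|u s - u t| <= K * `|s - t|) ->
  measurable E -> mu E = 0%E ->
  (forall t, a < t <= b -> ~ E t -> forall e : R, 0 < e -> exists2 d : R, 0 < d &
    forall s, 0 < s < d -> a <= t - s -> u t <= u (t - s) + e * s) ->
  u b <= u a.
Proof.
move=> ab K0 uK mE E0 H; apply/ler_addgt0Pr => e0 e00.
(* One [e] serves as the slope off [E] and as the measure of [O]; the total cost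
   [e * (b - a) + K * e] is at most [e0]. *)
pose e := e0 / (b - a + K + 1).
have den : 0 < b - a + K + 1 by rewrite ltr_wpDl // addr_ge0 // subr_ge0.
have ep : 0 < e by rewrite divr_gt0.
have Efin : (mu E < +oo)%E by rewrite E0 ltry.
have [ O [oO EO Oe]] := lebesgue_regularity_outer mE Efin ep.
have mO : measurable O by exact: open_measurable.
have muO : (mu O <= e%:E)%E.
  have leU : (mu O <= mu E + mu (O `\` E))%E.
    by rewrite -{1}(setDUK EO); apply: measureU2 => //; exact: measurableD.
  by apply: le_trans leU _; rewrite E0 add0e ltW.
(* Nondecreasing and 1-Lipschitz, with slope exactly 1 on intervals inside [O], and at most [e] in
   total. *)
pose m t := fine (mu (O `&` `]a, t])).
have mD s t : a <= s -> s <= t -> exists2 r : R, m t = m s + r &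
    0 <= r <= t - s /\ (`]s, t] `<=` O -> r = t - s).
  move=> as_ st; have [r rE r01] := cap_itv oO st.
  have [p pE p01] := cap_itv oO as_.
  exists r; last first.
    split => // sub; move: rE; rewrite setIidr // lebesgue_measure_itv /= lte_fin.
    case: ifPn => [_|ts] [<-] //.
    rewrite -leNgt in ts; by have -> : s = t by [apply/eqP; rewrite eq_le st ts]; rewrite subrr.
  rewrite /m pE /=; have -> : O `&` `]a, t] = (O `&` `]a, s]) `|` (O `&` `]s, t]).
    rewrite -setIUr; congr (_ `&` _).
    by rewrite (@itv_bndbnd_setU _ _ _ (BRight s)) // bnd_simp.
  have -> : mu ((O `&` `]a, s]) `|` (O `&` `]s, t])) =
      (mu (O `&` `]a, s]) + mu (O `&` `]s, t]))%E.
    apply: measureU; try exact: measurableI.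
    apply/seteqP; split=> x //= -[[_ ]]; rewrite !in_itv /= => /andP[_ xs] [_ /andP[sx _]].
    by move: sx; rewrite ltNge xs.
  by rewrite pE rE.
have m_le : m b <= e.
  have [p pE p01] := cap_itv oO ab; rewrite /m pE /= -lee_fin -pE.
  apply: le_trans muO; apply: le_measure; rewrite ?inE //; first exact: measurableI.
have ma : m a = 0 by rewrite /m set_itv_ge ?setI0 ?measure0 //= bnd_simp -leNgt.
(* At points off [E] the term [e * (t - a)] absorbs the error of the hypothesis; at points of [E],
   which are interior to [O], the term [K * m t] absorbs the Lipschitz growth. *)
pose U t := u t - e * (t - a) - K * m t.
have /= : U b <= U a.
  apply: left_nonincreasing => //.
    move=> x /andP[ax xb] c c0; pose L := K + e + K + 1.
    have L0 : 0 < L by rewrite /L; lra.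
    exists (c / L); first by rewrite divr_gt0.
    move=> y /andP[ay yb]; rewrite ltr_pdivlMr // mulrC => yx; apply: le_lt_trans yx.
    have h1 : `|u y - u x| <= K * `|y - x| by apply: uK; apply/andP.
    have h2 : `|m y - m x| <= `|y - x|.
      have [xy|/ltW yx] := leP x y.
        have [r -> [/andP[r0 r1] _]] := mD x y ax xy.
        by rewrite addrAC subrr add0r ger0_norm // ger0_norm ?subr_ge0.
      have [r -> [/andP[r0 r1] _]] := mD y x ay yx.
      by rewrite opprD addrA subrr add0r normrN ger0_norm // distrC ger0_norm ?subr_ge0.
    have -> : U y - U x = (u y - u x) - e * (y - x) - K * (m y - m x) by rewrite /U; ring.
    apply: le_trans (ler_normB _ _) _.
    apply: le_trans (lerD (ler_normB _ _) (lexx _)) _.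
    rewrite [`|e * _|]normrM [`|K * _|]normrM (gtr0_norm ep) (ger0_norm K0).
    have h3 := ler_wpM2l K0 h2; have h4 := normr_ge0 (y - x).
    by move: h1 h3 h4; rewrite /L; move: (`|u y - u x|) (`|m y - m x|) (`|y - x|) => p q r *; lra.
  move=> t /andP[ta tb]; have [Et|nEt] := pselect (E t).
    have [d d0 Hd] := (nbhsRP t O).1 (open_nbhs_nbhs (conj oO (EO _ Et))).
    exists d => // s /andP[s0 sd] ats.
    have ts : t - s <= t by rewrite gerBl ltW.
    have [r mr [_ rE]] := mD _ _ ats ts.
    have r_ : r = s.
      rewrite rE; first by rewrite opprB addrC subrK.
      move=> x /=; rewrite in_itv /= => /andP[x1 x2]; apply: Hd.
      by rewrite ler0_norm ?subr_le0 // opprB ltrBlDr -ltrBlDl (lt_trans _ x1) // ltrD2l ltrN2.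
    have := uK t (t - s); rewrite (ltW ta) tb ats (le_trans ts tb) => /(_ isT isT).
    rewrite subKr (gtr0_norm s0) => /(le_trans (ler_norm _)) h.
    have es : 0 <= e * s by rewrite mulr_ge0 // ltW.
    rewrite /U mr r_; move: h es; move: (u t) (u (t - s)) (m (t - s)) => p q x.
    by move=> h es; rewrite -subr_ge0; lra.
  have ttb : a < t <= b by rewrite ta.
  have [d d0 Hd] := H t ttb nEt _ ep.
  exists d => // s sd ats; have := Hd s sd ats; have /andP[s0 _] := sd.
  have ts : t - s <= t by rewrite gerBl ltW.
  have [r mr [/andP[r0 _] _]] := mD _ _ ats ts.
  have Kr : 0 <= K * r by rewrite mulr_ge0.
  rewrite /U mr; move: Kr; move: (u t) (u (t - s)) (m (t - s)) => p q x.
  by move=> h es; rewrite -subr_ge0; lra.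
rewrite /U ma subrr !mulr0 !subr0 => h.
have h2 : K * m b <= K * e by rewrite ler_wpM2l.
have h3 : e * (b - a) + K * e <= e0.
  have -> : e0 = e * (b - a + K + 1) by rewrite /e divfK // gt_eqF.
  by rewrite !mulrDr mulr1 [K * e]mulrC lerDl ltW.
by move: h h2 h3; move: (u b) (u a) (m b) => p q x *; lra.
Qed.

(** Local Lipschitz constants suffice: on a short interval ending at [t] the Lipschitz case gives
    the left comparison, and [left_nonincreasing] glues these comparisons together. *)
Lemma ae_nonincreasing u a b (E : set R) : a <= b ->
  (forall t0, a <= t0 <= b -> exists L d : R, 0 < d /\ forall s t,
     a <= s <= b -> a <= t <= b -> `|s - t0| < d -> `|t - t0| < d ->
     `|u s - u t| <= L * `|s - t|) ->
  measurable E -> mu E = 0%E ->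
  (forall t, a < t <= b -> ~ E t -> forall e : R, 0 < e -> exists2 d : R, 0 < d &
    forall s, 0 < s < d -> a <= t - s -> u t <= u (t - s) + e * s) ->
  u b <= u a.
Proof.
move=> ab lip mE E0 H.
have lip' t0 : a <= t0 <= b -> exists2 L : R, 0 <= L & exists2 d : R, 0 < d & forall s t,
     a <= s <= b -> a <= t <= b -> `|s - t0| < d -> `|t - t0| < d ->
     `|u s - u t| <= L * `|s - t|.
  move=> /lip [L [d [d0 HL]]]; exists `|L| => //; exists d => // s t sab tab sd td.
  by apply: le_trans (HL s t sab tab sd td) _; rewrite ler_wpM2r // ler_norm.
apply: left_nonincreasing => //.
  move=> x xab e e0; have [L L0 [d d0 HL]] := lip' x xab.
  have L1 : 0 < L + 1 by rewrite ltr_wpDl.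
  exists (Num.min d (e / (L + 1))); first by rewrite lt_min d0 divr_gt0.
  move=> y yab; rewrite lt_min => /andP[yd ye].
  have := HL y x yab xab yd; rewrite subrr normr0 => /(_ d0) h.
  move: ye; rewrite ltr_pdivlMr // mulrC => ye; apply: le_lt_trans ye.
  by apply: le_trans h _; rewrite ler_wpM2r // lerDl.
move=> t /andP[ta tb]; have tab : a <= t <= b by rewrite (ltW ta).
have [L L0 [d d0 HL]] := lip' t tab; exists d => // s /andP[s0 sd] ats.
have ts : t - s <= t by rewrite gerBl ltW.
apply: (@lipschitz_ae_nonincreasing u (t - s) t L E ts L0) => //.
  have close x : t - s <= x <= t -> a <= x <= b /\ `|x - t| < d.
    move=> /andP[x1 x2]; rewrite (le_trans ats x1) (le_trans x2 tb); split=> //.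
    by rewrite ler0_norm ?subr_le0 // opprB (le_lt_trans _ sd) // lerBlDr -lerBlDl.
  by move=> x y /close [xab xd] /close [yab yd]; exact: HL.
move=> x /andP[x1 x2] nEx e e0; have [|d' d'0 Hd'] := H x _ nEx e e0.
  by rewrite (le_lt_trans ats x1) (le_trans x2 tb).
by exists d' => // y yd xy; apply: Hd' => //; exact: le_trans ats xy.
Qed.

End LeftDiniMonotone.

(** * Differential inequalities for a scalar function along almost all times *)

Section ScalarGrowth.
Context {R : realType}.
Implicit Types (p m c C : R -> R) (s t k : R).

Lemma expR_left_increment k t s : expR (k * t) - expR (k * (t - s)) <= k * s * expR (k * t).
Proof.
rewrite mulrBr expRD -[X in X - _]mulr1 -mulrBr mulrC ler_wpM2r ?expR_ge0 //.
by have := expR_ge1Dx (- (k * s)); lra.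
Qed.

Lemma expR_lipschitz k b s t : 0 <= k <= 1 -> 0 <= s <= b -> 0 <= t <= b ->
  `|expR (k * s) - expR (k * t)| <= expR b * `|s - t|.
Proof.
move=> /andP[k0 k1]; wlog st : s t / s <= t => [H s0 t0|/andP[s0 sb] /andP[t0 tb]].
  have [st|/ltW ts] := leP s t; first exact: H.
  by rewrite distrC [`|s - t|]distrC; exact: H.
have le1 : expR (k * s) <= expR (k * t) by rewrite ler_expR ler_wpM2l.
rewrite distrC [`|s - t|]distrC ger0_norm ?subr_ge0 // ger0_norm ?subr_ge0 //.
have := expR_left_increment k t (t - s); rewrite subKr => /le_trans; apply.
rewrite mulrC; apply: ler_pM; rewrite ?expR_ge0 ?mulr_ge0 ?subr_ge0 //.
  by rewrite ler_expR (le_trans _ tb) // ler_piMl.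
by rewrite ler_piMl ?subr_ge0.
Qed.

(** Arithmetic of one left step of length [s] in [ae_exp_growth]: [A], [P], [C1] are the values at
    [t] of the exponential, of [p] and of [C], and [B], [Q], [C2] those at [t - s]. *)
Let combine (A B P Q m k s e C1 C2 c : R) : A * P <= A * (Q - m * s + e * s) ->
  (A - B) * Q <= k * s * A * Q -> k * s * A * Q <= k * s * A * (P + e) ->
  A * (k * P - m) * s <= c * s -> k * (s * A * e) <= s * A * e -> c * s <= C1 - C2 ->
  A * P - C1 <= B * Q - C2 + 2 * A * e * s.
Proof. lra. Qed.

(** Where [p' <= - m], one has [(e^(k t) p)' <= e^(k t) (k p - m) <= c]. Here [C] acts as a
    primitive of a nonincreasing [c], entering only through its increments, and [e^(k t) p - C] is
    nonincreasing. *)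
Lemma ae_exp_growth p m c C k (M b : R) (E : set R) : 0 <= k <= 1 -> 0 <= b ->
  (forall t, 0 <= t -> 0 <= p t <= 1) ->
  (forall t0, 0 <= t0 -> exists L d : R, 0 < d /\ forall s t, 0 <= s -> 0 <= t ->
     `|s - t0| < d -> `|t - t0| < d -> `|p s - p t| <= L * `|s - t|) ->
  (forall s t, 0 <= s -> s <= t -> c t * (t - s) <= C t - C s <= M * (t - s)) ->
  (forall t, 0 <= t -> 0 <= c t) ->
  measurable E -> lebesgue_measure E = 0%E ->
  (forall t, 0 < t -> ~ E t -> forall e : R, 0 < e -> exists2 d : R, 0 < d &
    forall s, 0 < s < d -> 0 <= t - s -> p t <= p (t - s) - m t * s + e * s) ->
  (forall t, 0 < t -> ~ E t -> expR (k * t) * (k * p t - m t) <= c t) ->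
  expR (k * b) * p b - C b <= p 0 - C 0.
Proof.
move=> k01 b0 p01 lip CM c0 mE E0 H1 H2; have /andP[k0 k1] := k01.
have CL s t : 0 <= s -> 0 <= t -> `|C s - C t| <= M * `|s - t|.
  wlog st : s t / s <= t => [H s0 t0|s0 t0].
    have [st|/ltW ts] := leP s t; first exact: H.
    by rewrite distrC [`|s - t|]distrC; exact: H.
  have /andP[h1 h2] := CM s t s0 st.
  rewrite distrC [`|s - t|]distrC [`|t - s|]ger0_norm ?subr_ge0 // ger0_norm //.
  by apply: le_trans h1; rewrite mulr_ge0 ?c0 ?subr_ge0.
pose u t := expR (k * t) * p t - C t.
have -> : p 0 - C 0 = u 0 by rewrite /u mulr0 expR0 mul1r.
apply: (@ae_nonincreasing R u 0 b E b0 _ mE E0).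
  move=> t0 /andP[t00 t0b]; have [L [d [d0 HL]]] := lip t0 t00.
  exists (expR b * L + expR b + M), d; split=> // s t /andP[s0 sb] /andP[t_0 tb] sd td.
  have h1 := HL s t s0 t_0 sd td; have h2 := CL s t s0 t_0.
  have h3 : `|expR (k * s) - expR (k * t)| <= expR b * `|s - t|.
    by apply: expR_lipschitz; rewrite // ?s0 ?t_0.
  have -> : u s - u t = expR (k * s) * (p s - p t) + (expR (k * s) - expR (k * t)) * p t
      - (C s - C t) by rewrite /u; ring.
  apply: le_trans (ler_normB _ _) _; rewrite [leRHS]mulrDl; apply: lerD h2.
  apply: le_trans (ler_normD _ _) _; rewrite [leRHS]mulrDl; apply: lerD; last first.
    rewrite normrM; have /andP[pt0 pt1] := p01 t t_0.
    by apply: le_trans h3; rewrite ler_piMr // ger0_norm.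
  rewrite normrM -mulrA; apply: ler_pM => //.
  by rewrite ger0_norm ?expR_ge0 // ler_expR (le_trans _ sb) // ler_piMl.
move=> t /andP[t0 tb] nE e e0; pose A := expR (k * t).
have A0 : 0 < A by exact: expR_gt0.
(* One share [A * e1] is the error of the left estimate for [p], the other the cost of replacing
   [p (t - s)] by [p t]. *)
have [e1 e10 eE] : exists2 e1 : R, 0 < e1 & e = 2 * A * e1.
  exists (e / (2 * A)); first by rewrite divr_gt0 // mulr_gt0.
  by rewrite mulrC divfK // mulf_neq0 // gt_eqF.
have [L [d [d0 HL]]] := lip t (ltW t0); have [d' d'0 Hd'] := H1 t t0 nE e1 e10.
have L1 : 0 < `|L| + 1 by rewrite ltr_wpDl.
exists (Num.min (Num.min d d') (e1 / (`|L| + 1))).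
  by rewrite !lt_min d0 d'0 divr_gt0.
move=> s /andP[s0]; rewrite !lt_min => /andP[/andP[sd sd'] sL] ts.
have h1 : p t <= p (t - s) - m t * s + e1 * s by apply: Hd'; rewrite ?s0.
have h3 : p (t - s) <= p t + e1.
  have := HL (t - s) t ts (ltW t0); rewrite subrr normr0 addrAC subrr add0r normrN gtr0_norm //.
  move=> /(_ sd d0) /(le_trans (ler_norm _)); rewrite lerBlDl => /le_trans; apply.
  rewrite lerD2l; move: sL; rewrite ltr_pdivlMr // => sL; apply: le_trans (ltW sL).
  by rewrite mulrC ler_wpM2l ?(ltW s0) // (le_trans (ler_norm L)) // lerDl.
have h2 := expR_left_increment k t s.
have /andP[h4 _] : c t * (t - (t - s)) <= C t - C (t - s) <= M * (t - (t - s)).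
  by apply: CM => //; rewrite gerBl ltW.
have h5 := H2 t t0 nE; have /andP[q0 _] := p01 _ ts; rewrite subKr in h4.
rewrite /u eE; move: h1 h2 h3 h4 h5 q0; rewrite -/A.
move: (p t) (p (t - s)) (m t) (C t) (C (t - s)) (c t) (expR _) => P Q m' C1 C2 c' B.
move=> h1 h2 h3 h4 h5 q0.
have i1 := ler_wpM2l (ltW A0) h1.
have i2 := ler_wpM2r q0 h2.
have ksA : 0 <= k * s * A by rewrite !mulr_ge0 // ltW.
have i3 := ler_wpM2l ksA h3.
have i5 := ler_wpM2r (ltW s0) h5.
have i6 : k * (s * A * e1) <= s * A * e1 by rewrite ler_piMl // ?mulr_ge0 // ltW.
exact: combine i1 i2 i3 i5 i6 h4.
Qed.

(* The growth of [t |-> e^t p t] under [p' <= - p (1 - a p)]: bootstrapping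
   through the rates [0] and [1 - a r] makes the error integrable. *)
Lemma ae_logistic_growth p m (a r b : R) (E : set R) : 0 < a -> 0 < r -> 2 * a * r < 1 ->
  0 <= b -> p 0 <= r ->
  (forall t, 0 <= t -> 0 <= p t <= 1) ->
  (forall t0, 0 <= t0 -> exists L d : R, 0 < d /\ forall s t, 0 <= s -> 0 <= t ->
     `|s - t0| < d -> `|t - t0| < d -> `|p s - p t| <= L * `|s - t|) ->
  measurable E -> lebesgue_measure E = 0%E ->
  (forall t, 0 < t -> ~ E t -> forall e : R, 0 < e -> exists2 d : R, 0 < d &
    forall s, 0 < s < d -> 0 <= t - s -> p t <= p (t - s) - m t * s + e * s) ->
  (forall t, 0 < t -> ~ E t -> 0 <= m t) ->
  (forall t, 0 < t -> ~ E t -> p t <= r -> p t * (1 - a * p t) <= m t) ->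
  expR b * p b <= r + a * r ^+ 2 / (1 - 2 * a * r).
Proof.
move=> a0 r0 ar b0 p0 p01 lip mE E0 H m0 Hm; have ar0 : 0 < a * r by exact: mulr_gt0.
(* Rate 0: as [p] never exceeds [r], the hypothesis relating [p] and [m] becomes available at almost
   every time. *)
have step1 t : 0 <= t -> p t <= r.
  move=> t0; have := @ae_exp_growth p m (fun=> 0) (fun=> 0) 0 0 t E.
  rewrite mul0r expR0 mul1r !subr0 => h; apply: le_trans p0; apply: h => //.
  - by rewrite lexx ler01.
  - by move=> *; rewrite !mul0r lexx.
  - by move=> s s0 nE; rewrite !mul0r expR0 mul1r add0r oppr_le0; exact: m0.
(* From [p <= r] one gets [m >= k * p], hence decay of [p] at rate [k]. *)
pose k := 1 - a * r.
have k01 : 0 <= k <= 1 by rewrite /k; apply/andP; split; lra.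
have step2 t : 0 <= t -> expR (k * t) * p t <= r.
  move=> t0; have := @ae_exp_growth p m (fun=> 0) (fun=> 0) k 0 t E.
  rewrite !subr0 => h; apply: le_trans p0; apply: h => //.
    by move=> *; rewrite !mul0r lexx.
  move=> s s0 nE; rewrite pmulr_rle0 ?expR_gt0 // subr_le0.
  apply: le_trans (Hm s s0 nE (step1 s (ltW s0))).
  have /andP[ps _] := p01 s (ltW s0); rewrite mulrC ler_wpM2l // /k lerB // ler_wpM2l ?(ltW a0) //.
  exact: step1 (ltW s0).
pose la := 1 - 2 * a * r; have la0 : 0 < la by rewrite /la subr_gt0.
pose D := a * r ^+ 2; have D0 : 0 < D by rewrite /D mulr_gt0 // exprn_gt0.
(* At rate 1 the error is [a e^t p^2 <= a r^2 e^((1 - 2 k) t)], and [2 k - 1 = la], positive since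
   [2 * a * r < 1]. [C] is the primitive of [c] vanishing at infinity, so [- C 0 = D / la] is the
   final error term. *)
pose c t := D * expR (- (la * t)); pose C t := - (D / la * expR (- (la * t))).
have := @ae_exp_growth p m c C 1 D b E; rewrite mul1r => h.
have {h}h : expR b * p b - C b <= p 0 - C 0.
  apply: h => //; first by rewrite ler01 lexx.
  - move=> s t s0 st.
    have dE : D * (t - s) = D / la * (la * (t - s)).
      by rewrite mulrA divfK // gt_eqF.
    have DL : 0 < D / la by rewrite divr_gt0.
    have e1 : expR (- (la * s)) = expR (- (la * t)) * expR (la * (t - s)).
      by rewrite -expRD; congr expR; ring.
    have e2 : expR (- (la * t)) = expR (- (la * s)) * expR (- (la * (t - s))).
      by rewrite -expRD; congr expR; ring.
    have -> : C t - C s = D / la * (expR (- (la * s)) - expR (- (la * t))).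
      by rewrite mulrBr /C opprK addrC.
    apply/andP; split.
      rewrite /c mulrAC dE -[leLHS]mulrA ler_wpM2l ?(ltW DL) // e1.
      have := expR_ge1Dx (la * (t - s)); rewrite -lerBrDl => h1.
      have := ler_wpM2l (expR_ge0 (- (la * t))) h1; rewrite [X in _ <= X -> _]mulrBr mulr1.
      by rewrite [la * _ * _]mulrC.
    rewrite dE ler_wpM2l ?(ltW DL) // e2 -{1}[expR (- (la * s))]mulr1 -mulrBr.
    have h1 : expR (- (la * s)) <= 1 by rewrite -expR0 ler_expR oppr_le0 mulr_ge0 // ltW.
    have h2 := expR_ge1Dx (- (la * (t - s))).
    have h3 : expR (- (la * (t - s))) <= 1.
      by rewrite -expR0 ler_expR oppr_le0 mulr_ge0 ?subr_ge0 // ltW.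
    apply: le_trans (_ : 1 * (1 - expR (- (la * (t - s)))) <= _).
      by rewrite ler_wpM2r // subr_ge0.
    by rewrite mul1r lerBlDr addrC -lerBlDr.
  - by move=> t _; rewrite /c mulr_ge0 ?expR_ge0 // ltW.
  move=> t t0 nE; rewrite !mul1r /c.
  have pr := step1 t (ltW t0); have hm := Hm t t0 nE pr.
  have /andP[pt0 _] := p01 t (ltW t0).
  apply: le_trans (_ : expR t * (a * p t ^+ 2) <= _).
    by rewrite ler_wpM2l ?expR_ge0 //; move: hm; rewrite expr2; lra.
  have sq : (expR (k * t) * p t) ^+ 2 <= r ^+ 2.
    by rewrite lerXn2r ?nnegrE ?mulr_ge0 ?expR_ge0 ?(ltW r0) ?step2 // ltW.
  have -> : expR t * (a * p t ^+ 2) = a * (expR (k * t) * p t) ^+ 2 * expR (- (la * t)).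
    have -> : expR t = expR (k * t) * expR (k * t) * expR (- (la * t)).
      by rewrite -!expRD; congr expR; rewrite /k /la; ring.
    by move: (expR (k * t)) (p t) (expR _) => x y z; ring.
  by rewrite ler_wpM2r ?expR_ge0 // ler_wpM2l // ltW.
rewrite /C opprK opprK mulr0 oppr0 expR0 mulr1 in h.
have Cb : 0 <= D / la * expR (- (la * b)) by rewrite !mulr_ge0 ?expR_ge0 ?invr_ge0 ?ltW.
by move: h p0 Cb; rewrite -/D -/la; move: (expR b * p b) (D / la) (p 0) => *; lra.
Qed.

End ScalarGrowth.

(** * From the range of [g] to growth and coefficient bounds for the class *)

Section BallGrowth.
Context {R : realType} {n : nat}.
Local Notation C := (Cplx R).
Local Notation X := 'rV[Cplx R]_n.
Variable N : X -> R.
Hypothesis hN : is_norm N.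
Implicit Types (l : {linear X -> C}) (y : X).

(** A functional supporting [N] at [w t] computes [N (w t)] and only underestimates [N (w (t - s))].
    The estimate is thus valid for a norm without derivative, but only to the left. *)
Lemma norm_left_dini (w : R -> X) (t : R) (d : X) l : has_real_derivative w t d ->
  (forall x, cmod (l x) <= N x) -> l (w t) = cofR (N (w t)) ->
  forall e : R, 0 < e -> exists2 r : R, 0 < r & forall s, 0 < s < r ->
    N (w t) <= N (w (t - s)) + cRe (l d) * s + e * s.
Proof.
move=> /cvgXP dw lN lw e e0; have [K K0 HK] := linear_bound l.
have [r r0 Hr] := (nbhsRP 0 _).1 (dw (e / K) (divr_gt0 e0 K0)).
exists r => // s /andP[s0 sr]; have := Hr (- s).
rewrite subr0 normrN gtr0_norm // oppr_eq0 gt_eqF // => /(_ sr isT).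
set x := _ *: _ => xd.
have wE : w t = w (t - s) + cofR s *: x.
  rewrite /x scalerA -cofRM invrN mulrN mulfV ?gt_eqF // cofRN scaleN1r.
  by rewrite opprB addrC subrK.
have h1 : cRe (l (w (t - s))) <= N (w (t - s)) := le_trans (cRe_le _) (lN _).
have h2 : cRe (l x) <= cRe (l d) + e.
  rewrite -[x](subrK d) linearD cReD addrC lerD2l.
  apply: le_trans (cRe_le _) _; apply: le_trans (HK _) _.
  by rewrite mulrC -ler_pdivlMr // ltW.
have -> : N (w t) = cRe (l (w (t - s))) + s * cRe (l x).
  by rewrite -cRe_real -functionalZ -cReD -linearD -wE lw.
have := ler_wpM2l (ltW s0) h2; move: h1.
by move: (cRe _) (cRe _) (cRe _) (N _) => *; lra.
Qed.

Variable g : C -> C.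
Hypothesis gh : hol_off0 g 1.
Hypothesis gi : inj_on_disc g 1.
Hypothesis g0 : g 0 = 1.
Hypothesis g_Re : forall z : C, cmod z < 1 -> 0 < cRe (g z).

(* With [v = y / N y], the function [l (h (w v)) / w], continued by [1 = g 0] at
   [w = 0], takes its values in the range of [g]: rotate [l] to support [w v]. *)
Lemma calMg_subordination (h : X -> X) y l : calMg N g h -> unit_ball N y -> y != 0 ->
  support_functionals N y l ->
  exists2 u : C, cmod u <= N y & l (h y) = cofR (N y) * g u.
Proof.
move=> [hh hnorm him] yB y0 [l1 ly]; have lN := dual_norm_bound hN l1.
have Ny := normN_gt0 hN y0; pose v := cofR (N y)^-1 *: y.
have Nv : N v = 1.
  by rewrite /v (normN_Z hN) cmod_cofR ger0_norm ?invr_ge0 ?ltW // mulVf // gt_eqF.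
have lv : l v = 1.
  by rewrite /v functionalZ ly -cofRM mulVf ?gt_eqF.
have [L0 dL] := line_map_derive0 hN l hh hnorm Nv.
have Lh := line_map_hol hN l hh Nv.
pose phi := slope (line_map h l v) 0.
have phi0 : phi 0 = g 0 by rewrite /phi /slope eqxx dL lv g0.
have yv : cofR (N y) *: v = y by rewrite /v scalerA -cofRM mulfV ?gt_eqF // scale1r.
have cNy : cmod (cofR (N y)) = N y by rewrite cmod_cofR gtr0_norm.
have img w : cmod w < 1 -> exists2 u, cmod u < 1 & g u = phi w.
  move=> w1; have [->|w0] := eqVneq w 0; first by exists 0; rewrite ?cmod0 ?ltr01.
  have cw : 0 < cmod w by rewrite cmod_gt0.
  have [l' l'E] := scaled_functional l (cofR (cmod w) / w).
  have ce : cmod (cofR (cmod w) / w) = 1.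
    by rewrite cmodM cmodV cmod_cofR gtr0_norm // mulfV // gt_eqF.
  have Nwv : N (w *: v) = cmod w by rewrite (normN_Z hN) Nv mulr1.
  have wv0 : w *: v != 0.
    apply/eqP => wv; move: Nwv; rewrite wv (normN_0 hN) => /esym/eqP.
    by rewrite gt_eqF.
  have sl' : support_functionals N (w *: v) l'.
    apply: (dual_norm_attained hN) => // [x|]; first by rewrite l'E cmodM ce mul1r.
    by rewrite l'E functionalZ lv mulr1 divfK // Nwv.
  have [u u1 uE] := him _ l' (unit_ball_line hN Nv w1) wv0 sl'.
  exists u => //; rewrite uE Nwv l'E /phi /slope (negPf w0) L0 !subr0 /line_map.
  by rewrite mulrA mulrA -cofRM mulVf ?gt_eqF // mul1r mulrC.
have [|u u1 uE] := subordination gh gi (hol_slope ltr01 Lh) phi0 img (z := cofR (N y)).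
  by rewrite cNy.
exists u; first by rewrite -cNy.
by rewrite uE -{1}yv -/(line_map h l v _) (slopeE _ 0) L0 add0r subr0.
Qed.

Lemma Re_lower_bound (a : R) : cmod ('D_1 g 0) < a -> exists2 r : R, 0 < r &
  forall u : C, cmod u < r -> 1 - a * cmod u <= cRe (g u).
Proof.
move=> ga; have e0 : 0 < a - cmod ('D_1 g 0) by rewrite subr_gt0.
have g00 : cmod (0 : C) < 1 by rewrite cmod0 ltr01.
have [r r0 Hr] := (deriveCP _ _ _).1 (diff_derive (removable gh g00)) _ e0.
exists r => // u ur; have := Hr u; rewrite subr0 => /(_ ur) h.
have h1 : cmod (g u - 1) <= a * cmod u.
  have -> : g u - 1 = (g u - g 0 - 'D_1 g 0 * u) + 'D_1 g 0 * u by rewrite g0 subrK.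
  apply: le_trans (cmodD _ _) _; rewrite (cmodM _ u); move: h.
  by move: (cmod _) (cmod _) (cmod u) => *; lra.
have := cRe_le_cmod (g u - 1); rewrite cReB => h2.
have := le_trans h2 h1; rewrite ler_norml => /andP[h3 _].
by move: h3; rewrite (_ : cRe 1 = 1) //; move: (cRe _) (a * _) => *; lra.
Qed.

Lemma calMg_lower (h : X -> X) y l (a r : R) : 0 < a ->
  (forall u : C, cmod u < r -> 1 - a * cmod u <= cRe (g u)) ->
  calMg N g h -> unit_ball N y -> y != 0 -> support_functionals N y l ->
  0 <= cRe (l (h y)) /\ (N y < r -> N y * (1 - a * N y) <= cRe (l (h y))).
Proof.
move=> a0 Hr hM yB y0 sl; have [u uN ->] := calMg_subordination hM yB y0 sl.
have u1 := le_lt_trans uN yB; have Ny := normN_ge0 hN y.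
rewrite cRe_real; split; first by rewrite mulr_ge0 // ltW // g_Re.
move=> yr; apply: (ler_wpM2l Ny); apply: le_trans (Hr u (le_lt_trans uN yr)).
by rewrite lerB // ler_wpM2l // ltW.
Qed.

Lemma loewner_growth (h : X -> R -> X) (V : R -> X) z (a r rho b : R) :
  0 < a -> (forall u : C, cmod u < r -> 1 - a * cmod u <= cRe (g u)) ->
  {ae @lebesgue_measure R, forall t, 0 <= t -> calMg N g (h ^~ t)} ->
  loewner_solution N h z V -> N z <= rho -> 0 < rho < r -> 2 * a * rho < 1 -> 0 <= b ->
  expR b * N (V b) <= rho + a * rho ^+ 2 / (1 - 2 * a * rho).
Proof.
move=> a0 Hr hM [VB Vlip dV V0] zr /andP[r0 rr] ar b0.
have [E [mE E0 HE]] := negligibleU hM dV.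
pose dini t m := [/\ forall e : R, 0 < e -> exists2 d : R, 0 < d &
    forall s, 0 < s < d -> 0 <= t - s -> N (V t) <= N (V (t - s)) - m * s + e * s,
  0 <= m & N (V t) <= rho -> N (V t) * (1 - a * N (V t)) <= m].
(* The rate is [cRe (l (h (V t) t))] for some functional supporting [N] at [V t], and 0 if
   [V t = 0]. The choice at different times is arbitrary, with no regularity in [t]. *)
have Hm t : exists m, 0 < t -> ~ E t -> dini t m.
  have [[t0 nE]|H] := pselect (0 < t /\ ~ E t); last by exists 0 => t0 nE; case: H.
  have H1 : 0 <= t -> calMg N g (h ^~ t).
    by apply: contrapT => H; apply: nE; apply: HE; left.
  have H2 : 0 <= t -> has_real_derivative V t (- h (V t) t).
    by apply: contrapT => H; apply: nE; apply: HE; right.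
  have {}H1 := H1 (ltW t0); have {}H2 := H2 (ltW t0); have VtB := VB t (ltW t0).
  have [Vt0|Vt0] := eqVneq (V t) 0.
    exists 0 => _ _; rewrite /dini Vt0 (normN_0 hN) mul0r; split=> // e e0.
    exists 1; first exact: ltr01.
    move=> s /andP[s0 _] _; rewrite mul0r subr0 addr_ge0 ?(normN_ge0 hN) //.
    by rewrite mulr_ge0 // ltW.
  have [l sl] := support_functional_exists hN Vt0.
  have [m0 mle] := calMg_lower a0 Hr H1 VtB Vt0 sl.
  exists (cRe (l (h (V t) t))) => _ _; split=> //; last first.
    by move=> le; apply: mle; exact: le_lt_trans le rr.
  move=> e e0; case: sl => l1 lV.
  have [d d0 Hd] := norm_left_dini H2 (dual_norm_bound hN l1) lV e0.
  exists d => // s sd _; have := Hd s sd.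
  by rewrite linearN cReN mulNr.
have [m {}Hm] := choice Hm.
have triB x y : `|N x - N y| <= N (x - y).
  rewrite ler_norml (normN_triB hN) andbT lerNl opprB.
  by rewrite -(normN_N hN (x - y)) opprB (normN_triB hN).
apply: (@ae_logistic_growth R (fun t => N (V t)) m a rho b E) => //.
- by rewrite V0.
- by move=> t t0; rewrite (normN_ge0 hN) ltW //; exact: VB.
- move=> t0 t00; have [L [d [d0 HL]]] := Vlip t0 t00; exists L, d; split=> // s t s0 t_0 sd td.
  exact: le_trans (triB _ _) (HL s t s0 t_0 sd td).
- by move=> t t0 nE; have [] := Hm t t0 nE.
- by move=> t t0 nE; have [] := Hm t t0 nE.
- by move=> t t0 nE; have [] := Hm t t0 nE.
Qed.

(** The growth bound along the trajectory from [rho u] is uniform in time, so it passes to the limit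
    [q (rho u)]; the convergence is used on a one-point compact set. *)
Lemma S0g_line_growth (q : X -> X) l (u : X) (a r rho : R) : S0g N g q -> N u = 1 ->
  (forall x, cmod (l x) <= N x) -> 0 < a ->
  (forall u : C, cmod u < r -> 1 - a * cmod u <= cRe (g u)) ->
  0 < rho < r -> rho < 1 -> 2 * a * rho < 1 ->
  cRe (line_map q l u (cofR rho)) <= rho + a * rho ^+ 2 / (1 - 2 * a * rho).
Proof.
move=> [_ _ [h [v [_ hM vsol vq]]]] Nu lN a0 Hr rr rho1 ar; apply/ler_addgt0Pr => e e0.
have /andP[rho0 _] := rr; pose z := cofR rho *: u.
have cr : cmod (cofR rho) = rho by rewrite cmod_cofR gtr0_norm.
have zB : unit_ball N z by apply: (unit_ball_line hN Nu); rewrite cr.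
have [K K0 HK] := linear_bound l.
have zc : compactly_in (unit_ball N) [set z].
  by split; [move=> _ ->|exact: compact_set1].
have h1 := vq _ (family_nbhsX q (divr_gt0 e0 K0) zc).
have [t [t0 /(_ z erefl) ht]] := filter_ex (filterI (nbhs_pinfty_ge (num_real (0 : R))) h1).
have Nz : N z <= rho by rewrite /z (normN_Z hN) Nu mulr1 cr.
have gr := loewner_growth a0 Hr hM (vsol z zB) Nz rr ar t0.
pose x := cofR (expR t) *: v z t.
have lx : cRe (l x) <= expR t * N (v z t).
  apply: le_trans (cRe_le _) _; apply: le_trans (lN _) _.
  by rewrite (normN_Z hN) cmod_cofR ger0_norm ?expR_ge0.
have lq : cRe (l (q z - x)) <= e.
  apply: le_trans (cRe_le _) _; apply: le_trans (HK _) _.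
  by rewrite mulrC -ler_pdivlMr // -supnormN opprB ltW.
rewrite /line_map -/z -[q z](subrK x) linearD cReD addrC.
by apply: lerD lq; exact: le_trans lx gr.
Qed.

(** With [f rho = rho + rho ^+ 2 * k rho] and [k] tending to the coefficient, the bound divided by
    [rho ^+ 2] gives [a] in the limit. *)
Lemma coef2_le (f : C -> C) (a r : R) : 0 < a -> 0 < r -> hol_off0 f 1 -> f 0 = 0 ->
  'D_1 f 0 = 1 ->
  (forall rho, 0 < rho < r -> rho < 1 -> 2 * a * rho < 1 ->
    cRe (f (cofR rho)) <= rho + a * rho ^+ 2 / (1 - 2 * a * rho)) ->
  cRe (coef2 f) <= a.
Proof.
move=> a0 r0 fh f0 df H; rewrite leNgt; apply/negP => lt.
have [b ab bc] : exists2 b, a < b & b < cRe (coef2 f).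
  by exists ((a + cRe (coef2 f)) / 2); move: lt; move: (cRe _) => *; lra.
pose k := slope (slope f 0) 0.
have k0 : k 0 = coef2 f by rewrite /k {1}/slope eqxx.
have kh : hol_off0 k 1 by apply: hol_slope => //; exact: hol_slope.
have bc0 : 0 < cRe (coef2 f) - b by rewrite subr_gt0.
have c0 : cmod (0 : C) < 1 by rewrite cmod0 ltr01.
have [d d0 Hd] := (contCP _ _).1 (kh.1 _ c0) _ bc0.
have b0 := lt_trans a0 ab; have ba0 : 0 < b - a by rewrite subr_gt0.
(* For [rho <= c] one has [2 * a * b * rho < b - a], which is [a / (1 - 2 * a * rho) < b]. *)
pose c := (b - a) / (4 * a * b).
have cp : 0 < c by rewrite divr_gt0 // !mulr_gt0.
have [rho rho0 [rd rr r1 rc]] : exists2 rho : R, 0 < rho &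
    [/\ rho <= d / 2, rho <= r / 2, rho <= 1 / 2 & rho <= c].
  exists (Num.min (Num.min (d / 2) (r / 2)) (Num.min (1 / 2) c)).
    by rewrite !lt_min cp !divr_gt0.
  by split; rewrite !ge_min lexx ?orbT.
have abrho : 4 * a * b * rho <= b - a.
  by rewrite mulrC -ler_pdivlMr // !mulr_gt0.
have arho : 4 * a * rho <= 1.
  have : b * (4 * a * rho) <= b * 1.
    rewrite mulr1; apply: le_trans (_ : b - a <= b); last by rewrite gerBl ltW.
    by apply: le_trans abrho; rewrite le_eqVlt; apply/orP; left; apply/eqP; ring.
  by rewrite ler_pM2l.
have ar2 : 2 * a * rho < 1 by move: (mulr_gt0 a0 rho0) arho; lra.
have := H rho; rewrite rho0 => /(_ _ _ ar2) h.
have {}h : cRe (f (cofR rho)) <= rho + a * rho ^+ 2 / (1 - 2 * a * rho).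
  by apply: h; [move: rr r0 => *; lra | move: r1 => *; lra].
have cr : cmod (cofR rho - 0) < d.
  by rewrite subr0 cmod_cofR gtr0_norm //; move: rd d0 => *; lra.
have kr : b < cRe (k (cofR rho)).
  have := le_lt_trans (cRe_le_cmod _) (Hd _ cr); rewrite cReB k0 ltr_norml => /andP[h1 _].
  by move: h1; move: (cRe _) (cRe _) => *; lra.
have fE : f (cofR rho) = cofR rho + cofR (rho ^+ 2) * k (cofR rho).
  rewrite (slopeE f 0) (slopeE (slope f 0) 0) f0 {1}/slope eqxx df -/k !subr0 add0r.
  by rewrite mulrDr mulr1 mulrA -cofRM.
move: h; rewrite fE cReD cRe_real cRe_cofR lerD2l [_ * _ / _]mulrAC => h.
have : b * rho ^+ 2 < a / (1 - 2 * a * rho) * rho ^+ 2.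
  by apply: lt_le_trans h; rewrite [ltLHS]mulrC ltr_pM2l // exprn_gt0.
rewrite ltr_pM2r ?exprn_gt0 // ltr_pdivlMr ?subr_gt0 //.
by move: abrho ba0 => *; lra.
Qed.

Lemma S0g_coef2_le (q : X -> X) l (u : X) : S0g N g q -> N u = 1 ->
  (forall x, cmod (l x) <= N x) -> l u = 1 ->
  cRe (coef2 (line_map q l u)) <= cmod ('D_1 g 0).
Proof.
move=> qS Nu lN lu; apply/ler_addgt0Pr => e e0; set a := _ + e.
have ga : cmod ('D_1 g 0) < a by rewrite ltrDl.
have a0 := le_lt_trans (cmod_ge0 _) ga; have [r r0 Hr] := Re_lower_bound ga.
case: (qS) => qh qn _; have [L0 dL] := line_map_derive0 hN l qh qn Nu.
apply: (coef2_le a0 r0 (line_map_hol hN l qh Nu) L0); first by rewrite dL.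
by move=> rho rr r1 ar; exact: S0g_line_growth Hr rr r1 ar.
Qed.

End BallGrowth.

(** * The coefficient functional and unboundedness *)

Section RealAxis.
Context {R : realType}.
Local Notation C := (Cplx R).
Variable g : C -> C.
Hypothesis gh : hol_off0 g 1.
Hypothesis gi : inj_on_disc g 1.
Hypothesis g0 : g 0 = 1.
Hypothesis g_conj : forall z : C, cmod z < 1 -> g (cconj z) = cconj (g z).
Variables (K d : R).
Hypothesis K0 : 0 < K.
Hypothesis d0 : 0 < d.
Hypothesis gK : forall x : R, 1 - d < x < 1 -> cmod (g (cofR x)) <= K * (1 - x).

Lemma g_real (x : R) : `|x| < 1 -> g (cofR x) = cofR (cRe (g (cofR x))).
Proof.
move=> x1; have := g_conj (z := cofR x); rewrite cmod_cofR => /(_ x1).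
have -> : cconj (cofR x) = cofR x :> C by rewrite /cconj /cofR /real_complex_def /= oppr0.
case: (g (cofR x)) => a b /= [] /eqP; rewrite -addr_eq0 -mulr2n mulrn_eq0 /= => /eqP ->.
by [].
Qed.

Lemma g_real_cont (x : R) : `|x| < 1 -> {for x, continuous (fun t => cRe (g (cofR t)))}.
Proof.
move=> x1; apply: (@cont_Re R (fun t => g (cofR t))).
have c1 : cmod (cofR x) < 1 by rewrite cmod_cofR.
apply/contRP => e e0; have [r r0 Hr] := (contCP _ _).1 (gh.1 _ c1) e e0.
by exists r => // y yx; apply: Hr; rewrite -cofRB cmod_cofR.
Qed.

(* Otherwise [g] would take the value [1 = g 0] again on [(0,1)], as it tends to
   [0] at [1]. *)
Lemma g_real_le1 (x : R) : 0 < x < 1 -> cRe (g (cofR x)) <= 1.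
Proof.
move=> /andP[x0 x1]; rewrite leNgt; apply/negP => lt.
have [y [xy y1 yle]] : exists y, [/\ x <= y, y < 1 & cRe (g (cofR y)) <= 1].
  pose s := Num.min (Num.min (d / 2) (1 / K)) (1 - x).
  have s0 : 0 < s by rewrite !lt_min !divr_gt0 // subr_gt0.
  have [sd sK sx] : [/\ s <= d / 2, s <= 1 / K & s <= 1 - x].
    by split; rewrite !ge_min lexx ?orbT.
  exists (1 - s); split; [by rewrite lerBrDr addrC -lerBrDr|by rewrite gtrBl|].
  apply: le_trans (cRe_le _) _; apply: le_trans (gK _) _.
    by rewrite gtrBl s0 andbT ltrD2l ltrN2 (le_lt_trans sd) // ltr_pdivrMr // ltr_pMr // ltr1n.
  by rewrite subKr mulrC -ler_pdivlMr.
have n1 t : x <= t <= y -> `|t| < 1.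
  by move=> /andP[xt ty]; rewrite ger0_norm ?(le_lt_trans ty) // (le_trans _ xt) // ltW.
have cont : {within `[x, y], continuous (fun t => cRe (g (cofR t)))}.
  by apply: within_cont => t txy; apply: g_real_cont; exact: n1.
have [|t] := IVT (v := 1) xy cont.
  by rewrite ge_min yle orbT le_max (ltW lt).
rewrite in_itv /= => txy gt; have t1 := n1 t txy.
have : cofR t = 0 :> C.
  by apply: gi; [rewrite cmod_cofR|rewrite cmod0|rewrite (g_real t1) gt g0].
move=> /eqP; rewrite cofR_eq0 => /eqP t0.
by case/andP: txy => + _; rewrite t0 leNgt x0.
Qed.

(** Difference quotients at 0 along the positive real axis are real, and nonpositive by
    [g_real_le1]. *)
Lemma derive_g0 : 'D_1 g 0 = - cofR (cmod ('D_1 g 0)) :> C.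
Proof.
have c0 : cmod (0 : C) < 1 by rewrite cmod0.
have /deriveCP dg := diff_derive (removable gh c0); set D := 'D_1 g 0 in dg *.
have key e : 0 < e -> `|cIm D| <= e /\ cRe D <= e.
  move=> e0; have [r r0 Hr] := dg e e0; pose x := Num.min (r / 2) (1 / 2).
  have x0 : 0 < x by rewrite lt_min !divr_gt0.
  have [xr x1] : x <= r / 2 /\ x <= 1 / 2 by split; rewrite ge_min lexx ?orbT.
  have xlt1 : x < 1 by lra.
  have := Hr (cofR x); rewrite subr0 cmod_cofR (gtr0_norm x0) => /(_ ltac:(lra)).
  have xn : `|x| < 1 by rewrite (gtr0_norm x0).
  rewrite g0 (g_real xn) => h.
  have gx := @g_real_le1 x; rewrite x0 xlt1 in gx; have {}gx := gx isT.
  have h1 := le_trans (cIm_le_cmod _) h; have h2 := le_trans (cRe_le_cmod _) h.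
  rewrite !cImB mulrC cIm_real (_ : cIm 1 = 0) // cIm_cofR subrr sub0r normrN in h1.
  rewrite normrM (gtr0_norm x0) [e * x]mulrC ler_pM2l // in h1; split=> //.
  move: h2; rewrite !cReB mulrC cRe_real (_ : cRe 1 = 1) // cRe_cofR ler_norml => /andP[h2 _].
  by rewrite -(ler_pM2l x0); move: h2 gx; move: (cRe (g _)) (cRe D) => *; lra.
have im0 : cIm D = 0.
  by apply/eqP; rewrite -normr_le0; apply/ler_addgt0Pr => e /key[]; rewrite add0r.
have re0 : cRe D <= 0 by apply/ler_addgt0Pr => e /key[]; rewrite add0r.
have DE : D = cofR (cRe D) by apply: cplx_eq; rewrite ?cRe_cofR // cIm_cofR.
by rewrite {2}DE cmod_cofR ler0_norm // cofRN opprK.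
Qed.

Hypothesis g_Re : forall z : C, cmod z < 1 -> 0 < cRe (g z).
Variable Phi : C -> C.
Hypothesis dPhi : forall z, cmod z < 1 ->
  is_derive z 1 Phi (slope (fun w => (g w)^-1) 0 z).

Let chi (x : R) := cRe (Phi (cofR x)).

Let dchi (x : R) : `|x| < 1 -> is_derive x 1 chi (cRe (kfun g (cofR x))).
Proof.
move=> x1; have c1 : cmod (cofR x) < 1 by rewrite cmod_cofR.
apply: (@rderiv_Re R (fun t => Phi (cofR t))).
rewrite -[kfun _ _]mulr1.
exact: (rderiv_comp (phi := fun s => cofR s) (dPhi c1) (rderiv_cofR x)).
Qed.

Let chi_cont (x : R) : `|x| < 1 -> {for x, continuous chi}.
Proof.
move=> x1; have c1 : cmod (cofR x) < 1 by rewrite cmod_cofR.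
apply: (@cont_Re R (fun t => Phi (cofR t))).
exact: (rderiv_cont (rderiv_comp (phi := fun s => cofR s) (dPhi c1) (rderiv_cofR x))).
Qed.

(** With [q = 1 / g x] the derivative is [(q - 1) / x]; the [2] comes from [x * (q - 2) <= q - 1],
    valid for [q >= 0] and [1 / 2 <= x <= 1]. *)
Let chi_slope (x : R) : 2^-1 <= x < 1 -> 1 - d < x ->
  (K * (1 - x))^-1 - 2 <= cRe (kfun g (cofR x)).
Proof.
move=> /andP[x2 x1] xd; have x0 : 0 < x by apply: lt_le_trans x2; rewrite invr_gt0.
have c1 : cmod (cofR x) < 1 by rewrite cmod_cofR gtr0_norm.
have x1' : `|x| < 1 by rewrite gtr0_norm.
have Kx : 0 < K * (1 - x) by rewrite mulr_gt0 // subr_gt0.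
have gp := g_Re c1; have le : (K * (1 - x))^-1 <= (cRe (g (cofR x)))^-1.
  rewrite lef_pV2 ?posrE //; apply: le_trans (cRe_le _) (gK _).
  by rewrite xd.
have := kfunE g0 (cofR x); rewrite g_real // -cofRV => /(congr1 (@cRe R)).
rewrite cRe_real cReB cRe_cofR (_ : cRe 1 = 1) //.
have ip : 0 < (cRe (g (cofR x)))^-1 by rewrite invr_gt0.
move: le ip; set p := (K * _)^-1; set q := (cRe _)^-1; set k := cRe (kfun _ _).
clearbody p q k => pq q0 E.
have q1 : 0 <= q * (1 - x) by rewrite mulr_ge0 ?subr_ge0 // ltW.
apply: le_trans (_ : q - 2 <= _); first by rewrite lerD2r.
by rewrite -(ler_pM2l x0) E; move: q1 x2; rewrite mulrBr mulrBr mulr1 [q * x]mulrC => *; lra.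
Qed.

(* Halving the distance to [1] increases [chi] by a fixed amount, because
   [chi' x >= 1 / (K (1 - x)) - 2]. *)
Lemma Re_Phi_unbounded (M : R) : exists2 x : R, 2^-1 <= x < 1 & M < chi x.
Proof.
(* Moving halfway towards 1 gains [(1 - x) / (2 * K * (1 - x)) = 2 * c] and loses [1 - x <= c], so
   each step adds at least [c]. *)
pose c := (4 * K)^-1; have c0 : 0 < c by rewrite invr_gt0 mulr_gt0.
have [x0 [x02 x01 x0d x0c]] : exists x0 : R, [/\ 2^-1 <= x0, x0 < 1, 1 - d < x0 & 1 - x0 <= c].
  pose s := Num.min (Num.min (d / 2) 2^-1) c.
  have s0 : 0 < s by rewrite !lt_min c0 divr_gt0 // invr_gt0 ltr0n.
  have [sd s2 sc] : [/\ s <= d / 2, s <= 2^-1 & s <= c].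
    by split; rewrite !ge_min lexx ?orbT.
  by exists (1 - s); split; [lra|lra|lra|rewrite subKr].
have step j : exists2 x, x0 <= x < 1 & chi x0 + j%:R * c <= chi x.
  elim: j => [|j [x /andP[xx x1] IH]].
    by exists x0; rewrite ?lexx // mul0r addr0.
  pose y := (1 + x) / 2; have xy : x < y by rewrite /y; lra.
  have y1 : y < 1 by rewrite /y; lra.
  have xp : 0 < x by apply: lt_le_trans xx; apply: lt_le_trans x02; rewrite invr_gt0.
  have n1 t : x <= t <= y -> `|t| < 1.
    by move=> /andP[xt ty]; rewrite gtr0_norm ?(le_lt_trans ty) // (lt_le_trans xp).
  have [||t tI tE] := @MVT R chi (fun t => cRe (kfun g (cofR t))) x y xy.
  - by move=> t; rewrite in_itv /= => /andP[xt ty]; apply: dchi; apply: n1; rewrite !ltW.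
  - by apply: within_cont => t /n1; exact: chi_cont.
  exists y; first by rewrite y1 andbT (le_trans xx) // ltW.
  move: tI; rewrite in_itv /= => /andP[xt ty].
  have st : (K * (1 - t))^-1 - 2 <= cRe (kfun g (cofR t)).
    apply: chi_slope; first by rewrite (lt_trans ty y1) andbT; lra.
    by apply: lt_trans xt; exact: lt_le_trans xx.
  have st2 : (K * (1 - x))^-1 <= (K * (1 - t))^-1.
    rewrite lef_pV2 ?posrE ?mulr_gt0 ?subr_gt0 ?(lt_trans ty y1) //.
    by rewrite ler_pM2l // lerD2l lerN2 ltW.
  have yx : y - x = (1 - x) / 2 by rewrite /y; lra.
  have x1' : 0 < 1 - x by rewrite subr_gt0.
  have E1 : (K * (1 - x))^-1 * ((1 - x) / 2) = c + c.
    by rewrite /c; field; rewrite !gt_eqF.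
  have : ((K * (1 - x))^-1 - 2) * (y - x) <= chi y - chi x.
    rewrite tE ler_wpM2r ?subr_ge0 ?(ltW xy) //; apply: le_trans st.
    by rewrite lerD2r.
  rewrite yx mulrBl E1 -(@natr1 _ j) [(_ + 1) * c]mulrDl mul1r.
  have xc : 1 - x <= c by apply: le_trans x0c; rewrite lerD2l lerN2.
  by move: IH xc; move: (chi x) (chi y) (chi x0) (j%:R * c) => *; lra.
have [j Hj] : exists j : nat, (M - chi x0) / c < j%:R.
  exists (Num.truncn `|(M - chi x0) / c|).+1.
  apply: le_lt_trans (ler_norm _) _; exact: truncnS_gt.
have [x /andP[xx x1] Hx] := step j; exists x; first by rewrite x1 (le_trans x02).
apply: lt_le_trans Hx; rewrite ltr_pdivrMr // in Hj.
by rewrite addrC -ltrBlDr.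
Qed.

End RealAxis.

(** * The second coefficient as a continuous linear functional *)

Section CoefficientFunctional.
Context {R : realType} {n : nat}.
Local Notation C := (Cplx R).
Local Notation X := 'rV[Cplx R]_n.
Variable N : X -> R.
Hypothesis hN : is_norm N.
Variables (l : {linear X -> C}) (u : X).
Hypothesis Nu : N u = 1.

(** Cauchy's integral for the coefficient on the circle of radius 1/2: it involves only the values
    of [q] on a compact subset of the ball, which is what continuity requires. *)
Definition coef2_functional (q : mapsB N) : C :=
  cmean (fun w => line_map q l u w / w ^+ 2) 2^-1.

Let half_lt1 : 0 < (2^-1 : R) < 1.
Proof. by rewrite invr_gt0 ltr0n invf_lt1 ?ltr1n. Qed.

Lemma coef2_functionalE (q : X -> X) : holB N q ->
  coef2_functional q = coef2 (line_map q l u).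
Proof. by move=> qh; exact: (cmean_coef2 (line_map_hol hN l qh Nu) half_lt1). Qed.

Let integrand_cont (q : X -> X) : holB N q ->
  circle_cont (fun w => line_map q l u w / w ^+ 2) 2^-1.
Proof.
move=> qh t; have /andP[h0 h1] := half_lt1.
have cw : cmod (cofR 2^-1 * cis t) = 2^-1 :> R by rewrite circle_norm // ltW.
apply: contM; first by apply: (line_map_hol hN l qh Nu).1; rewrite cw.
apply: (@contV _ _ (fun w : C => w ^+ 2)); first by rewrite expf_neq0 // -cmod_gt0 cw.
exact: (@contX _ _ (fun w : C => w) _ 2 (cont_idC _)).
Qed.

Lemma coef2_functional_continuous_linear : continuous_linear_functional coef2_functional.
Proof.
have /andP[h0 h1] := half_lt1.
have cw t : cmod (cofR 2^-1 * cis t) = 2^-1 :> R by rewrite circle_norm // ltW.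
split.
  move=> a f q fh qh; have fc := integrand_cont fh; have qc := integrand_cont qh.
  have ac : circle_cont (fun w => a * (line_map f l u w / w ^+ 2)) 2^-1.
    by move=> t; exact: contM (cont_cst _ _) (fc t).
  rewrite /coef2_functional -(cmeanZ a fc) -(cmeanD ac qc); apply: cmean_eq => t.
  by rewrite /line_map linearD functionalZ mulrDl mulrA.
apply/subspace_continuousP => q qh; apply: (cvgCP _ _).2 => e e0.
pose A := [set cofR 2^-1 * w *: u | w in [set w : C | cmod w = 1]].
have cA : compactly_in (unit_ball N) A.
  split.
    by move=> _ [w /= w1 <-]; apply: (unit_ball_line hN Nu); rewrite cmodM w1 mulr1 cmod_cofR gtr0_norm.
  apply: continuous_compact; last exact: circle_compact.
  apply: continuous_subspaceT => w.
  have dw : differentiable (fun w : C => (cofR 2^-1 * w) *: u) w.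
    by apply: differentiableZl; exact: (diffC_M (diff_cstC _ _) (diff_id _)).
  exact: differentiable_continuous dw.
(* The integrands differ by at most [4 * K * r], as [w ^+ 2] has modulus 1/4, and [cmean_bound]
   doubles this to [e / 2]. *)
have [K K0 HK] := linear_bound l; pose r := e / (16 * K).
have r0 : 0 < r by rewrite divr_gt0 // mulr_gt0.
have near_q := family_nbhsX q r0 cA.
rewrite /within /=; apply: filterS near_q => f Hf fh.
have fc := integrand_cont fh; have qc := integrand_cont qh.
rewrite /coef2_functional -(cmeanB fc qc).
have dc : circle_cont (fun w => line_map f l u w / w ^+ 2 - line_map q l u w / w ^+ 2) 2^-1.
  by move=> t; exact: contB (fc t) (qc t).
apply: le_lt_trans (cmean_bound (M := K * r * 4) dc _) _; last first.
  have -> : 2 * (K * r * 4) = e / 2 by rewrite /r; field; rewrite gt_eqF.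
  by move: e0; lra.
move=> t; rewrite -mulrBl cmodM cmodV cmodX cw -exprVn invrK.
have -> : (2 ^+ 2 : R) = 4 by ring.
rewrite ler_wpM2r // /line_map -linearB; apply: le_trans (HK _) _.
rewrite ler_pM2l // ltW //; apply: Hf; exists (cis t) => //=.
by have := circle_norm t (ler01 : (0 : R) <= 1); rewrite cofR1 mul1r.
Qed.

End CoefficientFunctional.

(** * The second coefficient of the extremal map *)

Section ExtremalCoefficient.
Context {R : realType}.
Local Notation C := (Cplx R).

Lemma coef2_mul (p : C -> C) (e : C) : is_derive (0 : C) 1 p e -> coef2 (fun w => w * p w) = e.
Proof.
move=> dp; have df := deriveC_M (deriveC_id 0) dp; rewrite /coef2.
have -> : slope (fun w => w * p w) 0 = p.
  apply/funext => w; rewrite /slope; case: eqP => [->|/eqP w0].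
    by case: df => _ ->; rewrite mul1r mul0r addr0.
  by rewrite mul0r !subr0 mulrC mulKf.
by case: dp.
Qed.

Context {n : nat}.
Local Notation X := 'rV[Cplx R]_n.
Variables g Phi : C -> C.
Hypothesis gh : hol_off0 g 1.
Hypothesis g0 : g 0 = 1.
Hypothesis g_Re : forall z : C, cmod z < 1 -> 0 < cRe (g z).
Hypothesis Phi0 : Phi 0 = 0.
Hypothesis dPhi : forall z, cmod z < 1 ->
  is_derive z 1 Phi (slope (fun w => (g w)^-1) 0 z).

(** [l] shapes the map while [m] reads the coefficient. Keeping them apart covers both [l = m], the
    extremal map, and [l = 0], the identity. *)
Lemma coef2_fext (l m : {linear X -> C}) (u : X) : m u = 1 ->
  coef2 (line_map (fext Phi l) m u) = - 'D_1 g 0 * l u.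
Proof.
move=> mu; have -> : line_map (fext Phi l) m u = fun w => w * cexp (Phi (w * l u)).
  by apply/funext => w; rewrite /line_map /fext !functionalZ mu mulr1 mulrC.
apply: coef2_mul; rewrite -(kfun0 gh g0 g_Re).
have c0 : cmod (0 * l u) < 1 by rewrite mul0r cmod0 ltr01.
have d1 : is_derive (0 : C) 1 (fun w => w * l u) (l u).
  by apply: deriveC_eq (deriveC_M (deriveC_id 0) (deriveC_cst (l u) 0)); rewrite mul1r mul0r addr0.
have := is_derive_comp (h := fun w => w * l u) (z := 0) (derive_expPhi dPhi c0) d1.
by rewrite mul0r Phi0 cexp0 mul1r.
Qed.

End ExtremalCoefficient.

(** * Extremality and unboundedness of [fext] *)

Theorem theorem1p8 (R : realType) (n : nat) (hn : (0 < n)%N)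
    (N : 'rV[Cplx R]_n -> R) (hN : is_norm N)
    (g : Cplx R -> Cplx R)
    (g_holo : holomorphic_on (unit_disc R) g)
    (g_univalent : {in unit_disc R &, injective g})
    (g0 : g 0 = 1)
    (g_conj : forall z, unit_disc R z -> g (cconj z) = cconj (g z))
    (g_Re : forall z, unit_disc R z -> 0 < cRe (g z))
    (g_O : (fun r : R => g (cofR r)) =O_ ((1 : R)^'-)
           (fun r : R => cofR (1 - r))) :
  exists f : 'rV[Cplx R]_n -> 'rV[Cplx R]_n,
    support_point (S0g N g) f /\ unbounded_on_ball N f.
Proof.
have gh : hol_off0 g 1 by apply: hol_intro => z z1; exact: g_holo.
have gi : inj_on_disc g 1.
  by move=> z w z1 w1; apply: g_univalent; exact: mem_set.
have c0 : cmod (0 : Cplx R) < 1 by rewrite cmod0.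
have [K K0 [d d0 gK]] : exists2 K : R, 0 < K & exists2 d : R, 0 < d &
    forall x : R, 1 - d < x < 1 -> cmod (g (cofR x)) <= K * (1 - x).
  have [_ /pos_cofR[K K0 ->] /(nbhsRP 1 _).1[d d0 Hd]] := (eqO_exP _ _ _).1 g_O.
  exists K => //; exists d => // x /andP[xd x1].
  have := Hd x; rewrite ltr0_norm ?subr_lt0 // opprB ltrBlDr addrC -ltrBlDr.
  move=> /(_ xd x1); rewrite !normCE -cofRM cofR_le cmod_cofR gtr0_norm //.
  by rewrite subr_gt0.
have [u Nu] : exists u, N u = 1.
  pose x : 'rV[Cplx R]_n := delta_mx 0 (Ordinal hn).
  have x0 : x != 0.
    apply/eqP => /matrixP /(_ 0 (Ordinal hn)) /eqP.
    by rewrite !mxE !eqxx /= oner_eq0.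
  exists (cofR (N x)^-1 *: x); have Nx := normN_gt0 hN x0.
  by rewrite (normN_Z hN) cmod_cofR ger0_norm ?invr_ge0 ?ltW // mulVf // gt_eqF.
have [l [lN lu]] := hahn_banach hN u; rewrite Nu cofR1 in lu.
have [Phi [Phi0 dPhi]] := primitive ltr01 (hol_slope ltr01 (inv_g_hol gh g_Re)).
have fS := fext_S0g gh g0 g_Re Phi0 dPhi hN lN.
exists (fext Phi l); split.
  split=> //; exists (coef2_functional l u).
  have LE q : S0g N g q -> coef2_functional l u q = coef2 (line_map q l u).
    by case=> qh _ _; exact: coef2_functionalE.
  have fE : coef2_functional l u (fext Phi l : mapsB N) = cofR (cmod ('D_1 g 0)).
    by rewrite LE // (coef2_fext gh g0 g_Re Phi0 dPhi _ lu) lu mulr1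
      [X in - X](derive_g0 gh gi g0 g_conj K0 d0 gK) opprK.
  split.
  - exact: coef2_functional_continuous_linear.
  (* For the zero functional the construction yields the identity, so the same lemma places it in
     the class. *)
  - case=> c Hc; have [l' l'E] := scaled_functional l 0.
    have l'N x : cmod (l' x) <= N x by rewrite l'E mul0r cmod0 normN_ge0.
    have qS := fext_S0g gh g0 g_Re Phi0 dPhi hN l'N.
    have := Hc _ qS; rewrite LE // (coef2_fext gh g0 g_Re Phi0 dPhi _ lu) l'E mul0r mulr0 => c0'.
    (* Equal values at the two maps would mean [g'(0) = 0], which univalence excludes. *)
    have := Hc _ fS; rewrite fE -c0' cRe_cofR => /eqP; rewrite cmod_eq0.
    by rewrite (negPf (injective_derive_neq0 gh gi c0)).
  - move=> q qS; rewrite fE cRe_cofR LE //.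
    exact: (S0g_coef2_le hN gh gi g0 g_Re qS Nu lN lu).
case=> M HM.
(* At [x u] the map has norm [x * e^s], where [s > 2 * |M|] is the real part of [Phi x]. As
   [x >= 1/2] and [e^s >= 1 + s], this exceeds [|M|]. *)
have [x /andP[x2 x1] Hx] := Re_Phi_unbounded g0 g_conj K0 d0 gK g_Re dPhi (2 * `|M|).
have x0 : 0 < x by apply: lt_le_trans x2; rewrite invr_gt0.
have xB : unit_ball N (cofR x *: u).
  by apply: (unit_ball_line hN Nu); rewrite cmod_cofR gtr0_norm.
have := HM _ xB; rewrite /fext functionalZ lu mulr1 !(normN_Z hN) Nu mulr1.
rewrite cmod_cexp cmod_cofR gtr0_norm // leNgt => /negP; apply.
move: Hx; set s := cRe _ => Hx; have s1 := expR_ge1Dx s.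
apply: le_lt_trans (ler_norm M) _.
apply: lt_le_trans (_ : (1 + s) * 2^-1 <= _).
  by move: Hx; move: `|M| => *; lra.
by apply: ler_pM => //; have := normr_ge0 M; move: Hx; move: `|M| => *; lra.
Qed.
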